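(* Let $k$ be an algebraically closed field and let $A$ be a quasi-hereditary finite dimensional $k$-algebra with exactly two simple modules up to isomorphism. Then $A$ is Morita equivalent to one of the algebras $A_{s,t}$ with integers $s,t\geq 0$, where $A_{s,t}$ is the path algebra of the quiver with two vertices $1,2$, arrows $\alpha_1,\dots,\alpha_s\colon 1\to 2$ and $\beta_1,\dots,\beta_t\colon 2\to 1$, modulo the relations $\alpha_i\beta_j=0$ for all $1\leq i\leq s$ and $1\leq j\leq t$. For all $s,t\ge 0$, the subalgebra of $A_{s,t}$ spanned by the two trivial paths $e_1,e_2$ and the arrows $\alpha_1,\dots,\alpha_s$ is an exact Borel subalgebra of $A_{s,t}$. Moreover, the category $\mathcal F(\Delta)$ of $A_{s,t}$-modules filtered by standard modules is of finite representation type if and only if $s\leq 1$, and it is tame if and only if $s=2$.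
   Context: Modules are finite dimensional left modules; paths are composed from right to left (so $\alpha_i\beta_j$ means first $\beta_j$, then $\alpha_i$, a path from $2$ to $2$). For a family of modules $\Delta=\{\Delta(1),\dots,\Delta(n)\}$, $\mathcal F(\Delta)$ denotes the full subcategory of modules $M$ having a chain of submodules $0=N_0\subset N_1\subset\dots\subset N_r=M$ with each $N_{i+1}/N_i$ isomorphic to some $\Delta(j)$. Quasi-hereditary: a finite dimensional algebra $A$ with $n$ simple modules up to isomorphism is quasi-hereditary if there exist indecomposable modules $\Delta(1),\dots,\Delta(n)$ (the standard modules) such that: $\operatorname{End}_A(\Delta(i))\cong k$; $\operatorname{Hom}_A(\Delta(i),\Delta(j))\neq0\Rightarrow i\leq j$; $\operatorname{Ext}^1_A(\Delta(i),\Delta(j))\neq 0\Rightarrow i<j$; and $A\in\mathcal F(\Delta)$. Equivalently (after suitably ordering the simples), $\Delta(i)=P(i)/M(i)$ with $M(i)$ the sum of the images of all homomorphisms $P(j)\to P(i)$, $j>i$, and the indecomposable projectives $P(i)$ lie in $\mathcal F(\Delta)$. The algebra $A_{s,t}$ is regarded as quasi-hereditary with respect to the order $1<2$ of its vertices. Exact Borel subalgebra: a subalgebra $B\subseteq A$ of a quasi-hereditary algebra with the same number of simple modules, such that (B1) $B$ is directed, i.e. whenever there is an arrow $i\to j$ in the Gabriel quiver of $B$, then $i\leq j$; (B2) the functor $A\otimes_B-$ is exact; (B3) $A\otimes_B L_B(i)\cong\Delta(i)$ for all $i$, where $L_B(i)$ are the simple $B$-modules. Representation type of a full subcategory $\mathcal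 C\subseteq\operatorname{mod}A$ closed under direct sums and summands: $\mathcal C$ is of finite representation type if it contains only finitely many indecomposable modules up to isomorphism. $\mathcal C$ is tame if it is not of finite representation type and for each $d\geq1$ there are finitely many $A$-$k[T]$-bimodules $N^{(1)},\dots,N^{(m)}$, free of finite rank over $k[T]$, such that all but finitely many isomorphism classes of indecomposable modules in $\mathcal C$ of dimension $d$ are of the form $N^{(i)}\otimes_{k[T]}k_\lambda$ for some $i$ and some simple $k[T]$-module $k_\lambda$. *)

(* Defs.v *)
From HB Require Import structures.
From mathcomp Require Import all_boot all_order all_algebra all_field.

Set Implicit Arguments.
Unset Strict Implicit.
Unset Printing Implicit Defensive.

Import GRing.Theory.
Local Open Scope ring_scope.

Record fdmod (k : fieldType) (A : falgType k) := FdMod {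
  fdm_space :> vectType k;
  fdm_act : {linear A -> 'End(fdm_space)};
  fdm_act1 : forall v, fdm_act 1 v = v;
  fdm_actM : forall a b v, fdm_act (a * b) v = fdm_act a (fdm_act b v)
}.

Section Modules.
Variables (k : fieldType) (A : falgType k).
Implicit Types M N E X : fdmod A.

Fact regular_act1 (v : A) : amull 1 v = v.
Proof. by rewrite lfunE /= mul1r. Qed.

Fact regular_actM (a b v : A) : amull (a * b) v = amull a (amull b v).
Proof. by rewrite !lfunE /= mulrA. Qed.

Definition regular_fdmod : fdmod A :=
  @FdMod k A A (@amull k A : {linear A -> 'End(A)}) regular_act1 regular_actM.

Definition is_submod M (U : {vspace M}) : Prop :=
  forall a, (fdm_act M a @: U <= U)%VS.

(* A-linearity on the subset U; a homomorphism from a submodule U of M to N is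
   encoded as (the restriction to U of) a k-linear map M -> N of this kind. *)
Definition hom_on M N (U : {vspace M}) (f : 'Hom(M, N)) : Prop :=
  forall a x, x \in U -> f (fdm_act M a x) = fdm_act N a (f x).

Definition is_hom M N (f : 'Hom(M, N)) : Prop := hom_on fullv f.

Definition is_iso M N (f : 'Hom(M, N)) : Prop :=
  [/\ is_hom f, lker f = 0%VS & limg f = fullv].

Definition isomorphic M N : Prop := exists f : 'Hom(M, N), is_iso f.

Definition simple_mod M : Prop :=
  (fullv : {vspace M}) <> 0%VS /\
  forall U : {vspace M}, is_submod U -> U = 0%VS \/ U = fullv.

Definition indecomposable M : Prop :=
  (fullv : {vspace M}) <> 0%VS /\
  forall U V : {vspace M}, is_submod U -> is_submod V ->
    (U + V)%VS = fullv -> (U :&: V)%VS = 0%VS -> U = 0%VS \/ V = 0%VS.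

Definition complete_simples n (L : 'I_n -> fdmod A) : Prop :=
  [/\ forall i, simple_mod (L i),
      forall i j, isomorphic (L i) (L j) -> i = j
    & forall S, simple_mod S -> exists i, isomorphic S (L i)].

Definition short_exact N E M (i : 'Hom(N, E)) (p : 'Hom(E, M)) : Prop :=
  [/\ is_hom i, is_hom p, lker i = 0%VS, limg i = lker p & limg p = fullv].

Definition Hom_nonzero M N : Prop := exists2 f : 'Hom(M, N), is_hom f & f <> 0.

(* Yoneda Ext^1: the zero class is the class of the split extensions. *)
Definition Ext1_nonzero M N : Prop :=
  exists (E : fdmod A) (i : 'Hom(N, E)) (p : 'Hom(E, M)),
    short_exact i p /\
    ~ exists2 s : 'Hom(M, E), is_hom s & (p \o s)%VF = \1%VF.

(* The structure map k -> End_A(M) is bijective. *)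
Definition End_is_k M : Prop :=
  forall f : 'End(M), is_hom f -> exists! c : k, f = c *: \1%VF.

(* V / U is isomorphic to D, for submodules U <= V of M: there is a surjective
   homomorphism V -> D with kernel U. *)
Definition subquot_iso M (V U : {vspace M}) (D : fdmod A) : Prop :=
  exists f : 'Hom(M, D),
    [/\ hom_on V f, (f @: V)%VS = fullv & (V :&: lker f)%VS = U].

Definition filtered n (Delta : 'I_n -> fdmod A) M : Prop :=
  exists (r : nat) (N : nat -> {vspace M}),
    [/\ N 0 = 0%VS, N r = fullv,
        forall i, (i <= r)%N -> is_submod (N i)
      & forall i, (i < r)%N ->
          (N i <= N i.+1)%VS /\ exists j, subquot_iso (N i.+1) (N i) (Delta j)].

Definition standard_system n (Delta : 'I_n -> fdmod A) : Prop :=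
  [/\ forall i, indecomposable (Delta i),
      forall i, End_is_k (Delta i),
      forall i j, Hom_nonzero (Delta i) (Delta j) -> (i <= j)%N,
      forall i j, Ext1_nonzero (Delta i) (Delta j) -> (i < j)%N
    & filtered Delta regular_fdmod].

Definition has_n_simples n : Prop :=
  exists L : 'I_n -> fdmod A, complete_simples L.

Definition quasi_hereditary n : Prop :=
  has_n_simples n /\ exists Delta : 'I_n -> fdmod A, standard_system Delta.

(* The standard modules for an ordered complete system e of primitive
   orthogonal idempotents: Delta i = P i / T, with P i = A e_i and T the sum
   (least upper bound) of the images of all homomorphisms P j -> P i, j > i.  *)
Definition proj_of (e : A) : {vspace regular_fdmod} := limg (amulr e).

Definition contains_images n (e : 'I_n -> A) (i : 'I_n)
    (T : {vspace regular_fdmod}) : Prop :=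
  forall (j : 'I_n) (f : 'Hom(regular_fdmod, regular_fdmod)), (i < j)%N ->
    hom_on (proj_of (e j)) f ->
    (f @: proj_of (e j) <= proj_of (e i))%VS ->
    (f @: proj_of (e j) <= T)%VS.

Definition is_trace n (e : 'I_n -> A) (i : 'I_n)
    (T : {vspace regular_fdmod}) : Prop :=
  contains_images e i T /\ forall W, contains_images e i W -> (T <= W)%VS.

Definition standard_modules n (e : 'I_n -> A) (Delta : 'I_n -> fdmod A) : Prop :=
  forall i, exists2 T, is_trace e i T & subquot_iso (proj_of (e i)) T (Delta i).

(* A full subcategory is given by its class C of objects. *)
Definition finite_type (C : fdmod A -> Prop) : Prop :=
  exists (m : nat) (M : 'I_m -> fdmod A),
    forall X, C X -> indecomposable X -> exists i, isomorphic X (M i).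

(* A-k[T]-bimodules, free of finite rank over k[T] (this is what vectType says
   over the ring k[T]), with k acting centrally; as k[T] is commutative the
   right action is written on the left. *)
Record bimod := Bimod {
  bm_space :> vectType {poly k};
  bm_act : A -> 'End(bm_space);
  bm_act_linear : forall c a b,
    bm_act (c *: a + b) = c%:P *: bm_act a + bm_act b;
  bm_act1 : forall v, bm_act 1 v = v;
  bm_actM : forall a b v, bm_act (a * b) v = bm_act a (bm_act b v)
}.

End Modules.

Section Tensor.
Variables (S : nzRingType) (N L : zmodType).
Variables (ract : N -> S -> N) (lact : S -> L -> L).

(* The tensor product of N and L over S, by its universal property; ract is a
   right action of S on N and lact a left action on L. *)
Definition balanced (V : zmodType) (t : N -> L -> V) : Prop :=
  [/\ forall x y l, t (x + y) l = t x l + t y l,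
      forall x l m, t x (l + m) = t x l + t x m
    & forall x s l, t (ract x s) l = t x (lact s l)].

Definition is_tensor (T : zmodType) (t : N -> L -> T) : Prop :=
  balanced t /\
  forall (V : zmodType) (h : N -> L -> V), balanced h ->
    exists2 g : {additive T -> V},
      forall x l, g (t x l) = h x l
    & forall g' : {additive T -> V}, (forall x l, g' (t x l) = h x l) ->
        g' =1 g.

End Tensor.

Section Tame.
Variables (k : fieldType) (A : falgType k).

(* X is isomorphic to N (x)_{k[T]} k_lambda, with k_lambda = k on which a
   polynomial p acts as p(lambda). *)
Definition specialization (N : bimod A) (lambda : k) (X : fdmod A) : Prop :=
  exists t : N -> k -> X,
    is_tensor (fun (x : N) (p : {poly k}) => p *: x)
              (fun (p : {poly k}) (c : k) => p.[lambda] * c) t /\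
    forall a x c, t (bm_act N a x) c = fdm_act X a (t x c).

(* Over an algebraically closed field the k_lambda are all the simple
   k[T]-modules. *)
Definition tame (C : fdmod A -> Prop) : Prop :=
  ~ finite_type C /\
  forall d, (0 < d)%N ->
    exists (m : nat) (N : 'I_m -> bimod A) (r : nat) (E : 'I_r -> fdmod A),
      forall X : fdmod A, C X -> indecomposable X -> \dim {:X} = d ->
        (exists i, isomorphic X (E i)) \/
        (exists i lambda, specialization (N i) lambda X).

End Tame.

Section Borel.
Variables (k : fieldType) (A : falgType k).

Definition sub_ract (B : {aspace A}) (a : A) (b : subvs_of B) : A :=
  a * vsval b.

Definition sub_lact (B : {aspace A}) (X : fdmod (subvs_of B))
  (b : subvs_of B) (x : X) : X := fdm_act X b x.

(* T is the underlying group of A (x)_B X, with a (x) x written t a x. *)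
Definition is_induced (B : {aspace A}) (X : fdmod (subvs_of B)) (T : zmodType)
    (t : A -> X -> T) : Prop :=
  is_tensor (@sub_ract B) (@sub_lact B X) t.

Definition induced_iso (B : {aspace A}) (X : fdmod (subvs_of B)) (D : fdmod A) :
  Prop :=
  exists t : A -> X -> D, is_induced t /\
    forall a a' x, t (a * a') x = fdm_act D a (t a' x).

Definition induction_exact (B : {aspace A}) : Prop :=
  forall (X Y Z : fdmod (subvs_of B)) (f : 'Hom(X, Y)) (g : 'Hom(Y, Z)),
    short_exact f g ->
  forall (TX TY TZ : zmodType)
    (tX : A -> X -> TX) (tY : A -> Y -> TY) (tZ : A -> Z -> TZ),
    is_induced tX -> is_induced tY -> is_induced tZ ->
  forall (F : {additive TX -> TY}) (G : {additive TY -> TZ}),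
    (forall a x, F (tX a x) = tY a (f x)) ->
    (forall a y, G (tY a y) = tZ a (g y)) ->
    [/\ injective F,
        forall y, G y = 0 <-> exists x, F x = y
      & forall z, exists y, G y = z].

(* The number of arrows i -> j in the Gabriel quiver is dim Ext^1(L i, L j). *)
Definition directed (B : falgType k) n (L : 'I_n -> fdmod B) : Prop :=
  forall i j, Ext1_nonzero (L i) (L j) -> (i <= j)%N.

(* The subspace U of the quasi-hereditary algebra A with standard modules Delta
   is an exact Borel subalgebra.  An {aspace A} may have its own unit, hence
   the condition 1 \in U. *)
Definition exact_borel n (Delta : 'I_n -> fdmod A) (U : {vspace A}) : Prop :=
  [/\ has_n_simples A n, standard_system Delta, 1 \in U
    & exists2 B : {aspace A}, asval B = U
    & exists L : 'I_n -> fdmod (subvs_of B),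
        [/\ complete_simples L, directed L, induction_exact B
          & forall i, induced_iso (L i) (Delta i)]].

End Borel.

(* The values of fmap on k-linear maps that are not homomorphisms are
   irrelevant. *)
Record lin_functor (k : fieldType) (A B : falgType k) := LinFunctor {
  fobj :> fdmod A -> fdmod B;
  fmap : forall M N : fdmod A, 'Hom(M, N) -> 'Hom(fobj M, fobj N);
  fmap_hom : forall (M N : fdmod A) (f : 'Hom(M, N)),
    is_hom f -> is_hom (fmap f);
  fmap_id : forall M : fdmod A, @fmap M M \1%VF = \1%VF;
  fmap_comp : forall (M N P : fdmod A) (f : 'Hom(M, N)) (g : 'Hom(N, P)),
    is_hom f -> is_hom g -> fmap (g \o f)%VF = (fmap g \o fmap f)%VF;
  fmap_linear : forall (M N : fdmod A) (c : k) (f g : 'Hom(M, N)),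
    is_hom f -> is_hom g -> fmap (c *: f + g) = c *: fmap f + fmap g
}.

Definition inverse_up_to_iso (k : fieldType) (A B : falgType k)
    (F : lin_functor A B) (G : lin_functor B A) : Prop :=
  exists eta : forall M : fdmod A, 'Hom(G (F M), M),
    (forall M, is_iso (eta M)) /\
    forall (M N : fdmod A) (f : 'Hom(M, N)), is_hom f ->
      (eta N \o fmap G (fmap F f))%VF = (f \o eta M)%VF.

(* k-linear equivalence of the categories of finite dimensional modules. *)
Definition morita_equivalent (k : fieldType) (A B : falgType k) : Prop :=
  exists (F : lin_functor A B) (G : lin_functor B A),
    inverse_up_to_iso F G /\ inverse_up_to_iso G F.

(* The paths of the quiver that do not contain any of the forbidden paths
   alpha_i beta_j: these form a basis of the path algebra modulo the monomial
   relations.  BetaAlpha j i is the path beta_j alpha_i (first alpha_i). *)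
Inductive stpath (s t : nat) : Type :=
  | Triv of 'I_2
  | Alpha of 'I_s
  | Beta of 'I_t
  | BetaAlpha of 'I_t & 'I_s.

Arguments Triv {s t}.
Arguments Alpha {s t}.
Arguments Beta {s t}.
Arguments BetaAlpha {s t}.

Notation vtx1 := (ord0 : 'I_2).
Notation vtx2 := (ord_max : 'I_2).

Section Paths.
Variables s t : nat.
Local Notation path := (stpath s t).

Definition stpath_code (p : path) : 'I_2 + ('I_s + ('I_t + 'I_t * 'I_s)) :=
  match p with
  | Triv v => inl v
  | Alpha i => inr (inl i)
  | Beta j => inr (inr (inl j))
  | BetaAlpha j i => inr (inr (inr (j, i)))
  end.

Definition stpath_decode (c : 'I_2 + ('I_s + ('I_t + 'I_t * 'I_s))) : path :=
  match c with
  | inl v => Triv v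
  | inr (inl i) => Alpha i
  | inr (inr (inl j)) => Beta j
  | inr (inr (inr (j, i))) => BetaAlpha j i
  end.

Fact stpath_codeK : cancel stpath_code stpath_decode.
Proof. by case. Qed.

HB.instance Definition _ := Finite.copy path (can_type stpath_codeK).

Definition stsrc (p : path) : 'I_2 :=
  match p with
  | Triv v => v
  | Alpha _ | BetaAlpha _ _ => vtx1
  | Beta _ => vtx2
  end.

Definition sttgt (p : path) : 'I_2 :=
  match p with
  | Triv v => v
  | Alpha _ => vtx2
  | Beta _ | BetaAlpha _ _ => vtx1
  end.

(* The composite "first q, then p", None standing for 0. *)
Definition stcomp (p q : path) : option path :=
  match p, q with
  | Triv v, _ => if sttgt q == v then Some q else None
  | _, Triv v => if stsrc p == v then Some p else None
  | Beta j, Alpha i => Some (BetaAlpha j i)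
  | _, _ => None
  end.

Lemma stcompA p q r :
  obind (stcomp p) (stcomp q r) = obind (stcomp^~ r) (stcomp p q).
Proof.
by case: p => [v|i|j|j i]; case: q => [v'|i'|j'|j' i'];
  case: r => [v''|i''|j''|j'' i'']; rewrite /stcomp /=;
  repeat (case: eqP => //= ?; subst => //=); rewrite ?eqxx //;
  repeat (case: eqP => //= ?; subst => //=).
Qed.

End Paths.

(* k^o is k as a vector space over itself. *)
Definition Ast (k : fieldType) (s t : nat) : Type := {ffun stpath s t -> k^o}.

Section AstAlgebra.
Variables (k : fieldType) (s t : nat).
Local Notation path := (stpath s t).
Local Notation Ast := (Ast k s t).

HB.instance Definition _ := Vector.copy Ast {ffun path -> k^o}.

Definition Ast_path (p : path) : Ast := [ffun q => (q == p)%:R].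

Definition Ast_opath (o : option path) : Ast := oapp Ast_path 0 o.

Definition Ast_mul (x y : Ast) : Ast :=
  \sum_p \sum_q (x p * y q) *: Ast_opath (stcomp p q).

Definition Ast_one : Ast := \sum_v Ast_path (Triv v).

Lemma Ast_coord (x : Ast) : x = \sum_p x p *: Ast_path p.
Proof.
apply/ffunP => q; rewrite sum_ffunE (bigD1 q) //= big1 => [|p npq].
  by rewrite !ffunE eqxx addr0 [RHS]mulr1.
by rewrite !ffunE eq_sym (negPf npq) [LHS]mulr0.
Qed.

Fact Ast_mulDl : left_distributive Ast_mul +%R.
Proof.
move=> x y z; rewrite -big_split; apply: eq_bigr => p _ /=.
rewrite -big_split; apply: eq_bigr => q _ /=.
by rewrite ffunE mulrDl scalerDl.
Qed.

Fact Ast_mulDr : right_distributive Ast_mul +%R.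
Proof.
move=> x y z; rewrite -big_split; apply: eq_bigr => p _ /=.
rewrite -big_split; apply: eq_bigr => q _ /=.
by rewrite ffunE mulrDr scalerDl.
Qed.

Fact Ast_scaleAl (c : k) x y : c *: Ast_mul x y = Ast_mul (c *: x) y.
Proof.
rewrite scaler_sumr; apply: eq_bigr => p _; rewrite scaler_sumr.
apply: eq_bigr => q _; rewrite scalerA ffunE.
by congr (_ *: _); apply: mulrA.
Qed.

Fact Ast_scaleAr (c : k) x y : c *: Ast_mul x y = Ast_mul x (c *: y).
Proof.
rewrite scaler_sumr; apply: eq_bigr => p _; rewrite scaler_sumr.
apply: eq_bigr => q _; rewrite scalerA ffunE.
by congr (_ *: _); apply: mulrCA.
Qed.

Fact Ast_mul_sum (I J : finType) (c : I -> k) (d : J -> k)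
    (x : I -> Ast) (y : J -> Ast) :
  Ast_mul (\sum_i c i *: x i) (\sum_j d j *: y j) =
  \sum_i \sum_j (c i * d j) *: Ast_mul (x i) (y j).
Proof.
have m0l z : Ast_mul 0 z = 0.
  by apply: (addIr (Ast_mul 0 z)); rewrite -Ast_mulDl !add0r.
have m0r z : Ast_mul z 0 = 0.
  by apply: (addIr (Ast_mul z 0)); rewrite -Ast_mulDr !add0r.
rewrite (big_morph (Ast_mul^~ _) (fun a b => Ast_mulDl a b _) (m0l _)).
apply: eq_bigr => i _.
rewrite (big_morph (Ast_mul _) (Ast_mulDr _) (m0r _)).
apply: eq_bigr => j _.
by rewrite -Ast_scaleAl -Ast_scaleAr scalerA.
Qed.

Fact Ast_mul_path p q :
  Ast_mul (Ast_path p) (Ast_path q) = Ast_opath (stcomp p q).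
Proof.
rewrite /Ast_mul (bigD1 p) //= (bigD1 q) //= !ffunE !eqxx mulr1 scale1r.
rewrite !big1 ?addr0 // => [p' np|q' nq].
  by apply: big1 => q' _; rewrite ffunE (negPf np) mul0r scale0r.
by rewrite !ffunE (negPf nq) mulr0 scale0r.
Qed.

Fact Ast_mul_opath o o' :
  Ast_mul (Ast_opath o) (Ast_opath o') =
  Ast_opath (obind (fun p => obind (stcomp p) o') o).
Proof.
have z (x y : Ast) : x = 0 \/ y = 0 -> Ast_mul x y = 0.
  move=> xy; apply: big1 => p _; apply: big1 => q _.
  by case: xy => ->; rewrite ffunE ?(mulr0, mul0r) scale0r.
case: o o' => [p|] [q|] /=; rewrite ?Ast_mul_path ?z //; by [left | right].
Qed.

Fact Ast_mulA : associative Ast_mul.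
Proof.
move=> x y z.
rewrite (Ast_coord x) (Ast_coord y) (Ast_coord z) !Ast_mul_sum.
transitivity (\sum_p \sum_q \sum_r (x p * y q * z r) *:
    Ast_mul (Ast_path p) (Ast_mul (Ast_path q) (Ast_path r))).
  rewrite pair_big (eq_bigr (fun u => (y u.1 * z u.2) *:
    Ast_mul (Ast_path u.1) (Ast_path u.2))) // Ast_mul_sum.
  apply: eq_bigr => p _; rewrite pair_big /=.
  by apply: eq_bigr => u _; rewrite mulrA.
symmetry.
rewrite pair_big (eq_bigr (fun u => (x u.1 * y u.2) *:
    Ast_mul (Ast_path u.1) (Ast_path u.2))) // Ast_mul_sum.
rewrite [RHS]pair_big; apply: eq_bigr => -[p q] _ /=.
apply: eq_bigr => r _; congr (_ *: _).
rewrite -![Ast_path _]/(Ast_opath (Some _)) !Ast_mul_opath /=.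
by congr Ast_opath; rewrite stcompA; case: (stcomp p q).
Qed.

Fact Ast_triv_mul v p :
  Ast_mul (Ast_path (Triv v)) (Ast_path p) = (sttgt p == v)%:R *: Ast_path p.
Proof.
by rewrite Ast_mul_path /=; case: eqP => _; rewrite ?scale1r ?scale0r.
Qed.

Fact Ast_mul_triv v p :
  Ast_mul (Ast_path p) (Ast_path (Triv v)) = (stsrc p == v)%:R *: Ast_path p.
Proof.
rewrite Ast_mul_path; case: p => [w|i|j|j i] /=; last 3 first.
- by case: eqP => _; rewrite ?scale1r ?scale0r.
- by case: eqP => _; rewrite ?scale1r ?scale0r.
- by case: eqP => _; rewrite ?scale1r ?scale0r.
by rewrite eq_sym; case: eqP => [->|_]; rewrite ?scale1r ?scale0r.
Qed.

Fact Ast_oneE : Ast_one = \sum_v (1 : k) *: Ast_path (Triv v).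
Proof. by apply: eq_bigr => v _; rewrite scale1r. Qed.

Fact Ast_mul1l : left_id Ast_one Ast_mul.
Proof.
move=> x; rewrite [in LHS](Ast_coord x) Ast_oneE Ast_mul_sum exchange_big.
rewrite [RHS]Ast_coord; apply: eq_bigr => p _.
rewrite (bigD1 (sttgt p)) //= big1 => [|v nv];
  rewrite Ast_triv_mul mul1r ?eqxx ?scale1r ?addr0 //.
by rewrite eq_sym (negPf nv) scale0r scaler0.
Qed.

Fact Ast_mul1r : right_id Ast_one Ast_mul.
Proof.
move=> x; rewrite [in LHS](Ast_coord x) Ast_oneE Ast_mul_sum.
rewrite [RHS]Ast_coord; apply: eq_bigr => p _.
rewrite (bigD1 (stsrc p)) //= big1 => [|v nv];
  rewrite Ast_mul_triv mulr1 ?eqxx ?scale1r ?addr0 //.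
by rewrite eq_sym (negPf nv) scale0r scaler0.
Qed.

Fact Ast_one_neq0 : Ast_one != 0.
Proof.
apply/eqP => /ffunP/(_ (Triv ord0)); rewrite sum_ffunE (bigD1 ord0) //= big1.
  by rewrite !ffunE eqxx addr0 => /eqP; rewrite oner_eq0.
by move=> v nv; rewrite ffunE; case: eqP => // -[e]; rewrite e eqxx in nv.
Qed.

HB.instance Definition _ := GRing.Zmodule_isNzRing.Build Ast
  Ast_mulA Ast_mul1l Ast_mul1r Ast_mulDl Ast_mulDr Ast_one_neq0.
HB.instance Definition _ := GRing.Lmodule_isLalgebra.Build k Ast Ast_scaleAl.
HB.instance Definition _ := GRing.Lalgebra_isAlgebra.Build k Ast Ast_scaleAr.
HB.instance Definition _ := Algebra_isFalgebra.Build k Ast.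

Definition Ast_e (v : 'I_2) : Ast := Ast_path (Triv v).
Definition Ast_alpha (i : 'I_s) : Ast := Ast_path (Alpha i).
Definition Ast_beta (j : 'I_t) : Ast := Ast_path (Beta j).

Definition Ast_borel : {vspace Ast} :=
  <<[:: Ast_e vtx1, Ast_e vtx2 & [seq Ast_alpha i | i : 'I_s]]>>%VS.

End AstAlgebra.

(* The defining relations of the path algebra of the quiver (the e v are a
   complete system of orthogonal idempotents, alpha_i : 1 -> 2,
   beta_j : 2 -> 1) together with alpha_i beta_j = 0. *)
Definition st_relations (k : fieldType) (s t : nat) (C : algType k)
    (e : 'I_2 -> C) (a : 'I_s -> C) (b : 'I_t -> C) : Prop :=
  [/\ e vtx1 + e vtx2 = 1,
      forall v w, e v * e w = if v == w then e v else 0,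
      forall i, e vtx2 * a i = a i /\ a i * e vtx1 = a i,
      forall j, e vtx1 * b j = b j /\ b j * e vtx2 = b j
    & forall i j, a i * b j = 0].

Lemma Ast_relations (k : fieldType) (s t : nat) :
  st_relations (@Ast_e k s t) (@Ast_alpha k s t) (@Ast_beta k s t).
Proof.
have mE p q : (Ast_path k p : Ast k s t) * Ast_path k q =
    Ast_opath k (stcomp p q) by exact: Ast_mul_path.
split=> [|v w|i|j|i j]; rewrite ?mE //=.
- rewrite [RHS]/(Ast_one k s t) /Ast_one !big_ord_recl big_ord0 addr0.
  by congr (_ + Ast_path _ (Triv _)); apply: val_inj.
- by rewrite eq_sym; case: eqP => [->|].
Qed.

Section Universal.
Variables (k : fieldType) (s t : nat) (C : algType k).
Variables (e : 'I_2 -> C) (a : 'I_s -> C) (b : 'I_t -> C).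
Hypothesis rel : st_relations e a b.

Definition Ast_eval_path (p : stpath s t) : C :=
  match p with
  | Triv v => e v
  | Alpha i => a i
  | Beta j => b j
  | BetaAlpha j i => b j * a i
  end.

Definition Ast_eval of st_relations e a b := fun x : Ast k s t =>
  \sum_p x p *: Ast_eval_path p.

Fact Ast_eval_linear : linear (Ast_eval rel).
Proof.
move=> c x y; rewrite /Ast_eval scaler_sumr -big_split /=.
by apply: eq_bigr => p _; rewrite !ffunE scalerDl scalerA.
Qed.

HB.instance Definition _ :=
  GRing.isSemilinear.Build k (Ast k s t) C _ (Ast_eval rel)
    (GRing.semilinear_linear Ast_eval_linear).

Fact Ast_evalE p : Ast_eval rel (Ast_path k p) = Ast_eval_path p.
Proof.
rewrite /Ast_eval (bigD1 p) //= ffunE eqxx scale1r big1 ?addr0 // => q nq.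
by rewrite ffunE (negPf nq) scale0r.
Qed.

Fact Ast_eval_pathM p q :
  Ast_eval_path p * Ast_eval_path q = oapp Ast_eval_path 0 (stcomp p q).
Proof.
case: rel => _ ee ea eb ab.
have tg r : e (sttgt r) * Ast_eval_path r = Ast_eval_path r.
  case: r => [v|i|j|j i] /=; rewrite ?ee ?eqxx ?(ea i).1 ?(eb j).1 //.
  by rewrite mulrA (eb j).1.
have sr r : Ast_eval_path r * e (stsrc r) = Ast_eval_path r.
  case: r => [v|i|j|j i] /=; rewrite ?ee ?eqxx ?(ea i).2 ?(eb j).2 //.
  by rewrite -mulrA (ea i).2.
have z r r' : stsrc r != sttgt r' -> Ast_eval_path r * Ast_eval_path r' = 0.
  by move=> /negPf n; rewrite -sr -(tg r') mulrA -[_ * e _ * e _]mulrA ee n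
    mulr0 mul0r.
case: p => [v|i|j|j i].
- rewrite /stcomp; case: eqP => [<-|/eqP n] /=; first exact: tg.
  by apply: (z (Triv v)); rewrite eq_sym.
- case: q => [w|i'|j'|j' i'] /=; rewrite ?mulrA ?ab ?mul0r //.
    case: eqP => [<-|/eqP n]; first exact: (sr (Alpha i)).
    exact: (z (Alpha i) (Triv w)).
  exact: (z (Alpha i) (Alpha i')).
- case: q => [w|i'|j'|j' i'] //=.
  + case: eqP => [<-|/eqP n]; first exact: (sr (Beta j)).
    exact: (z (Beta j) (Triv w)).
  + exact: (z (Beta j) (Beta j')).
  + exact: (z (Beta j) (BetaAlpha j' i')).
- case: q => [w|i'|j'|j' i'] /=.
  + case: eqP => [<-|/eqP n]; first exact: (sr (BetaAlpha j i)).
    exact: (z (BetaAlpha j i) (Triv w)).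
  + exact: (z (BetaAlpha j i) (Alpha i')).
  + by rewrite -mulrA ab mulr0.
  + by rewrite mulrA -(mulrA (b j)) ab mulr0 mul0r.
Qed.

Fact Ast_eval_monoid_morphism : monoid_morphism (Ast_eval rel).
Proof.
split=> [|x y].
  have [<- _ _ _ _] := rel; rewrite [1]/(Ast_one k s t) /Ast_one.
  rewrite raddf_sum /=.
  rewrite !big_ord_recl big_ord0 addr0 !Ast_evalE /=.
  by congr (_ + e _); apply: val_inj.
rewrite [x * y]/(Ast_mul x y) /Ast_mul raddf_sum [in RHS]/Ast_eval mulr_suml.
apply: eq_bigr => p _; rewrite raddf_sum mulr_sumr; apply: eq_bigr => q _ /=.
rewrite linearZ /= -scalerAl -scalerAr scalerA Ast_eval_pathM.
by congr (_ *: _); case: (stcomp p q) => [r|] /=; rewrite ?Ast_evalE ?linear0.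
Qed.

HB.instance Definition _ :=
  GRing.isMonoidMorphism.Build (Ast k s t) C (Ast_eval rel)
    Ast_eval_monoid_morphism.

End Universal.

(* Ast k s t is the k-algebra presented by these generators and relations, that
   is, the path algebra modulo the relations alpha_i beta_j = 0. *)
Lemma Ast_universal (k : fieldType) (s t : nat) (C : algType k)
    (e : 'I_2 -> C) (a : 'I_s -> C) (b : 'I_t -> C) :
  st_relations e a b ->
  exists2 phi : {lrmorphism Ast k s t -> C},
    [/\ forall v, phi (Ast_e k s t v) = e v,
        forall i, phi (Ast_alpha k t i) = a i
      & forall j, phi (Ast_beta k s j) = b j]
  & forall psi : {lrmorphism Ast k s t -> C},
      [/\ forall v, psi (Ast_e k s t v) = e v,
          forall i, psi (Ast_alpha k t i) = a i
        & forall j, psi (Ast_beta k s j) = b j] -> psi =1 phi.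
Proof.
move=> rel; exists (Ast_eval rel : {lrmorphism Ast k s t -> C}).
  by split=> ? /=; rewrite Ast_evalE.
move=> psi [pe pa pb] x; rewrite (Ast_coord x) !linear_sum.
apply: eq_bigr => p _; rewrite !linearZ /= Ast_evalE; congr (_ *: _).
case: p => [v|i|j|j i] /=; rewrite -?pe -?pa -?pb -?rmorphM //.
by congr (psi _); rewrite [RHS]Ast_mul_path.
Qed.

(* Main.v *)
(* Vanishing of Ext^1 lets the Delta(2)'s of a filtration sink to the bottom, so
   A has an ideal J that is a direct sum of copies of Delta(2) with A / J a
   direct sum of copies of Delta(1); counting simple modules, A / J = End_k
   Delta(1) and J = A e2 A for an idempotent e2 with e2 A e2 = k e2.  Lifting a
   rank one idempotent of A / J to a suitable e1 gives e2 A e1 A e2 = 0, and the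
   full corner (e1 + e2) A (e1 + e2) is then some A_{s,t}.

   An A_{s,t}-module M is filtered by standard modules if and only if the map
   (e2 M)^t -> e1 M given by the beta_j is injective.  Then M is the module
   k^m + k^n + (k^n)^t determined by the s matrices of size m x n that represent
   the alpha_i, and direct sum decompositions of M correspond to those of the
   representation of the s-Kronecker quiver.  Hence the representation type is
   that of the s-Kronecker quiver: for s = 2 reflection functors show that the
   indecomposable pencils are determined by their size if m <> n, and one of the
   two maps is invertible and the other a Jordan block if m = n; for s >= 3 the
   modules with m = n = 1 form families with at least two parameters, which
   finitely many one-parameter families do not exhaust. *)

(* An arbitrary lift e1 of a rank one idempotent will not do: A e1 may contain a summand isomorphic
   to A e2, that is, e2 may factor as alpha beta through e1, and then e2 A e1 A e2 is not zero.
   Since e2 A e2 = k e2, this is the only obstruction, and a choice of e1 that is minimal in the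
   sense of dim e1 A excludes it. That the products beta_j alpha_i are linearly independent is a
   second consequence of the filtration: as J is a sum of copies of A e2, the multiplication A e2
   (x) e2 A -> J is injective. Tensor products are only given by a universal property. Therefore the
   inverse of the corner functor M -> eM is a coinduction, a space of linear maps cut out by linear
   equations, and computations in A (x)_B X use a normal form that uniqueness in the universal
   property provides. Non-tameness is a counting argument: on the members of a one-parameter family
   the ratios of the alpha_i are values of rational functions of the parameter, so finitely many
   families trace finitely many curves in a space of ratios of dimension at least 2. *)
Require Import Defs.
From HB Require Import structures.
From mathcomp Require Import all_boot all_order all_algebra all_field.
From mathcomp Require Import zify.
From Stdlib Require Import Classical ClassicalEpsilon.

Set Implicit Arguments.
Unset Strict Implicit.
Unset Printing Implicit Defensive.

Import GRing.Theory.
Local Open Scope ring_scope.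

(** * Modules and subquotients *)

Section LinearFunctions.
Variables (K : nzRingType) (aT rT : vectType K).

Definition lfun_of (g : aT -> rT) (lin_g : linear g) : 'Hom(aT, rT) :=
  linfun (HB.pack g (GRing.isSemilinear.Build K aT rT _ g
    (GRing.semilinear_linear lin_g)) : {linear aT -> rT}).

Lemma lfun_ofE g lin_g : @lfun_of g lin_g =1 g.
Proof. by move=> x; rewrite /lfun_of lfunE. Qed.

Implicit Types f : 'Hom(aT, rT).

Lemma lfunD f x y : f (x + y) = f x + f y. Proof. exact: linearD. Qed.
Lemma lfunB f x y : f (x - y) = f x - f y. Proof. exact: linearB. Qed.
Lemma lfunZ f c x : f (c *: x) = c *: f x. Proof. exact: linearZ. Qed.
Lemma lfun0 f : f 0 = 0. Proof. exact: linear0. Qed.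
Lemma lfun_sum f I (r : seq I) (P : pred I) (F : I -> aT) :
  f (\sum_(i <- r | P i) F i) = \sum_(i <- r | P i) f (F i).
Proof. exact: linear_sum. Qed.

End LinearFunctions.

Lemma vsvalD (k : fieldType) (V : vectType k) (U : {vspace V})
  (x y : subvs_of U) : vsval (x + y) = vsval x + vsval y.
Proof. by []. Qed.

Lemma vsvalZ (k : fieldType) (V : vectType k) (U : {vspace V}) c
  (x : subvs_of U) : vsval (c *: x) = c *: vsval x.
Proof. by []. Qed.

Lemma vsval_sum (k : fieldType) (V : vectType k) (U : {vspace V}) I
    (r : seq I) (P : pred I) (F : I -> subvs_of U) :
  vsval (\sum_(i <- r | P i) F i) = \sum_(i <- r | P i) vsval (F i).
Proof. exact: linear_sum. Qed.

Section FdMods.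
Variables (k : fieldType) (A : falgType k).
Implicit Types (M N E D : fdmod A) (a b : A).

Lemma actD M a b v : fdm_act M (a + b) v = fdm_act M a v + fdm_act M b v.
Proof. by rewrite linearD add_lfunE. Qed.

Lemma actB M a b v : fdm_act M (a - b) v = fdm_act M a v - fdm_act M b v.
Proof. by rewrite linearB add_lfunE opp_lfunE. Qed.

Lemma actZ M c a v : fdm_act M (c *: a) v = c *: fdm_act M a v.
Proof. by rewrite linearZ scale_lfunE. Qed.

Lemma act0 M v : fdm_act M 0 v = 0.
Proof. by rewrite linear0 zero_lfunE. Qed.

Lemma act_sum M I (r : seq I) (P : pred I) (F : I -> A) v :
  fdm_act M (\sum_(i <- r | P i) F i) v =
  \sum_(i <- r | P i) fdm_act M (F i) v.
Proof. by rewrite linear_sum sum_lfunE. Qed.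

Lemma act_regular a b : fdm_act (regular_fdmod A) a b = a * b.
Proof. by rewrite /= lfunE. Qed.

Lemma is_submodP M (U : {vspace M}) :
  is_submod U <-> forall a x, x \in U -> fdm_act M a x \in U.
Proof.
split=> [sU a x Ux | sU a]; first exact: (subvP (sU a)) (memv_img _ Ux).
by apply/subvP => _ /memv_imgP[x Ux ->]; apply: sU.
Qed.

Lemma submod_full M : is_submod (fullv : {vspace M}).
Proof. by move=> a; apply: subvf. Qed.

Lemma submod0 M : is_submod (0%VS : {vspace M}).
Proof. by move=> a; rewrite limg0 subv0. Qed.

Lemma is_homP M N (f : 'Hom(M, N)) :
  is_hom f <-> forall a x, f (fdm_act M a x) = fdm_act N a (f x).
Proof.
split=> [hf a x | hf a x _]; last exact: hf.
by apply: hf; apply: memvf.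
Qed.

Lemma submod_ker_on M N (U : {vspace M}) (f : 'Hom(M, N)) :
  is_submod U -> hom_on U f -> is_submod (U :&: lker f)%VS.
Proof.
move=> /is_submodP sU hf; apply/is_submodP => a x; rewrite !memv_cap !memv_ker.
by case/andP=> Ux /eqP fx0; rewrite sU //= hf // fx0 linear0.
Qed.

Lemma submod_img M N (f : 'Hom(M, N)) (U : {vspace M}) :
  is_hom f -> is_submod U -> is_submod (f @: U)%VS.
Proof.
move=> /is_homP hf /is_submodP sU; apply/is_submodP => a _ /memv_imgP[x Ux ->].
by rewrite -hf memv_img ?sU.
Qed.

Lemma comp_hom M N E (f : 'Hom(M, N)) (g : 'Hom(N, E)) :
  is_hom f -> is_hom g -> is_hom (g \o f)%VF.
Proof.
move=> /is_homP hf /is_homP hg; apply/is_homP => a x.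
by rewrite !comp_lfunE hf hg.
Qed.

Lemma is_iso_cancel M N (f : 'Hom(M, N)) (g : N -> M) :
  is_hom f -> cancel f g -> cancel g f -> is_iso f.
Proof.
move=> hf fK gK; split=> //; first by apply/eqP/lker0P/(can_inj fK).
apply/eqP; rewrite eqEsubv subvf; apply/subvP => y _.
by rewrite -[y]gK memv_img ?memvf.
Qed.

Lemma is_iso_inv M N (f : 'Hom(M, N)) : is_iso f ->
  exists g : 'Hom(N, M), [/\ is_hom g, cancel f g & cancel g f].
Proof.
case=> /is_homP hf /eqP kf imf; have fK := lker0_lfunK kf.
have gK : cancel (f^-1)%VF f by move=> y; rewrite limg_lfunVK // imf memvf.
exists (f^-1)%VF; split=> //; apply/is_homP => a x.
by apply: (can_inj fK); rewrite hf !gK.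
Qed.

Lemma isomorphic_sym M N : isomorphic M N -> isomorphic N M.
Proof.
case=> f /is_iso_inv[g [hg fK gK]]; exists g; exact: is_iso_cancel hg gK fK.
Qed.

Lemma isomorphic_trans M N E :
  isomorphic M N -> isomorphic N E -> isomorphic M E.
Proof.
move=> [f fi] [g gi]; have [f' [_ fK f'K]] := is_iso_inv fi.
have [g' [_ gK g'K]] := is_iso_inv gi; have [[hf _ _] [hg _ _]] := (fi, gi).
exists (g \o f)%VF; apply: (@is_iso_cancel _ _ _ (f' \o g')).
- exact: comp_hom.
- by move=> x; rewrite /= comp_lfunE gK fK.
- by move=> x; rewrite /= comp_lfunE f'K g'K.
Qed.

Lemma indecomposable_iso M N :
  isomorphic M N -> indecomposable M -> indecomposable N.
Proof.
move=> /isomorphic_sym[f fi] [nz ind].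
have [hf /eqP kf imf] := fi; split=> [N0|U V sU sV UV UV0].
  by apply: nz; rewrite -imf N0 limg0.
have := ind (f @: U)%VS (f @: V)%VS (submod_img hf sU) (submod_img hf sV).
rewrite -limgD UV imf -lker0_img_cap // UV0 limg0 => /(_ erefl erefl).
by case=> /eqP h; [left|right]; apply/eqP; move: h; rewrite -{1}(limg0 f)
  eq_limg_ker0.
Qed.

Section Subquotient.
Variables (M : fdmod A) (V U : {vspace M}).
Hypotheses (sV : is_submod V) (sU : is_submod U) (UV : (U <= V)%VS).

Let W := (V :\: U)%VS.
Let WU0 : (W :&: U = 0)%VS. Proof. exact: capv_diff. Qed.
Let pi : 'End(M) := daddv_pi W U.

Let pi_sub x : x \in V -> x - pi x \in U.
Proof.
move=> Vx; have xWU : x \in (W + U)%VS by rewrite addv_diff (addv_idPl UV).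
by rewrite -{1}(daddv_pi_add WU0 xWU) addrC addKr memv_pi.
Qed.

Let piU x : x \in U -> pi x = 0.
Proof.
move=> Ux; apply/eqP; rewrite -memv0 -WU0 memv_cap memv_pi /=.
by rewrite -[X in X \in U](subKr x) memvB // pi_sub // (subvP UV).
Qed.

(** [V / U] is realised on the complement [W] of [U] in [V]: an algebra element acts as in [M],
    followed by the projection onto [W] along [U]. *)
Definition subquot_fun (a : A) (w : subvs_of W) : subvs_of W :=
  vsproj W (pi (fdm_act M a (vsval w))).

Fact subquot_fun_linear a : linear (subquot_fun a).
Proof. by move=> c x y; rewrite /subquot_fun !linearP. Qed.

Definition subquot_op a : 'End(subvs_of W) := lfun_of (subquot_fun_linear a).

Fact subquot_op_linear : linear subquot_op.
Proof.
move=> c a b; apply/lfunP => w; rewrite add_lfunE scale_lfunE !lfun_ofE.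
by rewrite /subquot_fun linearP add_lfunE scale_lfunE !linearP.
Qed.

HB.instance Definition _ := GRing.isSemilinear.Build k A 'End(subvs_of W) _
  subquot_op (GRing.semilinear_linear subquot_op_linear).

Let proj_piE x : vsval (vsproj W (pi x)) = pi x.
Proof. by rewrite vsprojK // memv_pi. Qed.

Let pi_act a x : x \in V -> pi (fdm_act M a (pi x)) = pi (fdm_act M a x).
Proof.
move=> Vx; apply/esym/eqP; rewrite -subr_eq0 -linearB -linearB.
by apply/eqP/piU; move/is_submodP: sU; apply; apply: pi_sub.
Qed.

Fact subquot_act1 w : subquot_op 1 w = w.
Proof.
rewrite lfun_ofE /subquot_fun fdm_act1 /pi daddv_pi_id ?subvsP //.
exact: vsvalK.
Qed.

Fact subquot_actM a b w : subquot_op (a * b) w = subquot_op a (subquot_op b w).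
Proof.
rewrite !lfun_ofE /subquot_fun proj_piE pi_act ?fdm_actM //.
by move/is_submodP: sV; apply; apply: subvP (diffvSl V U) _ (subvsP _).
Qed.

Definition subquot_fdmod : fdmod A :=
  @FdMod k A (subvs_of W) (subquot_op : {linear A -> 'End(subvs_of W)})
    subquot_act1 subquot_actM.

Fact subquot_proj_linear : linear (fun x => vsproj W (pi x)).
Proof. by move=> c x y; rewrite !linearP. Qed.

Lemma subquot_fdmodP : subquot_iso V U subquot_fdmod.
Proof.
exists (lfun_of subquot_proj_linear : 'Hom(M, subquot_fdmod)); split.
- move=> a x Vx; rewrite lfun_ofE /= lfun_ofE lfun_ofE /subquot_fun proj_piE.
  by rewrite pi_act.
- apply/eqP; rewrite eqEsubv subvf /=; apply/subvP => w _; apply/memv_imgP.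
  exists (vsval w); first exact: subvP (diffvSl V U) _ (subvsP _).
  by rewrite lfun_ofE /pi daddv_pi_id ?subvsP ?vsvalK.
- apply/vspaceP => x; rewrite memv_cap memv_ker lfun_ofE.
  apply/andP/idP => [[Vx /eqP/(congr1 vsval)]|Ux].
    rewrite proj_piE linear0 => pix; have := pi_sub Vx.
    by rewrite pix subr0.
  by rewrite piU // linear0 eqxx (subvP UV).
Qed.

End Subquotient.

Lemma subquot_exists M (V U : {vspace M}) :
  is_submod V -> is_submod U -> (U <= V)%VS -> exists D, subquot_iso V U D.
Proof. by move=> sV sU UV; exists (subquot_fdmod sV sU UV); apply: subquot_fdmodP. Qed.

Lemma split_of_Ext1 N E M (i : 'Hom(N, E)) (p : 'Hom(E, M)) :
  ~ Ext1_nonzero M N -> short_exact i p ->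
  exists2 s : 'Hom(M, E), is_hom s & (p \o s)%VF = \1%VF.
Proof.
by move=> Ext0 ex; apply: NNPP => nosplit; apply: Ext0; exists E, i, p.
Qed.

End FdMods.

Lemma choose_fun (T U : Type) (P : T -> U -> Prop) :
  (forall x, exists y, P x y) -> exists f, forall x, P x (f x).
Proof.
move=> ex; exists (fun x => sval (constructive_indefinite_description _ (ex x))).
by move=> x; case: constructive_indefinite_description.
Qed.

Lemma lfun_section (k : fieldType) (V W : vectType k) (U : {vspace V})
    (f : 'Hom(V, W)) : (f @: U)%VS = fullv ->
  exists s : 'Hom(W, V), forall w, s w \in U /\ f (s w) = w.
Proof.
move=> fU; pose g := (f \o projv U)%VF; exists (projv U \o g^-1)%VF => w.
rewrite comp_lfunE memv_proj; split=> //; rewrite -comp_lfunE.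
by rewrite limg_lfunVK // limg_comp limg_proj fU memvf.
Qed.

(** * Extension of homomorphisms and rearrangement of filtrations *)

Section Extension.
Variables (k : fieldType) (A : falgType k).
Implicit Types (M N E D : fdmod A) (a b : A).

(* The pushout of 0 -> X -> Y -> D -> 0 along h is Y / (X :&: ker h). *)
Lemma hom_extend M (X Y : {vspace M}) D D' (q : 'Hom(M, D)) (h : 'Hom(M, D')) :
  is_submod X -> is_submod Y -> (X <= Y)%VS ->
  hom_on Y q -> (q @: Y)%VS = fullv -> (Y :&: lker q)%VS = X ->
  hom_on X h -> (h @: X)%VS = fullv -> ~ Ext1_nonzero D D' ->
  exists2 h' : 'Hom(M, D'), hom_on Y h' & {in X, h' =1 h}.
Proof.
move=> sX sY XY hq qY kq hh hX Ext0.
have [/is_submodP sXP /is_submodP sYP] := (sX, sY).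
pose Z := (X :&: lker h)%VS.
have ZX : (Z <= X)%VS by apply: capvSl.
have sZ : is_submod Z by apply: submod_ker_on.
have [E [pi [hpi piY kpi]]] := subquot_exists sY sZ (subv_trans ZX XY).
have [sg sgP] := lfun_section hX; have [tau tauP] := lfun_section piY.
have YX x : x \in X -> x \in Y by apply/subvP: x.
have qX x : x \in X -> q x = 0.
  by rewrite -kq memv_cap memv_ker => /andP[_ /eqP].
have qXP x : x \in Y -> q x = 0 -> x \in X.
  by rewrite -kq memv_cap memv_ker => -> ->; rewrite eqxx.
have piZ x y : x \in X -> y \in X -> h x = h y -> pi x = pi y.
  move=> Xx Xy e; apply/eqP; rewrite -subr_eq0 -lfunB -memv_ker.
  have: x - y \in Z by rewrite memv_cap memvB // memv_ker lfunB /= e subrr eqxx.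
  by rewrite -kpi memv_cap => /andP[].
have piZ' x y : x \in Y -> y \in Y -> pi x = pi y -> x - y \in Z.
  by move=> Yx Yy e; rewrite -kpi memv_cap memvB // memv_ker lfunB /= e subrr eqxx.
have qpi x y : x \in Y -> y \in Y -> pi x = pi y -> q x = q y.
  move=> Yx Yy e; apply/eqP; rewrite -subr_eq0 -lfunB qX //.
  exact: subvP ZX _ (piZ' _ _ Yx Yy e).
pose i := (pi \o sg)%VF; pose p := (q \o tau)%VF.
have iE d : i d = pi (sg d) by rewrite comp_lfunE.
have pE e : p e = q (tau e) by rewrite comp_lfunE.
have ppi x : x \in Y -> p (pi x) = q x.
  by move=> Yx; rewrite pE; apply: qpi => //; [apply: (tauP _).1 |
    rewrite (tauP _).2].
clearbody i p.
have hi : is_hom i.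
  apply/is_homP => a d; rewrite !iE -hpi ?YX ?(sgP _).1 //.
  apply: piZ; rewrite ?(sgP _).1 ?sXP ?(sgP _).1 //.
  by rewrite hh ?(sgP _).1 // !(sgP _).2.
have hp : is_hom p.
  apply/is_homP => a e; rewrite !pE -hq ?(tauP _).1 //.
  apply: qpi; rewrite ?(tauP _).1 ?sYP ?(tauP _).1 //.
  by rewrite hpi ?(tauP _).1 // !(tauP _).2.
have ki : lker i = 0%VS.
  apply/eqP/lker0P => d d' e; rewrite -(sgP d).2 -(sgP d').2.
  have := piZ' _ _ (YX _ (sgP d).1) (YX _ (sgP d').1).
  rewrite -!iE => /(_ e); rewrite memv_cap memv_ker lfunB subr_eq0.
  by case/andP=> _ /eqP.
have imi : limg i = lker p.
  apply/vspaceP => e; rewrite memv_ker; apply/memv_imgP/eqP => [[d _ ->]|pe0].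
    by rewrite iE ppi ?YX ?(sgP _).1 // qX ?(sgP _).1.
  have Xe : tau e \in X by apply: qXP; rewrite -?pE ?(tauP _).1.
  exists (h (tau e)); rewrite ?memvf // iE -{1}(tauP e).2.
  by apply: piZ; rewrite ?(sgP _).1 // (sgP _).2.
have imp : limg p = fullv.
  apply/eqP; rewrite eqEsubv subvf /= -qY; apply/subvP => _ /memv_imgP[x Yx ->].
  by rewrite -ppi // memv_img ?memvf.
have [s /is_homP hs ps] :=
  split_of_Ext1 Ext0 (And5 hi hp ki imi imp : short_exact i p).
(* On [Y] the map [pi - s q] is killed by [p], hence has values in the image of [i]; it induces the
   retraction of [E] onto [D'] that belongs to the section [s]. *)
pose h' := (i^-1 \o (pi - (s \o q)))%VF.
have ih' y : y \in Y -> i (h' y) = pi y - s (q y).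
  move=> Yy; rewrite comp_lfunE add_lfunE opp_lfunE comp_lfunE limg_lfunVK //.
  rewrite imi memv_ker lfunB ppi // -[p (s _)]comp_lfunE ps lfunE /=.
  by rewrite subrr.
have injd : injective i by apply/lker0P; rewrite ki.
exists h' => [a y Yy|x Xx].
  apply: injd; move/is_homP: hi => ->; rewrite !ih' ?sYP //.
  by rewrite hpi // hq // hs -lfunB.
apply: injd; rewrite ih' ?YX // qX // lfun0 subr0 iE.
by apply: piZ; rewrite ?(sgP _).1 // (sgP _).2.
Qed.

(* p_0, ..., p_(n-1) induce an isomorphism from V / J onto D^n *)
Definition joint_quot M (V J : {vspace M}) D n (p : nat -> 'Hom(M, D)) :=
  [/\ forall l, (l < n)%N -> hom_on V (p l),
      forall y : nat -> D,
        exists2 x, x \in V & forall l, (l < n)%N -> p l x = y l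
    & forall x, x \in V -> (x \in J <-> forall l, (l < n)%N -> p l x = 0)].

Lemma joint_quot_surj M (V J : {vspace M}) D n (p : nat -> 'Hom(M, D)) l :
  joint_quot V J n p -> (l < n)%N -> (p l @: V)%VS = fullv.
Proof.
case=> _ surj _ ln; apply/eqP; rewrite eqEsubv subvf; apply/subvP => d _.
by have [x Vx /(_ _ ln) <-] := surj (fun=> d); rewrite memv_img.
Qed.

Lemma joint_quot_extend M (X Y J : {vspace M}) D D' n (p : nat -> 'Hom(M, D')) :
  is_submod X -> is_submod Y -> (X <= Y)%VS -> ~ Ext1_nonzero D D' ->
  subquot_iso Y X D -> joint_quot X J n p ->
  exists p' : nat -> 'Hom(M, D'),
    forall l, (l < n)%N -> hom_on Y (p' l) /\ {in X, p' l =1 p l}.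
Proof.
move=> sX sY XY Ext0 [q [hq qY kq]] jq.
apply: (choose_fun (P := fun l (p' : 'Hom(M, D')) =>
  (l < n)%N -> hom_on Y p' /\ {in X, p' =1 p l})) => l.
case: (ltnP l n) => [ln|]; last by exists 0.
have [hp _ _] := jq.
have [h' h1 h2] :=
  hom_extend sX sY XY hq qY kq (hp l ln) (joint_quot_surj jq ln) Ext0.
by exists h'.
Qed.

(** The extensions of the [p l] to [Y], together with the quotient map [q] onto the new factor, are
    the n + 1 coordinates of [Y / J]. *)
Lemma joint_quot_add M (X Y J : {vspace M}) D n (p : nat -> 'Hom(M, D)) :
  is_submod X -> is_submod Y -> (J <= X)%VS -> (X <= Y)%VS ->
  ~ Ext1_nonzero D D -> subquot_iso Y X D -> joint_quot X J n p ->
  exists p' : nat -> 'Hom(M, D), joint_quot Y J n.+1 p'.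
Proof.
move=> sX sY JX XY Ext0 sq jq.
have [p' p'P] := joint_quot_extend sX sY XY Ext0 sq jq.
have [[q [hq qY kq]] [_ surj kp]] := (sq, jq).
have qX x : (x \in X) = (x \in Y) && (q x == 0).
  by rewrite -kq memv_cap memv_ker.
pose r l := if (l < n)%N then p' l else q.
have rS (P : 'Hom(M, D) -> nat -> Prop) :
    (forall l, (l < n)%N -> P (p' l) l) -> P q n ->
    forall l, (l < n.+1)%N -> P (r l) l.
  move=> P1 P2 l; rewrite ltnS leq_eqVlt /r => /orP[/eqP->|ln].
    by rewrite ltnn.
  by rewrite ln; apply: P1.
exists r; split.
- by apply: (rS (fun f _ => hom_on Y f)) => // l /p'P[].
(* The last coordinate is lifted first; the others are then corrected by an element of [X], on which
   [q] vanishes. *)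
- move=> y; have /memv_imgP[x0 Yx0 e0] : y n \in (q @: Y)%VS.
    by rewrite qY memvf.
  have [x1 Xx1 e1] := surj (fun l => y l - p' l x0).
  have [Yx1 /eqP qx1] := andP (etrans (esym (qX x1)) Xx1).
  exists (x0 + x1); first by rewrite memvD.
  apply: (rS (fun f l => f _ = y l)) => [l ln|]; rewrite lfunD.
    by have [_ pp] := p'P l ln; rewrite (pp x1) // e1 // addrC subrK.
  by rewrite qx1 addr0.
- move=> x Yx; split=> [Jx|r0].
    have Xx := subvP JX x Jx; apply: (rS (fun f l => f x = 0)) => [l ln|].
      by have [_ pp] := p'P l ln; rewrite pp // (kp x Xx).1.
    by move: Xx; rewrite qX => /andP[_ /eqP].
  have Xx : x \in X.
    by rewrite qX Yx; have := r0 n (ltnSn n); rewrite /r ltnn => ->; rewrite eqxx.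
  apply/(kp x Xx) => l ln; have [_ pp] := p'P l ln; rewrite -pp //.
  by have := r0 l (ltnW ln); rewrite /r ln.
Qed.

(** In [Y / J] the factor [D] lies above the layer [X / J] of copies of [D']. The common kernel [U]
    of the extended maps is a complement of that layer modulo [J], so the two can change places. *)
Lemma joint_quot_swap M (X Y J : {vspace M}) D D' n (p : nat -> 'Hom(M, D')) :
  is_submod X -> is_submod Y -> (J <= X)%VS -> (X <= Y)%VS ->
  ~ Ext1_nonzero D D' -> subquot_iso Y X D -> joint_quot X J n p ->
  exists (U : {vspace M}) (p' : nat -> 'Hom(M, D')),
    [/\ joint_quot Y U n p', (J <= U)%VS, (U <= Y)%VS, is_submod U
      & subquot_iso U J D].
Proof.
move=> sX sY JX XY Ext0 sq jq.
have [p' p'P] := joint_quot_extend sX sY XY Ext0 sq jq.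
have [[q [hq qY kq]] [_ surj kp]] := (sq, jq).
have qX x : (x \in X) = (x \in Y) && (q x == 0).
  by rewrite -kq memv_cap memv_ker.
pose U := (Y :&: \bigcap_(l < n) lker (p' l))%VS.
have UP x : x \in U <-> x \in Y /\ forall l, (l < n)%N -> p' l x = 0.
  rewrite memv_cap; split=> [/andP[Yx Kx]|[Yx Kx]].
    split=> // l ln; apply/eqP; rewrite -memv_ker.
    exact: (subv_bigcapP Kx (Ordinal ln)).
  by rewrite Yx; apply/subv_bigcapP => l _; rewrite -memvE memv_ker Kx.
have JU x : x \in J -> x \in U.
  move=> Jx; have Xx := subvP JX x Jx; apply/UP; split=> [|l ln].
    exact: subvP Xx.
  by have [_ pp] := p'P l ln; rewrite pp // (kp x Xx).1.
exists U, p'; split.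
- split=> [l /p'P[] //|y|x Yx].
    have [x Xx xP] := surj y; exists x; first exact: subvP Xx.
    by move=> l ln; have [_ pp] := p'P l ln; rewrite pp // xP.
  by split=> [/UP[]|xP] //; apply/UP.
- exact/subvP.
- exact: capvSl.
- apply/is_submodP => a x /UP[Yx xP]; apply/UP; split=> [|l ln].
    by move/is_submodP: sY; apply.
  by have [pp _] := p'P l ln; rewrite pp // xP // lfun0.
- exists q; split=> [a x /UP[Yx _]||]; first exact: hq.
    apply/eqP; rewrite eqEsubv subvf -qY; apply/subvP => _ /memv_imgP[x Yx ->].
    (* Subtracting an element of [X] with the same values under all [p' l] moves [x] into [U]
       without changing [q x]. *)
    have [x1 Xx1 e1] := surj (fun l => p' l x).
    have [Yx1 /eqP qx1] := andP (etrans (esym (qX x1)) Xx1).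
    have -> : q x = q (x - x1) by rewrite lfunB qx1 subr0.
    apply/memv_img/UP; split=> [|l ln]; first by rewrite memvB.
    by rewrite lfunB; have [_ pp] := p'P l ln; rewrite (pp x1) // e1 // subrr.
  apply/vspaceP => x; rewrite memv_cap memv_ker; apply/andP/idP => [[Ux qx]|Jx].
    have [Yx xP] := (UP x).1 Ux; have Xx : x \in X by rewrite qX Yx.
    by apply/(kp x Xx) => l ln; have [_ pp] := p'P l ln; rewrite -pp // xP.
  split; first exact: JU.
  by move: (subvP JX x Jx); rewrite qX => /andP[].
Qed.

(** Going up the filtration, a factor [Delta vtx1] joins the top layer, while a factor [Delta vtx2]
    passes below the top layer and joins the bottom one. The groups Ext^1 that must vanish for this
    are those at (1,1), (2,1) and (2,2). *)
Lemma standard_rearrange (Delta : 'I_2 -> fdmod A) M :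
  (forall i j, Ext1_nonzero (Delta i) (Delta j) -> (i < j)%N) ->
  filtered Delta M ->
  exists (J : {vspace M}) n (p : nat -> 'Hom(M, Delta vtx1))
         m (r : nat -> 'Hom(M, Delta vtx2)),
    [/\ is_submod J, joint_quot fullv J n p & joint_quot J 0%VS m r].
Proof.
move=> Ext0 [r [N [N0 Nr sN stepN]]].
suff: forall i, (i <= r)%N ->
  exists (J : {vspace M}) n (p : nat -> 'Hom(M, Delta vtx1))
         m (r : nat -> 'Hom(M, Delta vtx2)),
    [/\ is_submod J, (J <= N i)%VS, joint_quot (N i) J n p
      & joint_quot J 0%VS m r].
  move/(_ r (leqnn r)) => [J [n [p [m [s [sJ _ jp jr]]]]]].
  by rewrite Nr in jp; exists J, n, p, m, s.
elim=> [_|i IHi ir].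
  exists 0%VS, 0%N, (fun=> 0), 0%N, (fun=> 0).
  have jq0 D : joint_quot (0%VS : {vspace M}) 0%VS 0 (fun=> 0 : 'Hom(M, D)).
    by split=> // y; exists 0; rewrite ?mem0v.
  by split; rewrite ?N0 ?subvv //; apply: submod0.
have [J [n [p [m [s [sJ JN jp jr]]]]]] := IHi (ltnW ir).
have [NN [j sq]] := stepN i ir.
have nE (a b : 'I_2) : (b <= a)%N -> ~ Ext1_nonzero (Delta a) (Delta b).
  by move=> ba /Ext0; rewrite ltnNge ba.
have [jE|jE] : j = vtx1 \/ j = vtx2.
  by case: j {sq} => [[|[|//]]] hj; [left|right]; apply: val_inj.
  rewrite jE in sq.
  have [p' jp'] := joint_quot_add (sN i (ltnW ir)) (sN _ ir) JN NN
    (nE _ _ (leqnn _)) sq jp.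
  exists J, n.+1, p', m, s; split=> //; exact: subv_trans JN NN.
rewrite jE in sq.
have [U [p' [jp' JU UN sU sqU]]] := joint_quot_swap (sN i (ltnW ir)) (sN _ ir)
  JN NN (nE vtx2 vtx1 isT) sq jp.
have [s' js'] := joint_quot_add sJ sU (sub0v J) JU (nE _ _ (leqnn _)) sqU jr.
by exists U, n, p', m.+1, s'.
Qed.

End Extension.

(** * A Morita equivalence criterion *)

Section MoritaCriterion.
Variables (k : fieldType) (A B : falgType k) (phi : 'Hom(B, A)).
Hypothesis phiM : forall b b', phi (b * b') = phi b * phi b'.
Hypothesis phi_inj : injective phi.
Let e := phi 1.
Hypothesis phi_img : forall a, e * a * e \in limg phi.
Variables (I : finType) (x y : I -> A).
Hypothesis full_e : \sum_i x i * e * y i = 1.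

Let phi1l b : e * phi b = phi b. Proof. by rewrite -phiM mul1r. Qed.
Let phi1r b : phi b * e = phi b. Proof. by rewrite -phiM mulr1. Qed.

Let psi a := (phi^-1)%VF (e * a * e).
Let psiK a : phi (psi a) = e * a * e. Proof. by rewrite limg_lfunVK. Qed.

Section Corner.
Variable M : fdmod A.
Let W : {vspace M} := limg (fdm_act M e).

Fact corner_mem b v : fdm_act M (phi b) v \in W.
Proof. by rewrite -phi1l fdm_actM memv_img ?memvf. Qed.

Fact corner_e w : w \in W -> fdm_act M e w = w.
Proof. by case/memv_imgP => v _ ->; rewrite -fdm_actM phi1l. Qed.

Definition corner_fun (b : B) (w : subvs_of W) : subvs_of W :=
  vsproj W (fdm_act M (phi b) (vsval w)).

Fact corner_fun_linear b : linear (corner_fun b).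
Proof. by move=> c u v; rewrite /corner_fun !linearP. Qed.

Definition corner_op b : 'End(subvs_of W) := lfun_of (corner_fun_linear b).

Fact corner_opE b w : vsval (corner_op b w) = fdm_act M (phi b) (vsval w).
Proof. by rewrite lfun_ofE vsprojK ?corner_mem. Qed.

Fact corner_op_linear : linear corner_op.
Proof.
move=> c b b'; apply/lfunP => w; rewrite add_lfunE scale_lfunE; apply: val_inj.
by rewrite /= !corner_opE linearP actD actZ.
Qed.

HB.instance Definition _ := GRing.isSemilinear.Build k B 'End(subvs_of W) _
  corner_op (GRing.semilinear_linear corner_op_linear).

Fact corner_act1 w : corner_op 1 w = w.
Proof. by apply: val_inj; rewrite /= corner_opE corner_e ?subvsP. Qed.

Fact corner_actM b b' w : corner_op (b * b') w = corner_op b (corner_op b' w).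
Proof. by apply: val_inj; rewrite /= !corner_opE phiM fdm_actM. Qed.

Definition corner : fdmod B :=
  @FdMod k B (subvs_of W) (corner_op : {linear B -> 'End(subvs_of W)})
    corner_act1 corner_actM.

Lemma corner_val b (w : corner) :
  vsval (fdm_act corner b w) = fdm_act M (phi b) (vsval w).
Proof. exact: corner_opE. Qed.

Lemma corner_valP (w : corner) : fdm_act M e (vsval w) = vsval w.
Proof. by rewrite corner_e ?subvsP. Qed.

Lemma corner_inj (u v : corner) : vsval u = vsval v -> u = v.
Proof. exact: val_inj. Qed.

End Corner.

Section CornerMap.
Variables (M N : fdmod A) (f : 'Hom(M, N)).

Definition corner_map_fun (w : corner M) : corner N :=
  vsproj _ (f (vsval w)).

Fact corner_map_linear : linear corner_map_fun.
Proof. by move=> c u v; rewrite /corner_map_fun !linearP. Qed.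

Definition corner_map : 'Hom(corner M, corner N) := lfun_of corner_map_linear.

Lemma corner_mapE w : is_hom f -> vsval (corner_map w) = f (vsval w).
Proof.
move=> /is_homP hf; rewrite lfun_ofE vsprojK // -corner_valP hf.
exact: corner_mem.
Qed.

Lemma corner_map_hom : is_hom f -> is_hom corner_map.
Proof.
move=> hf; apply/is_homP => b w; apply: corner_inj.
rewrite (corner_mapE _ hf) !corner_val (corner_mapE _ hf).
by move/is_homP: hf.
Qed.

End CornerMap.

Definition corner_functor : lin_functor A B.
Proof.
apply: (@LinFunctor k A B corner corner_map) => [M N f hf|M|M N P f g hf hg|M N c f g hf hg].
- exact: corner_map_hom.
- by apply/lfunP => w; rewrite lfun_ofE /corner_map_fun !lfunE /= vsvalK.
- apply/lfunP => w; apply: corner_inj; rewrite comp_lfunE.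
  by rewrite !corner_mapE ?comp_lfunE //; apply: comp_hom.
- apply/lfunP => w; rewrite add_lfunE scale_lfunE !lfun_ofE /corner_map_fun.
  by rewrite add_lfunE scale_lfunE !linearP.
Defined.

Section Coind.
Variable N : fdmod B.

(** The inverse functor is the coinduction N -> Hom_B(eA, N), realised as the linear maps f on A
    with f (phi b * a) = b f(a). For b = 1 this says f(e a) = f(a), so that f is determined by its
    restriction to eA. A acts by right translation of the argument. *)
Definition coind_cond_fun b (f : 'Hom(A, N)) : 'Hom(A, N) :=
  (f \o amull (phi b) - (fdm_act N b \o f))%VF.

Fact coind_cond_linear b : linear (coind_cond_fun b).
Proof.
move=> c f g; apply/lfunP => a; rewrite /coind_cond_fun.
rewrite !(add_lfunE, opp_lfunE, scale_lfunE, comp_lfunE) linearP scalerBr.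
by rewrite opprD addrACA.
Qed.

Definition coind_space : {vspace 'Hom(A, N)} :=
  (\bigcap_(i < \dim {:B}) lker (lfun_of (coind_cond_linear (vbasis {:B})`_i)))%VS.

Fact coind_spaceP f :
  f \in coind_space <-> forall b a, f (phi b * a) = fdm_act N b (f a).
Proof.
split=> [/subv_bigcapP fP b a|fP].
  rewrite (coord_vbasis (memvf b)) lfun_sum mulr_suml lfun_sum act_sum.
  apply: eq_bigr => i _; rewrite lfunZ -scalerAl lfunZ actZ; congr (_ *: _).
  have := fP i isT; rewrite -memvE memv_ker lfun_ofE => /eqP/lfunP/(_ a).
  rewrite add_lfunE opp_lfunE !comp_lfunE zero_lfunE lfunE /= => /eqP.
  by rewrite subr_eq0 => /eqP.
apply/subv_bigcapP => i _; rewrite -memvE memv_ker lfun_ofE; apply/eqP/lfunP => a.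
rewrite add_lfunE opp_lfunE !comp_lfunE zero_lfunE lfunE /= fP.
exact: subrr.
Qed.

Definition coind_fun (a : A) (f : subvs_of coind_space) :
  subvs_of coind_space := vsproj coind_space (vsval f \o amulr a)%VF.

Fact coind_fun_linear a : linear (coind_fun a).
Proof.
move=> c f g; rewrite /coind_fun linearP /= comp_lfunDl -comp_lfunZl.
exact: linearP.
Qed.

Definition coind_op a : 'End(subvs_of coind_space) :=
  lfun_of (coind_fun_linear a).

Fact coind_opE a f z : vsval (coind_op a f) z = vsval f (z * a).
Proof.
have /coind_spaceP fP := subvsP f.
rewrite lfun_ofE vsprojK; first by rewrite comp_lfunE lfunE.
by apply/coind_spaceP => b z'; rewrite !comp_lfunE !lfunE /= -mulrA fP.
Qed.

Fact coind_op_linear : linear coind_op.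
Proof.
move=> c a b; apply/lfunP => f; rewrite add_lfunE scale_lfunE; apply: val_inj.
apply/lfunP => z; rewrite /= !(add_lfunE, scale_lfunE) !coind_opE.
by rewrite mulrDr -scalerAr lfunD lfunZ.
Qed.

HB.instance Definition _ := GRing.isSemilinear.Build k A
  'End(subvs_of coind_space) _
  coind_op (GRing.semilinear_linear coind_op_linear).

Fact coind_act1 f : coind_op 1 f = f.
Proof. by apply: val_inj; apply/lfunP => z; rewrite /= coind_opE mulr1. Qed.

Fact coind_actM a b f : coind_op (a * b) f = coind_op a (coind_op b f).
Proof.
by apply: val_inj; apply/lfunP => z; rewrite /= !coind_opE mulrA.
Qed.

Definition coind : fdmod A :=
  @FdMod k A (subvs_of coind_space)
    (coind_op : {linear A -> 'End(subvs_of coind_space)})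
    coind_act1 coind_actM.

Lemma coind_val a (f : coind) z : vsval (fdm_act coind a f) z = vsval f (z * a).
Proof. exact: coind_opE. Qed.

Lemma coind_valP (f : coind) b a : vsval f (phi b * a) = fdm_act N b (vsval f a).
Proof. exact: (coind_spaceP _).1 (subvsP f) b a. Qed.

Lemma coind_vale (f : coind) a : vsval f (e * a) = vsval f a.
Proof. by rewrite coind_valP fdm_act1. Qed.

Lemma coind_inj (f g : coind) : vsval f =1 vsval g -> f = g.
Proof. by move=> fg; apply: val_inj; apply/lfunP. Qed.

End Coind.

Section CoindMap.
Variables (M N : fdmod B) (f : 'Hom(M, N)).

Definition coind_map_fun (u : coind M) : coind N := vsproj _ (f \o vsval u)%VF.

Fact coind_map_linear : linear coind_map_fun.
Proof.
move=> c u v; rewrite /coind_map_fun !linearP /= comp_lfunDr -comp_lfunZr.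
exact: linearP.
Qed.

Definition coind_map : 'Hom(coind M, coind N) := lfun_of coind_map_linear.

Lemma coind_mapE u z : is_hom f -> vsval (coind_map u) z = f (vsval u z).
Proof.
move=> /is_homP hf; rewrite lfun_ofE vsprojK ?comp_lfunE //.
by apply/coind_spaceP => b a; rewrite !comp_lfunE coind_valP hf.
Qed.

Lemma coind_map_hom : is_hom f -> is_hom coind_map.
Proof.
move=> hf; apply/is_homP => b w; apply: coind_inj => z.
by rewrite (coind_mapE _ _ hf) !coind_val (coind_mapE _ _ hf).
Qed.

End CoindMap.

Definition coind_functor : lin_functor B A.
Proof.
apply: (@LinFunctor k B A coind coind_map) => [M N f hf|M|M N P f g hf hg|M N c f g hf hg].
- exact: coind_map_hom.
- apply/lfunP => w; rewrite lfun_ofE /coind_map_fun lfunE comp_lfun1l.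
  exact: vsvalK.
- apply/lfunP => w; apply: coind_inj => z; rewrite comp_lfunE.
  by rewrite !coind_mapE ?comp_lfunE //; apply: comp_hom.
- apply/lfunP => w; rewrite add_lfunE scale_lfunE !lfun_ofE /coind_map_fun.
  by rewrite comp_lfunDl -comp_lfunZl linearP.
Defined.

Section UnitA.
Variable M : fdmod A.

(** The inverse of m |-> (z |-> e z m), read off from m = sum_i x_i e y_i m. *)
Definition unitA_fun (f : coind (corner M)) : M :=
  \sum_i fdm_act M (x i) (vsval (vsval f (y i))).

Fact unitA_linear : linear unitA_fun.
Proof.
move=> c f g; rewrite /unitA_fun scaler_sumr -big_split; apply: eq_bigr => i _.
by rewrite !linearP /= add_lfunE scale_lfunE !linearP.
Qed.

Definition unitA : 'Hom(coind (corner M), M) := lfun_of unitA_linear.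

Lemma unitAE f : unitA f = unitA_fun f. Proof. exact: lfun_ofE. Qed.

(** Expand e z as sum_i (e z x_i e) y_i: the factors in parentheses lie in the image of [phi], so
    B-linearity takes them out of [f]. *)
Lemma unitA_val (f : coind (corner M)) z :
  vsval (vsval f z) = fdm_act M (e * z) (unitA f).
Proof.
rewrite unitAE lfun_sum -[z in LHS]mulr1 -full_e mulr_sumr lfun_sum vsval_sum.
apply: eq_bigr => i _; rewrite -coind_vale !mulrA -(mulrA e z) -psiK.
by rewrite coind_valP corner_val psiK fdm_actM corner_valP -fdm_actM mulrA.
Qed.

Lemma unitA_iso : is_iso unitA.
Proof.
have hom : is_hom unitA.
  apply/is_homP => a f; rewrite {1}unitAE /unitA_fun.
  rewrite (eq_bigr (fun i => fdm_act M (x i * e * y i) (fdm_act M a (unitA f)))).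
    by rewrite -act_sum full_e fdm_act1.
  by move=> i _; rewrite coind_val unitA_val -!fdm_actM !mulrA.
have linv (m : M) : linear (fun z => vsproj _ (fdm_act M (e * z) m) : corner M).
  by move=> c z z'; rewrite mulrDr -scalerAr linearP add_lfunE scale_lfunE linearP.
pose g m : coind (corner M) := vsproj (coind_space (corner M)) (lfun_of (linv m)).
have gE m z : vsval (vsval (g m) z) = fdm_act M (e * z) m.
  rewrite /g vsprojK; first by rewrite lfun_ofE vsprojK // fdm_actM corner_mem.
  apply/coind_spaceP => b a; rewrite !(lfun_ofE (linv m)) mulrA phi1l.
  apply: corner_inj.
  have mem b' z' : fdm_act M (phi b' * z') m \in limg (fdm_act M e).
    by rewrite fdm_actM corner_mem.
  by rewrite corner_val !vsprojK ?mem // -fdm_actM mulrA phi1r.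
apply: (is_iso_cancel hom (g := g)) => [f|m].
  by apply: coind_inj => z; apply: corner_inj; rewrite gE -unitA_val.
rewrite unitAE /unitA_fun (eq_bigr (fun i => fdm_act M (x i * e * y i) m)).
  by rewrite -act_sum full_e fdm_act1.
by move=> i _; rewrite gE -fdm_actM mulrA.
Qed.

End UnitA.

Section CounitB.
Variable N : fdmod B.

Definition counitB_fun (w : corner (coind N)) : N := vsval (vsval w) 1.

Fact counitB_linear : linear counitB_fun.
Proof.
move=> c f g; rewrite /counitB_fun !linearP /=.
by rewrite add_lfunE scale_lfunE.
Qed.

Definition counitB : 'Hom(corner (coind N), N) := lfun_of counitB_linear.

Lemma counitBE w : counitB w = vsval (vsval w) 1.
Proof. exact: lfun_ofE. Qed.

Lemma counitB_iso : is_iso counitB.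
Proof.
have hom : is_hom counitB.
  apply/is_homP => b w; rewrite !counitBE corner_val coind_val.
  by rewrite mul1r -[phi b]mulr1 coind_valP.
(* The inverse of evaluation at 1 sends m to z |-> psi(z) m, where [psi z] is the element of B that
   [phi] maps to e z e. *)
have psi_linear m : linear (fun z => fdm_act N (psi z) m).
  move=> c z z'; rewrite -actZ -actD; congr (fdm_act N _ m).
  apply: phi_inj; rewrite lfunD lfunZ !psiK mulrDr mulrDl -scalerAr.
  by rewrite -scalerAl.
have gH m : lfun_of (psi_linear m) \in coind_space N.
  apply/coind_spaceP => b a; rewrite !(lfun_ofE (psi_linear m)) -fdm_actM.
  congr (fdm_act N _ m); apply: phi_inj.
  by rewrite phiM !psiK !mulrA phi1l phi1r.
pose g m : coind N := vsproj (coind_space N) (lfun_of (psi_linear m)).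
have gE m z : vsval (g m) z = fdm_act N (psi z) m.
  by rewrite vsprojK // lfun_ofE.
pose h m : corner (coind N) := vsproj _ (g m).
have hE m : vsval (h m) = g m.
  rewrite vsprojK //; apply/memv_imgP; exists (g m); rewrite ?memvf //.
  apply: coind_inj => z; rewrite coind_val !gE.
  congr (fdm_act N _ m); apply: phi_inj; rewrite !psiK -!mulrA.
  by rewrite -/e phi1l.
apply: (is_iso_cancel hom (g := h)) => [w|m].
  apply: corner_inj; rewrite hE; apply: coind_inj => z.
  rewrite gE counitBE -coind_valP psiK mulr1 -mulrA coind_vale -coind_val.
  by rewrite corner_valP.
rewrite counitBE hE gE -[RHS]fdm_act1; congr (fdm_act N _ m).
by apply: phi_inj; rewrite psiK mulr1 /e -phiM mulr1.
Qed.

End CounitB.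

Lemma morita_of_full_corner : morita_equivalent A B.
Proof.
exists corner_functor, coind_functor; split.
  exists unitA; split=> [M|M N f hf]; first exact: unitA_iso.
  apply/lfunP => u; rewrite !comp_lfunE !unitAE lfun_sum.
  apply: eq_bigr => i _; rewrite coind_mapE; last exact: corner_map_hom.
  by rewrite corner_mapE //; move/is_homP: hf => ->.
exists counitB; split=> [N|M N f hf]; first exact: counitB_iso.
apply/lfunP => u; rewrite !comp_lfunE !counitBE.
rewrite corner_mapE; last exact: coind_map_hom.
by rewrite coind_mapE.
Qed.

End MoritaCriterion.

(** * Quasi-hereditary algebras with two simple modules *)

Section Sections.
Variables (k : fieldType) (A : falgType k).
Implicit Types M D : fdmod A.

(** [s l] is a linear lift of the inclusion of the l-th copy of [D] in [V / J]. It is A-linear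
    modulo [J] only, hence a homomorphism once [J] is 0 or is killed by a further action. *)
Lemma joint_quot_section M (V J : {vspace M}) D n (p : nat -> 'Hom(M, D)) :
  is_submod V -> joint_quot V J n p ->
  exists s : nat -> 'Hom(D, M),
    [/\ forall l d, s l d \in V,
        forall l a d, (l < n)%N ->
          s l (fdm_act D a d) - fdm_act M a (s l d) \in J
      & forall x, x \in V -> x - \sum_(l < n) s l (p l x) \in J].
Proof.
move=> /is_submodP sV [hp surj kp].
have lin : linear (fun x => [ffun l : 'I_n => p l x]).
  by move=> c x y; apply/ffunP => l; rewrite !ffunE lfunD lfunZ.
pose P : 'Hom(M, {ffun 'I_n -> D}) := lfun_of lin.
have PE x (l : 'I_n) : P x l = p l x by rewrite lfun_ofE ffunE.
have PV : (P @: V)%VS = fullv.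
  apply/eqP; rewrite eqEsubv subvf; apply/subvP => y _.
  have [x Vx xP] := surj (fun l => if insub l is Some i then y i else 0).
  suff -> : y = P x by apply: memv_img.
  by apply/ffunP => l; rewrite PE xP ?ltn_ord // valK.
have [s sP] := lfun_section PV.
have dlin l : linear (fun d : D => [ffun i : 'I_n => if i == l :> nat then d else 0]).
  move=> c x y; apply/ffunP => i; rewrite !ffunE; case: ifP => // _.
  by rewrite scaler0 addr0.
pose t l : 'Hom(D, M) := (s \o lfun_of (dlin l))%VF.
have tV l d : t l d \in V by rewrite comp_lfunE (sP _).1.
have pt i l d : (i < n)%N -> p i (t l d) = if i == l then d else 0.
  move=> ni; rewrite -[i]/(val (Ordinal ni)) -PE comp_lfunE (sP _).2.
  by rewrite lfun_ofE ffunE.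
exists t; split=> // [l a d ln|x Vx].
  apply/kp => [|i ni]; first by rewrite memvB // sV.
  rewrite lfunB (hp i ni) ?tV // !pt //; case: ifP => _; rewrite ?lfun0 ?subrr //.
apply/kp => [|i ni]; first by rewrite memvB // memv_suml.
rewrite lfunB lfun_sum (bigD1 (Ordinal ni)) //= big1 => [|j nj].
  by rewrite pt // eqxx addr0 subrr.
by rewrite pt // -[i]/(val (Ordinal ni)) val_eqE eq_sym (negPf nj).
Qed.

End Sections.

Lemma dual_vector (k : fieldType) (V : vectType k) (u : V) :
  u != 0 -> exists phi : {scalar V}, phi u = 1.
Proof.
move=> u0; have [i ci] : exists i, coord (vbasis {:V}) i u != 0.
  apply/existsP; apply: contraR u0; rewrite negb_exists => /forallP c0.
  rewrite (coord_vbasis (memvf u)) big1 // => i _.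
  by rewrite (eqP (negPn (c0 i))) scale0r.
pose phi x := (coord (vbasis {:V}) i u)^-1 * coord (vbasis {:V}) i x.
have lin : scalar phi.
  by move=> c x y; rewrite /phi linearP mulrDr mulrCA.
exists (HB.pack phi (GRing.isSemilinear.Build k V k *%R phi
  (GRing.semilinear_linear lin)) : {scalar V}).
by rewrite /= /phi mulVf.
Qed.

Lemma exists_minimal (T : Type) (P : T -> Prop) (f : T -> nat) :
  (exists x, P x) -> exists2 x, P x & forall y, P y -> (f x <= f y)%N.
Proof.
case=> x; have [n] := ubnP (f x); elim: n x => // n IHn x fx Px.
case: (classic (exists2 y, P y & (f y < f x)%N)) => [[y Py fy]|nex].
  by apply: (IHn y) => //; apply: leq_trans fy _.
exists x => // y Py; rewrite leqNgt; apply/negP => fy; apply: nex.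
by exists y.
Qed.

(** * The quotient A / J acts on D as the full endomorphism ring *)

Section Density.
Variables (k : fieldType) (A : falgType k) (D : fdmod A).
Variables (J : {vspace regular_fdmod A}) (n : nat)
  (p : nat -> 'Hom(regular_fdmod A, D)).
Hypothesis jq : joint_quot fullv J n p.
Hypothesis JD : forall a, a \in J -> forall d, fdm_act D a d = 0.
Hypothesis EndD : End_is_k D.

(** Since [p l a] is [a] applied to [p l 1], an element that kills [D] has all its coordinates in
    [A / J] equal to 0. *)
Lemma annihilatorP a : a \in J <-> forall d, fdm_act D a d = 0.
Proof.
have [hp _ kp] := jq; split=> [Ja d|a0]; first exact: JD.
apply/kp => [|l ln]; first exact: memvf.
have := hp l ln a 1 (memvf _).
by rewrite act_regular mulr1 a0.
Qed.

Let u l := p l 1.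

(** Because [J] kills [D], each map d |-> (s l d) v is an endomorphism of [D], hence a scalar [c l].
    Applying 1, which is the sum of the [s l (u l)] modulo [J], to v gives the formula. *)
Lemma standard_span (v : D) : exists c : 'I_n -> k, v = \sum_l c l *: u l.
Proof.
have [s [_ hs es]] := joint_quot_section (submod_full _) jq.
have lin l : linear (fun d => fdm_act D (s l d) v).
  by move=> c x y; rewrite lfunD lfunZ actD actZ.
have /fin_all_exists[c cP] (l : 'I_n) : exists c, lfun_of (lin l) = c *: \1%VF.
  suff /EndD[c [e _]] : is_hom (lfun_of (lin l)) by exists c.
  apply/is_homP => a d; rewrite !lfun_ofE -fdm_actM.
  by apply/eqP; rewrite -subr_eq0 -actB JD // -act_regular hs.
exists c; have := es 1 (memvf _) => /JD/(_ v)/eqP.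
rewrite actB fdm_act1 subr_eq0 act_sum => /eqP->.
apply: eq_bigr => l _; have /lfunP/(_ (u l)) := cP l.
by rewrite lfun_ofE scale_lfunE lfunE.
Qed.

(** The coordinates a u_l of [a] can be prescribed at will, and the u_l span [D]: prescribe a u_l =
    f(u_l). *)
Lemma standard_dense (f : 'End(D)) : exists a, fdm_act D a = f.
Proof.
have [hp surj _] := jq; have [a _ aP] := surj (fun l => f (u l)).
exists a; apply/lfunP => v; have [c ->] := standard_span v.
rewrite !lfun_sum; apply: eq_bigr => l _; rewrite !lfunZ; congr (_ *: _).
have ln := ltn_ord l; rewrite -aP // /u.
by rewrite -(hp l ln) ?memvf // act_regular mulr1.
Qed.

(** For x0 nonzero in [S], the maps d |-> (s l d) x0 are homomorphisms [D -> S], and they cannot all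
    vanish because 1 acts as the identity. A nonzero one is injective by density and surjective by
    simplicity. *)
Lemma standard_simple_iso S :
  simple_mod S -> (forall a, a \in J -> forall x, fdm_act S a x = 0) -> isomorphic S D.
Proof.
move=> [S0 simS] JS.
have [x0 nx0] : exists x : S, x != 0.
  exists (vpick fullv); rewrite vpick0; exact/eqP.
have [s [_ hs es]] := joint_quot_section (submod_full _) jq.
have lin l : linear (fun d => fdm_act S (s l d) x0).
  by move=> c x y; rewrite lfunD lfunZ actD actZ.
pose E l : 'Hom(D, S) := lfun_of (lin l).
have hE (l : 'I_n) : is_hom (E l).
  apply/is_homP => a d; rewrite !lfun_ofE -fdm_actM.
  by apply/eqP; rewrite -subr_eq0 -actB JS // -act_regular hs.
have [l /eqP El] : exists l : 'I_n, E l != 0.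
  apply/existsP; apply: contraR nx0; rewrite negb_exists => /forallP E0.
  have := es 1 (memvf _) => /JS/(_ x0)/eqP.
  rewrite actB fdm_act1 subr_eq0 act_sum => /eqP->.
  rewrite big1 // => l _; have /eqP/lfunP/(_ (u l)) := negPn (E0 l).
  by rewrite lfun_ofE zero_lfunE.
apply: isomorphic_sym; exists (E l); split=> //.
  apply/eqP/lker0P => x y; move/eqP; rewrite -subr_eq0 -lfunB => /eqP Exy.
  apply/eqP; rewrite -subr_eq0; apply: contraT => nxy; case: El.
  have [phi phi1] := dual_vector nxy; apply/lfunP => z.
  have linz : linear (fun w : D => phi w *: z).
    by move=> c w w'; rewrite linearP scalerDl scalerA.
  have [a aP] := standard_dense (lfun_of linz).
  have -> : z = fdm_act D a (x - y) by rewrite aP lfun_ofE phi1 scale1r.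
  by move/is_homP: (hE l) => ->; rewrite Exy lfun0 zero_lfunE.
have := simS (limg (E l)) (submod_img (hE l) (submod_full D)).
case=> // im0; case: El; apply/lfunP => z; apply/eqP.
by rewrite zero_lfunE -memv0 -im0 memv_img ?memvf.
Qed.

End Density.

(** * The ideal J and the idempotent e2 *)

Section TopIdempotent.
Variables (k : fieldType) (A : falgType k) (D1 D2 : fdmod A).
Variables (J : {vspace regular_fdmod A}).
Variables (n m : nat) (p : nat -> 'Hom(regular_fdmod A, D1))
  (r : nat -> 'Hom(regular_fdmod A, D2)).
Hypotheses (sJ : is_submod J) (jp : joint_quot fullv J n p)
  (jr : joint_quot J 0%VS m r).
Hypothesis Hom21 : forall f : 'Hom(D2, D1), is_hom f -> f = 0.
Hypotheses (End1 : End_is_k D1) (End2 : End_is_k D2).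
Hypothesis simples2 : has_n_simples A 2.

Let r_hom l a x : (l < m)%N -> x \in J -> r l (a * x) = fdm_act D2 a (r l x).
Proof. by case: jr => hr _ _ lm Jx; rewrite -act_regular hr. Qed.

Let JM a x : x \in J -> a * x \in J.
Proof. by move/is_submodP: sJ => sJP Jx; rewrite -act_regular sJP. Qed.

Lemma trace_section : exists s : nat -> 'Hom(D2, A),
  [/\ forall l d, s l d \in J,
      forall l a d, (l < m)%N -> s l (fdm_act D2 a d) = a * s l d
    & forall x, x \in J -> x = \sum_(l < m) s l (r l x)].
Proof.
have [s [sJ' hs es]] := joint_quot_section sJ jr; exists s; split=> //.
  move=> l a d lm; apply/eqP; rewrite -subr_eq0 -memv0 -act_regular.
  exact: hs.
by move=> x Jx; apply/eqP; rewrite -subr_eq0 -memv0 es.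
Qed.

(** [J] is a sum of images of [D2], and x |-> (s l x) d is a homomorphism from [D2] to [D1], hence
    zero. *)
Lemma trace_kills : forall a, a \in J -> forall d, fdm_act D1 a d = 0.
Proof.
have [s [_ hs es]] := trace_section => a /es-> d; rewrite act_sum big1 // => l _.
have lin : linear (fun x => fdm_act D1 (s l x) d).
  by move=> c x y; rewrite lfunD lfunZ actD actZ.
have /Hom21/lfunP/(_ (r l a)) : is_hom (lfun_of lin).
  by apply/is_homP => b x; rewrite !lfun_ofE hs // fdm_actM.
by rewrite lfun_ofE zero_lfunE.
Qed.

Let JP := annihilatorP jp trace_kills.

Let JMr a x : x \in J -> x * a \in J.
Proof. by move=> Jx; apply/JP => d; rewrite fdm_actM; apply: trace_kills. Qed.

(** If [J] had square zero it would kill every simple module: from x v nonzero follows J v = L, so v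
    = y v with y in [J] and x y is not 0. Every simple module would then be isomorphic to [D1],
    although there are two of them. *)
Lemma trace_not_square_zero : exists x y, [/\ x \in J, y \in J & x * y != 0].
Proof.
apply: NNPP => nex; have [L [simL inj _]] := simples2.
have isoD i : isomorphic (L i) D1.
  apply: (standard_simple_iso jp trace_kills End1) => // x Jx v.
  apply: NNPP => /eqP xv; have [_ simLi] := simL i.
  have lin : linear (fun a => fdm_act (L i) a v).
    by move=> c a b; rewrite actD actZ.
  pose f : 'Hom(regular_fdmod A, L i) := lfun_of lin.
  have hf : is_hom f.
    by apply/is_homP => a b; rewrite act_regular !lfun_ofE fdm_actM.
  have [J0|Jf] := simLi (f @: J)%VS (submod_img hf sJ).
    by case/eqP: xv; apply/eqP; rewrite -memv0 -J0 -(lfun_ofE lin) memv_img.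
  have /memv_imgP[y Jy vy] : v \in (f @: J)%VS by rewrite Jf memvf.
  move: xv; rewrite vy lfun_ofE -fdm_actM => /eqP xyv.
  by apply: nex; exists x, y; split=> //; apply: contra_notN xyv => /eqP->;
    rewrite act0.
have := inj vtx1 vtx2 (isomorphic_trans (isoD _) (isomorphic_sym (isoD _))).
by move/(congr1 val).
Qed.

(** The last clause expresses that the multiplication A e (x) e A -> A is injective: contracting the
    second factor with any linear form [psi] depends only on the product. *)
Lemma top_idempotent : exists e : A,
  [/\ e * e = e, e != 0 /\ (forall d, fdm_act D1 e d = 0),
      forall a, exists c : k, e * a * e = c *: e,
      forall x, (forall d, fdm_act D1 x d = 0) ->
        exists xs ys : 'I_m -> A, x = \sum_l xs l * e * ys l
    & forall psi : {scalar A}, exists T : 'Hom(A, A),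
        forall z w, z * e = z -> e * w = w -> T (z * w) = psi w *: z].
Proof.
have [s [sJ' hs es]] := trace_section.
have [x [y [Jx Jy xy]]] := trace_not_square_zero.
have [l /eqP sly] : exists l : 'I_m, s l (r l x) * y != 0.
  apply/existsP; apply: contraR xy; rewrite negb_exists => /forallP s0.
  rewrite (es x Jx) mulr_suml big1 // => l _; exact/eqP/negPn.
have [l' rl'] : exists l' : 'I_m, r l' (s l (r l x) * y) != 0.
  apply/existsP; apply: contra_notT sly; rewrite negb_exists => /forallP r0.
  rewrite [LHS]es ?JM // big1 // => i _; by rewrite (eqP (negPn (r0 i))) lfun0.
rewrite r_hom // in rl'; set d0 := r l x in rl'; set w := r l' y in rl'.
(* The endomorphism d |-> (s l d) w of [D2] is a scalar, and it is not zero because it does not kill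
   [d0]; [v] is [w] divided by this scalar. *)
have lin : linear (fun d => fdm_act D2 (s l d) w).
  by move=> c d d'; rewrite lfunD lfunZ actD actZ.
have hE : is_hom (lfun_of lin).
  by apply/is_homP => a d; rewrite !lfun_ofE hs // fdm_actM.
have [c [cE _]] := End2 hE.
have sw d : fdm_act D2 (s l d) w = c *: d.
  by move/lfunP/(_ d): cE; rewrite lfun_ofE scale_lfunE lfunE.
have c0 : c != 0 by apply: contraNneq rl' => c0; rewrite sw c0 scale0r.
pose v := c^-1 *: w; pose iota := s l.
have iv d : fdm_act D2 (iota d) v = d.
  by rewrite lfunZ sw scalerA mulVf // scale1r.
clearbody v.
have hi a d : iota (fdm_act D2 a d) = a * iota d by apply: hs.
pose e := iota v.
(* Thus [iota] identifies [D2] with the left ideal A e, and [v] with the idempotent [e]. *)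
have iE d : iota d = iota d * e by rewrite -hi iv.
have ee : e * e = e by rewrite -iE.
have Je : e \in J by apply: sJ'.
have e0 : e != 0.
  apply: contraNneq rl' => e0; rewrite -/iota.
  by have := iE d0; rewrite e0 mulr0 => ->; rewrite act0.
have ek a : exists c : k, e * a * e = c *: e.
  have lin' : linear (fun d => fdm_act D2 (iota d * a) v).
    by move=> b d d'; rewrite lfunD lfunZ mulrDl -scalerAl actD actZ.
  have hE' : is_hom (lfun_of lin').
    by apply/is_homP => b d; rewrite !lfun_ofE hi -mulrA fdm_actM.
  have [b [/lfunP/(_ v) bE _]] := End2 hE'; exists b.
  rewrite lfun_ofE scale_lfunE lfunE /= in bE.
  by rewrite -{2}/(iota v) -hi bE lfunZ.
have ekv d : exists c : k, fdm_act D2 e d = c *: v.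
  have [b bE] := ek (iota d); exists b.
  rewrite -[LHS]iv hi iE mulrA bE.
  by rewrite actZ /e iv.
have vyE x' : x' \in J -> x' = \sum_(i < m) iota (r i x') * s i v.
  move=> Jx'; rewrite [LHS]es //; apply: eq_bigr => i _.
  by rewrite -hs // iv.
exists e; split=> //.
- by split=> // d; apply: trace_kills.
- move=> x' /JP Jx'; exists (fun i => iota (r i x')), (fun i => s i v).
  by rewrite [LHS]vyE //; apply: eq_bigr => i _; rewrite -iE.
- move=> psi.
  (* On [J] the inverse of the multiplication A e (x) e A -> J sends x to the sum of the iota(r_i x)
     (x) s_i(v); [T] is its contraction with [psi]. *)
  have linT : linear (fun x => \sum_(i < m) psi (s i v) *: iota (r i x)).
    move=> b z z'; rewrite scaler_sumr -big_split; apply: eq_bigr => i _ /=.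
    by rewrite !(lfunD, lfunZ) scalerDr !scalerA mulrC.
  exists (lfun_of linT) => z w' ze ew.
  have Jw : w' \in J by rewrite -ew JMr.
  have /fin_all_exists[b bE] (i : 'I_m) : exists b : k, iota (r i w') = b *: e.
    have [b bE] := ekv (r i w'); exists b.
    by rewrite -ew r_hom // bE lfunZ.
  rewrite lfun_ofE (eq_bigr (fun i => psi (b i *: s i v) *: z)); last first.
    by move=> i _; rewrite r_hom // hi bE -scalerAr ze scalerA (linearZ_LR psi) mulrC.
  rewrite -scaler_suml -(linear_sum psi); congr (psi _ *: _).
  rewrite [RHS]vyE //; apply: eq_bigr => i _.
  by rewrite bE -scalerAl -hs // /e iv.
Qed.

End TopIdempotent.

Lemma ord2P (v : 'I_2) : v = vtx1 \/ v = vtx2.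
Proof. by case: v => [[|[|//]] v2]; [left | right]; apply: val_inj. Qed.

Lemma sum_ord2 (V : nmodType) (F : 'I_2 -> V) : \sum_v F v = F vtx1 + F vtx2.
Proof.
rewrite !big_ord_recl big_ord0 addr0; congr (_ + F _); exact: val_inj.
Qed.

Lemma sum_stpath (V : nmodType) s t (F : stpath s t -> V) :
  \sum_p F p = F (Triv vtx1) + F (Triv vtx2) + \sum_i F (Alpha i) +
    \sum_j F (Beta j) + \sum_j \sum_i F (BetaAlpha j i).
Proof.
rewrite (reindex (@stpath_decode s t)) /=; last first.
  by exists (@stpath_code s t) => [[v|[i|[j|[j i]]]]|p] //= _; case: p.
rewrite !big_sumType /= sum_ord2 -!addrA; do 4!congr (_ + _).
by rewrite pair_big; apply: eq_bigr => -[].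
Qed.

Lemma corner_memP (k : fieldType) (A : falgType k) (e f x : A) :
  e * e = e -> f * f = f ->
  reflect (e * x = x /\ x * f = x) (x \in limg (amulr f \o amull e)%VF).
Proof.
move=> ee ff; apply: (iffP memv_imgP) => [[y _ ->]|[ex xf]].
  by rewrite comp_lfunE !lfunE /= !mulrA ee -!mulrA ff.
by exists x; rewrite ?memvf // comp_lfunE !lfunE /= ex xf.
Qed.

(** * The idempotent e1 and the corner of e1 + e2 *)

Section BasicAlgebra.
Variables (k : fieldType) (A : falgType k) (D : fdmod A) (d0 : D) (m : nat).
Hypothesis d0_neq0 : d0 != 0.
Hypothesis dense : forall f : 'End(D), exists a, fdm_act D a = f.
Variable e2 : A.
Hypotheses (ee2 : e2 * e2 = e2) (e2_neq0 : e2 != 0).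
Hypothesis e2D : forall d, fdm_act D e2 d = 0.
Hypothesis e2k : forall a, exists c : k, e2 * a * e2 = c *: e2.
Hypothesis ann : forall x, (forall d, fdm_act D x d = 0) ->
  exists xs ys : 'I_m -> A, x = \sum_l xs l * e2 * ys l.
Hypothesis coord2 : forall psi : {scalar A}, exists T : 'Hom(A, A),
  forall z w, z * e2 = z -> e2 * w = w -> T (z * w) = psi w *: z.

(* x A is made as small as possible among the x that act on D as a given
   idempotent of rank one and annihilate e2.  Then x A = x (x A), so the unique
   z in x A with x z = x is idempotent; and if alpha beta = e2 with
   alpha = alpha z, beta = z beta, then z - beta alpha would be smaller. *)
Lemma bottom_idempotent : exists (e1 : A) (u : D) (phi : {scalar D}),
  [/\ e1 * e1 = e1, e1 * e2 = 0 /\ e2 * e1 = 0,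
      forall d, fdm_act D e1 d = phi d *: u, phi u = 1
    & forall a b, e2 * a * e1 * b * e2 = 0].
Proof.
have [phi phi1] := dual_vector d0_neq0; pose u := d0.
pose Q x := [/\ e2 * x = 0, x * e2 = 0 & forall d, fdm_act D x d = phi d *: u].
have exQ : exists x, Q x.
  have lin : linear (fun d => phi d *: u).
    by move=> c d d'; rewrite linearP scalerDl scalerA.
  (* Multiplying by 1 - e2 on both sides makes the element orthogonal to [e2] and does not change
     its action on [D], where [e2] is zero. *)
  have [x xP] := dense (lfun_of lin); exists ((1 - e2) * x * (1 - e2)); split.
  - by rewrite !mulrA (mulrBr e2) mulr1 ee2 subrr !mul0r.
  - by rewrite -!mulrA [(1 - e2) * e2]mulrBl mul1r ee2 subrr !mulr0.
  - move=> d; rewrite !fdm_actM !actB !fdm_act1 !e2D !subr0 xP.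
    by rewrite lfun_ofE.
have [x [e2x xe2 xD] xmin] := exists_minimal (fun x => \dim (limg (amull x))) exQ.
have xM y : limg (amull (x * y)) = (amull x @: limg (amull y))%VS.
  by rewrite -limg_comp; congr (lfun_img _ _); apply/lfunP => z;
    rewrite comp_lfunE !lfunE /= mulrA.
have Qxx : Q (x * x).
  split=> [||d]; first by rewrite mulrA e2x mul0r.
    by rewrite -mulrA xe2 mulr0.
  by rewrite fdm_actM !xD linearZ_LR /= phi1 mulr1.
have ksub (y z : A) : (limg (amull (y * z)%R) <= limg (amull y))%VS.
  apply/subvP => _ /memv_imgP[w _ ->]; apply/memv_imgP; exists (z * w).
    exact: memvf.
  by rewrite !lfunE /= mulrA.
have xxE : limg (amull (x * x)) = limg (amull x).
  by apply/eqP; rewrite eqEdim ksub xmin.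
have kx y : y \in limg (amull x) -> x * y = 0 -> y = 0.
  move=> yx xy; have := limg_ker_dim (amull x) (limg (amull x)).
  rewrite -xM xxE -[RHS]add0n => /addIn/eqP; rewrite dimv_eq0 => /eqP k0.
  by apply/eqP; rewrite -memv0 -k0 memv_cap yx memv_ker lfunE /= xy eqxx.
have /memv_imgP[w _ xE] : x \in limg (amull (x * x)).
  by rewrite xxE; apply/memv_imgP; exists 1; rewrite ?memvf // lfunE /= mulr1.
rewrite lfunE /= -mulrA in xE; set z := x * w in xE.
have xA y : z * y \in limg (amull x).
  by apply/memv_imgP; exists (w * y); rewrite ?memvf // lfunE /= mulrA.
have zz : z * z = z.
  apply/eqP; rewrite -subr_eq0; apply/eqP/kx.
    by rewrite memvB // -[z]mulr1 xA.
  by rewrite mulrBr mulrA -xE -xE subrr.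
have e2z : e2 * z = 0 by rewrite mulrA e2x mul0r.
have ze2 : z * e2 = 0 by apply: kx; rewrite ?xA // mulrA -xE.
have zD d : fdm_act D z d = phi d *: u.
  rewrite /z fdm_actM xD; congr (_ *: _).
  have := congr1 (fun a => phi (fdm_act D a d)) xE.
  rewrite /z !fdm_actM !xD !linearZ_LR /= phi1 !mulr1 => ->.
  by [].
have zx : (limg (amull z) <= limg (amull x))%VS by apply: ksub.
clearbody z; exists z, u, phi; split=> // a b.
have [c cE] := e2k (a * z * b); rewrite !mulrA in cE; rewrite cE.
case: (eqVneq c 0) => [->|c0]; first by rewrite scale0r.
pose al := e2 * a * z; pose be := c^-1 *: (z * b * e2).
have alz : al * z = al by rewrite -mulrA zz.
have albe : al * be = e2.
  by rewrite -scalerAr /al !mulrA -[_ * z * z]mulrA zz cE scalerA mulVf ?scale1r.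
have zbe : z * be = be by rewrite -scalerAr !mulrA zz.
have bee2 : be * e2 = be by rewrite -scalerAl -(mulrA _ e2) ee2.
pose f := z - be * al.
have zf : z * f = f by rewrite mulrBr zz mulrA zbe.
have Qf : Q f.
  split=> [||d].
  - by rewrite mulrBr e2z -zbe !mulrA e2z !mul0r subrr.
  - by rewrite mulrBl ze2 -alz -!mulrA ze2 !mulr0 subrr.
  - by rewrite actB zD -bee2 !fdm_actM e2D lfun0 subr0.
have zfE : limg (amull f) = limg (amull z).
  apply/eqP; rewrite eqEdim -{1}zf ksub /=.
  exact: leq_trans (dimvS zx) (xmin _ Qf).
have /memv_imgP[w' _ zE] : z \in limg (amull f).
  by rewrite zfE; apply/memv_imgP; exists 1; rewrite ?memvf // lfunE /= mulr1.
(* By minimality [z] lies in f A, and [al] kills f A. Hence al = al z = 0, against al be = e2. *)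
have alf : al * f = 0.
  by rewrite mulrBr alz mulrA albe -{2}alz /al !mulrA ee2 -[_ * z * z]mulrA zz subrr.
have al0 : al = 0 by rewrite -alz zE lfunE /= mulrA alf mul0r.
by case/eqP: e2_neq0; rewrite -albe al0 mul0r.
Qed.

(** The arrows are bases of e2 A e1 and e1 A e2, and their relations are e2 A e1 A e2 = 0. The
    corner e1 A e1 is k e1 + e1 A e2 A e1, since [e1] acts on [D] with rank one and the annihilator
    of [D] is A e2 A. *)
Lemma basic_morita : exists s t, morita_equivalent A (Ast k s t).
Proof.
have [e1 [u [phi [ee1 [e12 e21] e1D phi1 e2e1]]]] := bottom_idempotent.
pose e := e1 + e2.
have ee : e * e = e by rewrite mulrDl !mulrDr ee1 ee2 e12 e21 addr0 add0r.
pose U (a b : A) := limg (amulr b \o amull a)%VF.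
have aC : is_aspace (U e e).
  apply/andP; split; last first.
    apply/prodvP => x y /(corner_memP _ ee ee)[ex xe] /(corner_memP _ ee ee)[ey ye].
    by apply/(corner_memP _ ee ee); rewrite mulrA ex -mulrA ye.
  apply/has_algidP; exists e; split=> [||x]; last by move/(corner_memP _ ee ee).
    by apply/(corner_memP _ ee ee).
  apply: contra_neq e2_neq0 => e0.
  by rewrite -ee2 -[LHS]add0r -{1}e12 -mulrDl -/e e0 mul0r.
pose C : {aspace A} := ASpace aC.
have CP x : reflect (e * x = x /\ x * e = x) (x \in C) by apply: corner_memP.
have C1 : algid C = e.
  have Ce : e \in C by apply/CP.
  by rewrite -[LHS](CP _ (memv_algid C)).2 (algidl Ce).
pose ev (v : 'I_2) := if v == vtx1 then e1 else e2.
have evv v : ev v * ev v = ev v by rewrite /ev; case: ifP.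
have Uev v w x : x \in U (ev v) (ev w) -> ev v * x = x /\ x * ev w = x.
  by move/(corner_memP _ (evv v) (evv w)).
have eev v : e * ev v = ev v.
  by rewrite /ev; case: ifP => _; rewrite mulrDl ?ee1 ?ee2 ?e21 ?e12 ?addr0 ?add0r.
have eve v : ev v * e = ev v.
  by rewrite /ev; case: ifP => _; rewrite mulrDr ?ee1 ?ee2 ?e21 ?e12 ?addr0 ?add0r.
have UC v w x : x \in U (ev v) (ev w) -> x \in C.
  case/Uev=> vx xw; apply/CP; split; first by rewrite -vx mulrA eev.
  by rewrite -xw -mulrA eve.
have evC v : ev v \in C by apply/CP.
pose s := \dim (U e2 e1); pose t := \dim (U e1 e2).
pose al (i : 'I_s) := (vbasis (U e2 e1))`_i.
pose be (j : 'I_t) := (vbasis (U e1 e2))`_j.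
have alU i : al i \in U (ev vtx2) (ev vtx1).
  by rewrite vbasis_mem // mem_nth // size_tuple.
have beU j : be j \in U (ev vtx1) (ev vtx2).
  by rewrite vbasis_mem // mem_nth // size_tuple.
have [alE beE] := (fun i => Uev _ _ _ (alU i), fun i => Uev _ _ _ (beU i)).
rewrite /ev /= in alE beE.
have vC (x : A) : x \in C -> vsval (vsproj C x : subvs_of C) = x by apply: vsprojK.
pose pr (x : A) : subvs_of C := vsproj C x.
have prE x : x \in C -> vsval (pr x) = x by apply: vsprojK.
have rel : st_relations (fun v => pr (ev v)) (fun i => pr (al i)) (fun j => pr (be j)).
  have alC i := UC _ _ _ (alU i); have beC j := UC _ _ _ (beU j).
  split=> [|v w|i|j|i j].
  - by apply: val_inj; rewrite /= !prE // C1.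
  - case: (ord2P v) => ->; case: (ord2P w) => -> /=;
      apply: val_inj; rewrite /= !prE //= /ev /=.
  - by split; apply: val_inj; rewrite /= !prE //= /ev /= ?(alE i).1 ?(alE i).2.
  - by split; apply: val_inj; rewrite /= !prE //= /ev /= ?(beE j).1 ?(beE j).2.
  - apply: val_inj; rewrite /= !prE //= -(alE i).1 -(beE j).2 !mulrA.
    by rewrite -(alE i).2 !mulrA e2e1.
pose ph x := vsval (Ast_eval rel x).
have phlin : linear ph by move=> c x y; rewrite /ph (Ast_eval_linear rel).
have phM x y : ph (x * y) = ph x * ph y by rewrite /ph rmorphM.
have ph1 : ph 1 = e by rewrite /ph rmorph1 /= C1.
have phE x : ph x = x (Triv vtx1) *: e1 + x (Triv vtx2) *: e2 +
    \sum_i x (Alpha i) *: al i + \sum_j x (Beta j) *: be j +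
    \sum_j \sum_i x (BetaAlpha j i) *: (be j * al i).
  have alC i := UC _ _ _ (alU i); have beC j := UC _ _ _ (beU j).
  rewrite /ph /Ast_eval sum_stpath !vsvalD !vsval_sum !vsvalZ.
  rewrite !prE // /ev /=; congr (_ + _ + _ + _ + _).
  - by apply: eq_bigr => i _; rewrite prE.
  - by apply: eq_bigr => i _; rewrite prE.
  - apply: eq_bigr => j _; rewrite vsval_sum; apply: eq_bigr => i _.
    by rewrite vsvalZ /= !prE.
have ph_path p : ph (Ast_path k p) =
    vsval (Ast_eval_path (fun v => pr (ev v)) (fun i => pr (al i))
      (fun j => pr (be j)) p) by rewrite /ph Ast_evalE.
pose Ph : 'Hom(Ast k s t, A) := lfun_of phlin.
have PhE : Ph =1 ph by move=> x; rewrite lfun_ofE.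
have u0 : u != 0.
  apply: contra_eq_neq phi1 => ->; rewrite linear0 eq_sym; exact: oner_neq0.
(* Multiplication by [e2] on either side separates all components except those of [e1] and of the
   beta_j alpha_i. The vector [u] of [D] then detects [e1], as [e2] kills [D]. *)
have Ph_inj : injective Ph.
  apply/lker0P; rewrite -subv0; apply/subvP => x.
  rewrite memv_ker PhE memv0 phE => /eqP.
  set Sa := \sum_i x (Alpha i) *: al i; set Sb := \sum_j x (Beta j) *: be j.
  set Sba := \sum_j \sum_i _.
  have e2a : e2 * Sa = Sa.
    by rewrite mulr_sumr; apply: eq_bigr => i _; rewrite -scalerAr (alE i).1.
  have ae1 : Sa * e1 = Sa.
    by rewrite mulr_suml; apply: eq_bigr => i _; rewrite -scalerAl (alE i).2.
  have e1b : e1 * Sb = Sb.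
    by rewrite mulr_sumr; apply: eq_bigr => i _; rewrite -scalerAr (beE i).1.
  have be2 : Sb * e2 = Sb.
    by rewrite mulr_suml; apply: eq_bigr => i _; rewrite -scalerAl (beE i).2.
  have e1ba : e1 * Sba = Sba.
    rewrite mulr_sumr; apply: eq_bigr => j _; rewrite mulr_sumr.
    by apply: eq_bigr => i _; rewrite -scalerAr mulrA (beE j).1.
  have bae1 : Sba * e1 = Sba.
    rewrite mulr_suml; apply: eq_bigr => j _; rewrite mulr_suml.
    by apply: eq_bigr => i _; rewrite -scalerAl -mulrA (alE i).2.
  move=> sum0; have := congr1 ( *%R e2) sum0.
  rewrite mulr0 !mulrDr -!scalerAr e21 ee2 e2a -e1b -e1ba !mulrA e21 !mul0r.
  rewrite scaler0 add0r !addr0 => sum2; have := congr1 ( *%R^~ e2) sum2.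
  rewrite /= mul0r mulrDl -scalerAl ee2 -ae1 -mulrA e12 mulr0 addr0 => /eqP.
  rewrite scaler_eq0 (negPf e2_neq0) orbF => /eqP x2.
  move: sum2; rewrite x2 scale0r add0r => Sa0.
  move: sum0; rewrite x2 scale0r Sa0 !addr0 => sum0.
  have := congr1 ( *%R^~ e2) sum0.
  rewrite /= mul0r !mulrDl -scalerAl e12 scaler0 add0r be2 -bae1 -mulrA e12.
  rewrite mulr0 addr0 => Sb0; move: sum0; rewrite Sb0 addr0 => sum0.
  have Sba_u : fdm_act D Sba u = 0.
    rewrite act_sum big1 // => j _; rewrite act_sum big1 // => i _.
    by rewrite actZ -(alE i).1 !fdm_actM e2D !lfun0 scaler0.
  have /eqP := congr1 (fun a => fdm_act D a u) sum0.
  rewrite actD actZ e1D phi1 scale1r Sba_u addr0 act0 scaler_eq0 (negPf u0).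
  rewrite orbF => /eqP x1; move: sum0; rewrite x1 scale0r add0r => Sba0.
  have freea := basis_free (vbasisP (U e2 e1)).
  have freeb := basis_free (vbasisP (U e1 e2)).
  have coE i i' : coord (vbasis (U e2 e1)) i (al i') = (i == i')%:R.
    by rewrite coord_free // eq_sym.
  apply/eqP/ffunP => -[v|i|j|j i]; rewrite [RHS]ffunE.
  - by case: (ord2P v) => ->; [exact: x1 | exact: x2].
  - by move/freeP: freea => /(_ (fun i => x (Alpha i)) Sa0 i).
  - by move/freeP: freeb => /(_ (fun j => x (Beta j)) Sb0 j).
  (* Contraction with the i-th coordinate on e2 A e1 leaves a linear relation between the beta_j,
     with the coefficients of the beta_j alpha_i for this i. *)
  - have [T TP] := coord2 (coord (vbasis (U e2 e1)) i).
    move/freeP: (freeb) => /(_ (fun j => x (BetaAlpha j i)))/(_ _ j); apply.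
    transitivity (T Sba); last by rewrite Sba0 lfun0.
    rewrite lfun_sum; apply: eq_bigr => j' _.
    rewrite lfun_sum (bigD1 i) //= big1 ?addr0 => [|i' ni].
      by rewrite lfunZ TP ?(alE i).1 ?(beE j').2 //= coE eqxx scale1r.
    rewrite lfunZ TP ?(alE i').1 ?(beE j').2 //= coE.
    by rewrite eq_sym (negPf ni) scale0r scaler0.
have Ph_mem p : ph (Ast_path k p) \in limg Ph by rewrite -PhE memv_img ?memvf.
have LM x y : x \in limg Ph -> y \in limg Ph -> x * y \in limg Ph.
  case/memv_imgP=> x' _ ->; case/memv_imgP=> y' _ ->.
  by rewrite !PhE -phM -PhE memv_img ?memvf.
have Le v : ev v \in limg Ph.
  by have := Ph_mem (Triv v); rewrite ph_path /= prE.
have La x : x \in U e2 e1 -> x \in limg Ph.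
  move/coord_vbasis->; apply: memv_suml => i _; apply: memvZ.
  by have := Ph_mem (Alpha i); rewrite ph_path /= prE //; apply: UC (alU i).
have Lb x : x \in U e1 e2 -> x \in limg Ph.
  move/coord_vbasis->; apply: memv_suml => j _; apply: memvZ.
  by have := Ph_mem (Beta j); rewrite ph_path /= prE //; apply: UC (beU j).
have Umem a b x : a * a = a -> b * b = b -> a * x * b \in U a b.
  move=> aa bb; apply/(corner_memP _ aa bb); rewrite !mulrA aa.
  by split=> //; rewrite -mulrA bb.
have Ph_img a : e * a * e \in limg Ph.
  rewrite !(mulrDl, mulrDr).
  have [c cE] := e2k a.
  rewrite [e2 * a * e2]cE; apply: memvD; apply: memvD.
  (* On [D], e1 a e1 acts as the multiple [phi (a u)] of [e1]; the difference is an element of A e2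
     A. *)
  - have [xs [ys yE]] : exists xs ys : 'I_m -> A,
        e1 * a * e1 - phi (fdm_act D a u) *: e1 = \sum_l xs l * e2 * ys l.
      apply: ann => d; rewrite actB actZ !fdm_actM !e1D lfunZ linearZ_LR.
      by rewrite /= scalerA [phi d * _]mulrC subrr.
    have -> : e1 * a * e1 = phi (fdm_act D a u) *: e1 +
        \sum_l (e1 * xs l * e2) * (e2 * ys l * e1).
      apply/eqP; rewrite addrC -subr_eq; apply/eqP.
      transitivity (e1 * (e1 * a * e1 - phi (fdm_act D a u) *: e1) * e1).
        by rewrite mulrBr mulrBl -scalerAr -scalerAl !mulrA !ee1
          -[_ * e1 * e1]mulrA ee1.
      rewrite yE mulr_sumr mulr_suml; apply: eq_bigr => l _.
      by rewrite !mulrA -[_ * e2 * e2]mulrA ee2.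
    rewrite memvD ?memvZ ?(Le vtx1) // memv_suml // => l _.
    exact: LM (Lb _ (Umem _ _ _ ee1 ee2)) (La _ (Umem _ _ _ ee2 ee1)).
  - exact: La _ (Umem _ _ _ ee2 ee1).
  - exact: Lb _ (Umem _ _ _ ee1 ee2).
  - exact: memvZ _ (Le vtx2).
exists s, t.
(* Fullness of [e]: by density the identity of [D] is a sum of rank one operators a_i e1 b_i, and 1
   differs from that sum by an element of A e2 A. *)
pose W := vbasis {:D}.
have /fin_all_exists[a aE] (i : 'I_(\dim {:D})) :
    exists a, forall d, fdm_act D a d = phi d *: W`_i.
  have lin : linear (fun d => phi d *: W`_i).
    by move=> c d d'; rewrite linearP scalerDl scalerA.
  by have [a aP] := dense (lfun_of lin); exists a => d; rewrite aP lfun_ofE.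
have /fin_all_exists[b bE] (i : 'I_(\dim {:D})) :
    exists a, forall d, fdm_act D a d = coord W i d *: u.
  have lin : linear (fun d => coord W i d *: u).
    by move=> c d d'; rewrite linearP scalerDl scalerA.
  by have [a' aP] := dense (lfun_of lin); exists a' => d; rewrite aP lfun_ofE.
have [xs [ys yE]] : exists xs ys : 'I_m -> A,
    1 - \sum_i a i * e1 * b i = \sum_l xs l * e2 * ys l.
  apply: ann => d; rewrite actB fdm_act1 act_sum.
  rewrite (eq_bigr (fun i => coord W i d *: W`_i)) => [|i _].
    by rewrite -coord_vbasis ?memvf // subrr.
  by rewrite !fdm_actM bE e1D aE !linearZ_LR /= phi1 !mulr1.
pose I := ('I_(\dim {:D}) + 'I_m)%type.
pose X (i : I) := match i with inl i => a i * e1 | inr l => xs l * e2 end.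
pose Y (i : I) := match i with inl i => e1 * b i | inr l => e2 * ys l end.
have PhM x y : Ph (x * y) = Ph x * Ph y by rewrite !PhE.
have Ph_img' x : Ph 1 * x * Ph 1 \in limg Ph by rewrite PhE ph1.
apply: (@morita_of_full_corner _ _ _ Ph PhM Ph_inj Ph_img' I X Y).
rewrite big_sumType /= PhE ph1 -[RHS](subrK (\sum_i a i * e1 * b i)) yE addrC.
congr (_ + _); apply: eq_bigr => i _; rewrite !mulrA.
  by rewrite -[_ * e2 * e]mulrA (eve vtx2) -[_ * e2 * e2]mulrA ee2.
by rewrite -[_ * e1 * e]mulrA (eve vtx1) -[_ * e1 * e1]mulrA ee1.
Qed.

End BasicAlgebra.

Theorem quasi_hereditary2_morita (k : fieldType) (A : falgType k) :
  quasi_hereditary A 2 -> exists s t, morita_equivalent A (Ast k s t).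
Proof.
case=> simples [Delta [indec EndD HomD ExtD filtA]].
have [J [n [p [m [r [sJ jp jr]]]]]] := standard_rearrange ExtD filtA.
have Hom21 (f : 'Hom(Delta vtx2, Delta vtx1)) : is_hom f -> f = 0.
  move=> hf; apply: NNPP => nf; suff: (vtx2 <= vtx1)%N by [].
  by apply: HomD; exists f.
have [e2 [ee2 [e2n e2D] e2k ann coord2]] :=
  top_idempotent sJ jp jr Hom21 (EndD _) (EndD _) simples.
have d0 : vpick {: Delta vtx1} != 0.
  by rewrite vpick0; apply/eqP; case: (indec vtx1).
apply: (basic_morita d0 _ ee2 e2n e2D e2k ann coord2) => f.
exact: standard_dense jp (trace_kills sJ jr Hom21) (EndD _) f.
Qed.

(** * Matrix pencils *)

Section KroneckerIndec.
Variable k : fieldType.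

(* A pencil (a, b) is a pair of linear maps k^m -> k^n acting on row vectors;
   a direct sum decomposition is a pair of idempotents that intertwines it. *)
Definition pencil_indec m n (a b : 'M[k]_(m, n)) : Prop :=
  forall (E : 'M_m) (F : 'M_n), E *m E = E -> F *m F = F ->
    E *m a = a *m F -> E *m b = b *m F ->
    (E = 0 /\ F = 0) \/ (E = 1%:M /\ F = 1%:M).

Definition pencil_equiv m n (a b a' b' : 'M[k]_(m, n)) : Prop :=
  exists (P : 'M_m) (Q : 'M_n), [/\ P \in unitmx, Q \in unitmx,
    P *m a = a' *m Q & P *m b = b' *m Q].

Lemma pencil_equiv_tr m n (a b a' b' : 'M[k]_(m, n)) :
  pencil_equiv a^T b^T a'^T b'^T -> pencil_equiv a' b' a b.
Proof.
case=> P [Q [uP uQ ea eb]]; exists Q^T, P^T; rewrite !unitmx_tr uP uQ.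
by split=> //; apply: trmx_inj; rewrite !trmx_mul !trmxK.
Qed.

Lemma pencil_indec_tr m n (a b : 'M[k]_(m, n)) :
  pencil_indec a b -> pencil_indec a^T b^T.
Proof.
move=> ind E F EE FF Ea Eb.
have tr1 p : (1%:M : 'M[k]_p)^T = 1%:M by rewrite tr_scalar_mx.
have [||||[F0 E0]|[F1 E1]] := ind F^T E^T.
- by rewrite -trmx_mul FF.
- by rewrite -trmx_mul EE.
- by apply: trmx_inj; rewrite !trmx_mul !trmxK.
- by apply: trmx_inj; rewrite !trmx_mul !trmxK.
- by left; split; apply: trmx_inj; rewrite ?E0 ?F0 trmx0.
- by right; split; apply: trmx_inj; rewrite ?E1 ?F1 tr1.
Qed.

(** The common kernel of [a] and [b] is a direct summand: the idempotent E = R R^+ satisfies E a = a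
    and E b = b, so (E, 1) is a decomposition, and n > 0 rules out (0, 0). *)
Lemma pencil_indec_free m n (a b : 'M[k]_(m, n)) :
  (0 < n)%N -> pencil_indec a b -> row_free (row_mx a b).
Proof.
move=> n0 ind; set R := row_mx a b; apply/row_freeP; exists (pinvmx R).
have ER : R *m pinvmx R *m R = R by apply: mulmxKpV.
have [Ea Eb] : R *m pinvmx R *m a = a /\ R *m pinvmx R *m b = b.
  by apply: eq_row_mx; rewrite -mul_mx_row.
have EE : R *m pinvmx R *m (R *m pinvmx R) = R *m pinvmx R by rewrite mulmxA ER.
have /(_ _ _)[||[_ F0]|[] //] := ind (R *m pinvmx R) 1%:M EE (mul1mx _).
- by rewrite mulmx1.
- by rewrite mulmx1.
by move/matrixP/(_ (Ordinal n0) (Ordinal n0))/eqP: F0; rewrite !mxE eqxx oner_eq0.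
Qed.

Lemma coker_exists m q N (R : 'M[k]_(m, N)) :
  row_free R -> (q + m = N)%N ->
  exists L : 'M[k]_(N, q), [/\ R *m L = 0, row_full L
    & forall r (x : 'M_(r, N)), x *m L = 0 -> (x <= R)%MS].
Proof.
move=> /eqnP fR qm; have rk : \rank (cokermx R) = q.
  by rewrite mxrank_coker fR -qm addnK.
case: q / rk qm => _; exists (col_base (cokermx R)); split.
- apply/eqP; rewrite -(mulmx_free_eq0 _ (row_base_free (cokermx R))).
  by rewrite -mulmxA mulmx_base mulmx_coker.
- exact: col_base_full.
- by move=> r x xL; rewrite submxE -[cokermx R]mulmx_base mulmxA xL mul0mx.
Qed.

(* the reflection functor of the Kronecker quiver *)
Lemma reflection_exists m n q (a b : 'M[k]_(m, n)) :
  row_free (row_mx a b) -> (q + m = n + n)%N ->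
  exists c d : 'M[k]_(n, q), [/\ a *m c + b *m d = 0,
    forall F : 'M_q, c *m F = 0 -> d *m F = 0 -> F = 0
    & forall P Q : 'M[k]_(m, n), P *m c + Q *m d = 0 ->
        exists Y : 'M_m, P = Y *m a /\ Q = Y *m b].
Proof.
move=> fR qm; have [L [RL fL xL]] := coker_exists fR qm.
exists (usubmx L), (dsubmx L); split=> [|F cF dF|P Q PQ].
- by rewrite -mul_row_col vsubmxK.
- case/row_fullP: fL => B BL; rewrite -[F]mul1mx -BL -mulmxA -[L]vsubmxK.
  by rewrite mul_col_mx cF dF col_mx0 mulmx0.
- have := xL _ (row_mx P Q); rewrite -{1}[L]vsubmxK mul_row_col => /(_ PQ).
  by case/submxP=> Y; rewrite mul_mx_row => /eq_row_mx; exists Y.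
Qed.

(** An idempotent (E, F) of (c, d) restricts to the kernel k^m of the column (c; d) as some Y, and
    (Y, E) is an idempotent of (a, b). It determines F because that column is onto. *)
Lemma reflection_indec m n q (a b : 'M[k]_(m, n)) (c d : 'M[k]_(n, q)) :
  (0 < m)%N -> row_free (row_mx a b) ->  a *m c + b *m d = 0 ->
  (forall F : 'M_q, c *m F = 0 -> d *m F = 0 -> F = 0) ->
  (forall P Q : 'M[k]_(m, n), P *m c + Q *m d = 0 ->
        exists Y : 'M_m, P = Y *m a /\ Q = Y *m b) ->
  pencil_indec a b -> pencil_indec c d.
Proof.
move=> m0 fR acbd Finj lift ind E F EE FF Ec Ed.
have [Y [aE bE]] : exists Y : 'M_m, a *m E = Y *m a /\ b *m E = Y *m b.
  apply: lift; rewrite -!mulmxA Ec Ed !mulmxA -mulmxDl acbd; exact: mul0mx.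
have YY : Y *m Y = Y.
  apply: (row_free_inj fR); rewrite -mulmxA !mul_mx_row -aE -bE.
  by rewrite !mulmxA -aE -bE -!mulmxA EE.
have [//|//|//|//|[_ E0]|[_ E1]] := ind Y E; [left|right]; split=> //.
  by apply: Finj; rewrite -?Ec -?Ed E0 mul0mx.
apply/eqP; rewrite -subr_eq0; apply/eqP/Finj; rewrite mulmxBr mulmx1.
  by rewrite -Ec E1 mul1mx subrr.
by rewrite -Ed E1 mul1mx subrr.
Qed.

(** Reflection takes the size (m, n) to (n, 2n - m): it preserves m - n and, as n < m, lowers n,
    down to pencils without columns. An equivalence of the reflected pencils lifts to the kernels,
    which are the original ones. *)
Lemma pencil_unique_lt m n (a b a' b' : 'M[k]_(m, n)) : (n < m)%N ->
  pencil_indec a b -> pencil_indec a' b' -> pencil_equiv a b a' b'.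
Proof.
have [N] := ubnP n; elim: N => // N IHN in m n a b a' b' * => nN nm ia ia'.
case: (posnP n) => [n0|n0].
  rewrite n0 in a b a' b' {ia ia' nm nN} *.
  exists 1%:M, 1%:M; rewrite !unitmx1; split=> //;
    by apply/matrixP => i [].
have [fa fa'] := (pencil_indec_free n0 ia, pencil_indec_free n0 ia').
have mn : (m <= n + n)%N.
  by move: (fa); rewrite /row_free => /eqP {1}<-; apply: rank_leq_col.
pose q := (n + n - m)%N; have qm : (q + m = n + n)%N by rewrite subnK.
have qn : (q < n)%N by rewrite -(ltn_add2r m) qm ltn_add2l.
have m0 : (0 < m)%N by apply: leq_trans nm.
have [c [d [e1 e2 e3]]] := reflection_exists fa qm.
have [c' [d' [e1' e2' e3']]] := reflection_exists fa' qm.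
have ic := reflection_indec m0 fa e1 e2 e3 ia.
have ic' := reflection_indec m0 fa' e1' e2' e3' ia'.
have [P [Q [uP uQ Pc Pd]]] := IHN n q c d c' d' (leq_trans qn nN) qn ic ic'.
have [Y [aY bY]] : exists Y : 'M_m, a' *m P = Y *m a /\ b' *m P = Y *m b.
  apply: e3; rewrite -!mulmxA Pc Pd !mulmxA -mulmxDl e1'; exact: mul0mx.
exists Y, P; split=> //; rewrite -row_free_unit; apply: inj_row_free => v vY.
apply: (row_free_inj fa'); apply: (row_free_inj (_ : row_free (block_mx P 0 0 P))).
  by rewrite row_free_unit unitmxE det_ublock unitrM -!unitmxE uP.
rewrite -!mulmxA mul_row_block !mulmx0 addr0 add0r aY bY -mul_mx_row mulmxA vY.
by rewrite !mul0mx.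
Qed.

Lemma pencil_unique m n (a b a' b' : 'M[k]_(m, n)) : m != n ->
  pencil_indec a b -> pencil_indec a' b' -> pencil_equiv a b a' b'.
Proof.
rewrite neq_ltn => /orP[mn|] ia ia'; last exact: pencil_unique_lt.
apply: pencil_equiv_tr; apply: pencil_unique_lt; rewrite //;
  exact: pencil_indec_tr.
Qed.

Lemma pencil_indec_swapN m n (a b : 'M[k]_(m, n)) :
  pencil_indec a b -> pencil_indec b (- a).
Proof.
move=> ind E F EE FF Eb; rewrite mulmxN mulNmx => /oppr_inj Ea; exact: ind.
Qed.

(* Each reflection lowers the degree of a polynomial vector in the kernel. *)
Lemma pencil_no_kernel n N (a b : 'M[k]_n) (v : nat -> 'rV[k]_n) : (0 < n)%N ->
  pencil_indec a b -> (forall i, (N <= i)%N -> v i = 0) ->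
  v 0%N *m a = 0 -> (forall i, v i.+1 *m a + v i *m b = 0) ->
  forall i, v i = 0.
Proof.
move=> n0; elim: N => [|N IHN] in a b v * => ind vN va vab; first by move=> i; apply: vN.
have fa := pencil_indec_free n0 ind.
have [c [d [e1 e2 e3]]] := reflection_exists fa erefl.
have ic := pencil_indec_swapN (reflection_indec n0 fa e1 e2 e3 ind).
have vba i : v i.+1 *m a = - (v i *m b).
  by apply/eqP; rewrite -addr_eq0 vab.
have ba : b *m d = - (a *m c) by apply/eqP; rewrite -addr_eq0 addrC e1.
have vb0 i : v i *m b = 0.
  (* From v_(i+1) a = - v_i b and b d = - a c, the vectors v_i b form a kernel vector of the pencil
     (d, -c), and they vanish one index earlier. *)
  apply: (IHN d (- c) (fun i => v i *m b)) => // [j Nj||j].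
  - by apply/eqP; rewrite -oppr_eq0 -vba vN ?mul0mx.
  - by rewrite -mulmxA ba mulmxN mulmxA va mul0mx oppr0.
  - by rewrite mulmxN -[_ *m b *m d]mulmxA ba mulmxN mulmxA vba mulNmx opprK subrr.
have va0 i : v i *m a = 0 by case: i => // i; rewrite vba vb0 oppr0.
by move=> i; apply: (row_free_inj fa); rewrite mul_mx_row va0 vb0 row_mx0 mul0mx.
Qed.

End KroneckerIndec.

(** Over a general ring, so that mu = 'X gives the one-parameter family of Jordan blocks over
    k[X]. *)
Definition jordan_mx (R : nzRingType) n (mu : R) : 'M[R]_n :=
  \matrix_(i, j) (mu *+ (i == j) + (i == j.+1 :> nat)%:R).

(** * Indecomposable nilpotent matrices *)

Section Nilpotent.
Variables (k : fieldType) (n' : nat).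
Local Notation n := n'.+1.
Variable N : 'M[k]_n.
Hypothesis indecN : forall E : 'M_n, E *m E = E -> E *m N = N *m E ->
  E = 0 \/ E = 1%:M.

(* With r maximal such that x N^r <> 0, the row vectors x N^i span a direct
   summand, by an f with x N^i f = 0 for i < r and x N^r f = 1. *)
Lemma nilpotent_jordan : (exists e, N ^+ e = 0) ->
  exists2 P : 'M_n, P \in unitmx & P *m N = jordan_mx n 0 *m P.
Proof.
have NX a b : N ^+ a *m N ^+ b = N ^+ (a + b) by rewrite exprD.
have NXr a : N ^+ a *m N = N ^+ a.+1 by rewrite exprSr.
have NXl a : N *m N ^+ a = N ^+ a.+1 by rewrite exprS.
case=> e0 Ne0; have [r [Nr0 Nr1]] : exists r, N ^+ r != 0 /\ N ^+ r.+1 = 0.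
  elim: e0 Ne0 => [/eqP|e0 IH Ne0]; first by rewrite expr0 oner_eq0.
  by case: (eqVneq (N ^+ e0) 0) => [/IH //|ne]; exists e0.
have Nbig i : (r < i)%N -> N ^+ i = 0.
  by move=> ri; rewrite -(subnK ri) exprD Nr1 mulr0.
have [x xr] : exists x : 'rV_n, x *m N ^+ r != 0.
  have /rowV0Pn[_ /submxP[x ->] nz] := Nr0; by exists x.
pose X : 'M_(r.+1, n) := \matrix_(i < r.+1) (x *m N ^+ (r - i)).
have fX : row_free X.
  apply: inj_row_free => v vX; apply/rowP => i; rewrite [RHS]mxE.
  have [M] := ubnP (r - i); elim: M => // M IHM in i * => ri.
  (* Row j of [X] times N^i is x N^(r - j + i). For j < i this is 0, and for j > i the coefficient
     of v vanishes by induction. *)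
  have : v *m X *m N ^+ i = v 0 i *: (x *m N ^+ r).
    rewrite [v *m X]mulmx_sum_row mulmx_suml (bigD1 i) //= big1 ?addr0 => [|j nj].
      by rewrite rowK -scalemxAl -mulmxA NX subnK // -ltnS.
    rewrite rowK -scalemxAl -mulmxA NX.
    case: (ltngtP j i) => [ji|ij|/val_inj eji]; last by rewrite eji eqxx in nj.
      rewrite Nbig ?mulmx0 ?scaler0 //; have := ltn_ord j; lia.
    rewrite (IHM j) ?scale0r //; have := ltn_ord j; lia.
  rewrite vX mul0mx => /esym/eqP; rewrite scaler_eq0 (negPf xr) orbF.
  by move/eqP.
have [f Xf] : exists f : 'cV_n, X *m f = delta_mx ord0 0.
  have /row_freeP[B XB] := fX; exists (B *m delta_mx ord0 0).
  by rewrite mulmxA XB mul1mx.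
have xNf i : x *m N ^+ i *m f = (i == r)%:R%:M.
  case: (ltnP r i) => [ri|ir].
    rewrite Nbig // mulmx0 mul0mx gtn_eqF //.
    by apply/matrixP => a b; rewrite !mxE mul0rn.
  have iP : (r - i < r.+1)%N by lia.
  have := congr1 (row (Ordinal iP)) Xf; rewrite row_mul rowK /= subKn // => ->.
  apply/matrixP => a b; rewrite !mxE !ord1 mulr1n -val_eqE /= andbT.
  by congr (_%:R); lia.
(* [E] projects onto the span of the x N^l. It commutes with [N] because both E N and N E shift the
   summation index by one, the extreme terms being 0 by N^(r+1) = 0. *)
pose E := \sum_(i < r.+1) (N ^+ i *m f) *m (x *m N ^+ (r - i)).
have xE l : (l <= r)%N -> x *m N ^+ l *m E = x *m N ^+ l.
  move=> lr; have lr' : (r - l < r.+1)%N by rewrite ltnS leq_subr.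
  rewrite mulmx_sumr (bigD1 (Ordinal lr')) //= big1 ?addr0 => [|i ni].
    rewrite !mulmxA -[_ *m N ^+ l *m _]mulmxA NX subnKC // xNf eqxx.
    by rewrite -!mulmxA mul1mx subKn.
  rewrite !mulmxA -[_ *m N ^+ l *m _]mulmxA NX xNf.
  rewrite (_ : _ == r = false) ?mul0mx // ?scalemx0 ?raddf0 ?mul0mx //.
  apply: contraNF ni => /eqP er; apply/eqP/val_inj => /=; lia.
have EN : E *m N = N *m E.
  rewrite mulmx_suml mulmx_sumr big_ord_recl big_ord_recr /=.
  rewrite [RHS]addrC; congr (_ + _).
    rewrite subnn subn0 -!mulmxA NXr Nr1 !mulmx0.
    by rewrite !mulmxA NXl Nr1 !mul0mx.
  apply: eq_bigr => i _; rewrite !mulmxA NXl.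
  by rewrite -[_ *m N]mulmxA NXr -subSn // subSS.
have EE : E *m E = E.
  rewrite {1}/E mulmx_suml; apply: eq_bigr => i _.
  by rewrite -[_ *m E]mulmxA xE ?leq_subr.
have E1 : E = 1%:M.
  case: (indecN EE EN) => // E0; case/eqP: xr.
  by rewrite -[LHS]xE // E0 mulmx0.
have full : row_full X.
  apply/row_fullP; exists (\matrix_(i, j) (N ^+ j *m f) i 0).
  rewrite -E1 /E; apply/matrixP => i j; rewrite summxE mxE.
  by apply: eq_bigr => l _; rewrite [RHS]mxE big_ord1 [X in X * _ = _]mxE [X l j]mxE.
have rn : n = r.+1.
  by move: fX full; rewrite /row_free /row_full => /eqP-> /eqP->.
have rowX i : row i X = x *m N ^+ (r - i) by rewrite rowK.
case: rn => rn; move: Nr1 X fX rowX {Nr0 Nbig xr full Xf xNf E xE EN EE E1 f}.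
rewrite -rn => Nr1 X fX rowX.
exists X; first by rewrite -row_free_unit.
apply/row_matrixP => i; rewrite row_mul rowX -mulmxA NXr row_mul.
rewrite [RHS]mulmx_sum_row; case: (posnP i) => [i0|i_gt0].
  rewrite i0 subn0 Nr1 mulmx0 big1 // => j _.
  by rewrite !mxE i0 mul0rn add0r scale0r.
have im : (i.-1 < n)%N by apply: leq_ltn_trans (leq_pred _) (ltn_ord i).
rewrite (bigD1 (Ordinal im)) //= big1 ?addr0 => [|j nj].
  rewrite !mxE rowX /= prednK // mul0rn eqxx add0r scale1r.
  by congr (x *m N ^+ _); have := ltn_ord i; lia.
rewrite !mxE mul0rn add0r (_ : _ == _ = false) ?scale0r //.
by apply: contraNF nj => /eqP ij; apply/eqP/val_inj; rewrite /= ij.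
Qed.

End Nilpotent.

Section ClosedField.
Variable k : closedFieldType.

(** Write the characteristic polynomial as (X - mu)^e q with coprime factors. The Bezout element (v
    q)(c) is an idempotent commuting with [c], so it is 0 or 1. If it were 0, c - mu would be
    invertible; so it is 1 and c - mu is nilpotent. *)
Lemma jordan_exists n (c : 'M[k]_n) : (0 < n)%N ->
  (forall E : 'M_n, E *m E = E -> E *m c = c *m E -> E = 0 \/ E = 1%:M) ->
  exists mu, exists2 P : 'M_n, P \in unitmx & P *m c = jordan_mx n mu *m P.
Proof.
case: n c => // n c _ ind.
have /closed_rootP[mu mur] : size (char_poly c) != 1%N by rewrite size_char_poly.
have [e [q nq chE]] := multiplicity_XsubC (char_poly c) mu.
have ch0 : char_poly c != 0 by apply: monic_neq0; apply: char_poly_monic.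
rewrite ch0 /= in nq.
have cop : coprimep (('X - mu%:P) ^+ e) q.
  by rewrite coprimep_expl // coprimep_sym coprimep_XsubC.
have /Bezout_eq1_coprimepP[[u v] /= uv] := cop.
pose N := c - mu%:M; pose g p : 'M_n.+1 := horner_mx c p.
have gM p p' : g (p * p') = g p *m g p' by rewrite /g rmorphM.
have gX : g ('X - mu%:P) = N by rewrite /g rmorphB /= horner_mx_X horner_mx_C.
have gXe d : g (('X - mu%:P) ^+ d) = N ^+ d by rewrite /g rmorphXn /= -/(g _) gX.
have g0 : g q *m N ^+ e = 0 by rewrite -gXe -gM -chE; apply: Cayley_Hamilton.
have guv : g u *m N ^+ e + g (v * q) = 1%:M.
  by rewrite -gXe -gM /g -rmorphD uv rmorph1.
have gC p p' : g p *m g p' = g p' *m g p by rewrite -!gM mulrC.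
have [E0|E1] : g (v * q) = 0 \/ g (v * q) = 1%:M.
- apply: ind; last first.
    by have := gC (v * q) 'X; rewrite {2 3}/g horner_mx_X.
  rewrite -[RHS]mulmx1 -guv mulmxDr mulmxA [g (v * q) *m g u]gC gM -!mulmxA g0.
  by rewrite !mulmx0 add0r.
- case: e chE {cop uv g0} guv => [|e] chE; rewrite E0 addr0.
    by case/negP: nq; move: mur; rewrite chE expr0 mulr1.
  rewrite exprSr mulmxA => /mulmx1_unit[_ uN].
  have : eigenvalue c mu by rewrite eigenvalue_root_char.
  case/eigenvalueP => x xc /eqP[]; rewrite -[x](mulmxK uN).
  by rewrite mulmxBr xc mul_mx_scalar subrr mul0mx.
have Ne : N ^+ e = 0.
  by rewrite -[LHS]mul1mx -E1 gM -mulmxA g0 mulmx0.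
have [|P uP PN] := @nilpotent_jordan k n N _ (ex_intro _ e Ne).
  move=> E EE EN; apply: ind => //; move: EN; rewrite mulmxBr mulmxBl.
  by rewrite scalar_mxC => /addIr.
exists mu, P => //; have -> : jordan_mx n.+1 mu = jordan_mx n.+1 0 + mu%:M.
  by apply/matrixP => a b; rewrite !mxE mul0rn add0r addrC.
by rewrite mulmxDl -PN mulmxBr -scalar_mxC subrK.
Qed.

Lemma jordan_mxii n (mu : k) i : jordan_mx n mu i i = mu.
Proof. by rewrite mxE eqxx ltn_eqF ?addr0. Qed.

Lemma jordan_mx_trig n (mu : k) (i j : 'I_n) : (i < j)%N -> jordan_mx n mu i j = 0.
Proof.
move=> ij; rewrite mxE [i == j](_ : _ = false) ?ltn_eqF ?addr0 //.
  exact: ltn_trans ij _.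
by apply/eqP => e; rewrite e ltnn in ij.
Qed.

Lemma jordan_unit n (mu : k) : mu != 0 -> jordan_mx n mu \in unitmx.
Proof.
move=> mu0; rewrite unitmxE det_trig.
  by rewrite unitfE; apply/prodf_neq0 => i _; rewrite jordan_mxii.
by apply/is_trig_mxP => i j /jordan_mx_trig.
Qed.

Lemma unit_1B_nilpotent_jordan n (mu : k) :
  1%:M - mu *: jordan_mx n 0 \in unitmx.
Proof.
rewrite unitmxE det_trig.
  rewrite unitfE; apply/prodf_neq0 => i _; rewrite !mxE eqxx.
  by rewrite mul0rn add0r ltn_eqF // mulr0 subr0 oner_neq0.
apply/is_trig_mxP => i j ij; have := jordan_mx_trig 0 ij; rewrite !mxE => ->.
by rewrite mulr0 subr0 [i == j](_ : _ = false) //; by apply/eqP => e; rewrite e ltnn in ij.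
Qed.

(** Otherwise det (a + X b) vanishes at every point of an infinite field, hence is 0, and a + X b
    has a nonzero polynomial vector w in its kernel. The coefficient vectors of w contradict
    [pencil_no_kernel]. *)
Lemma pencil_regular n (a b : 'M[k]_n) : (0 < n)%N -> pencil_indec a b ->
  exists l : k, a + l *: b \in unitmx.
Proof.
move=> n0 ind; apply: NNPP => sing.
pose M : 'M[{poly k}]_n := map_mx polyC a + 'X *: map_mx polyC b.
have : \det M = 0.
  apply/eqP; apply: contra_notT sing => /closed_nonrootP[l nl]; exists l.
  rewrite unitmxE unitfE; apply: contra nl => d0; rewrite rootE -horner_evalE.
  rewrite -det_map_mx (_ : map_mx _ M = a + l *: b) //.
  by apply/matrixP => i j; rewrite !mxE /= horner_evalE !hornerE.
move/eqP/det0P => [w nw wM].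
pose v i : 'rV_n := \row_j (w 0 j)`_i.
have wMj j : \sum_h w 0 h * (a h j)%:P + 'X * (\sum_h w 0 h * (b h j)%:P) = 0.
  have := congr1 (fun A : 'rV_n => A 0 j) wM; rewrite !mxE => e; apply: etrans e.
  rewrite mulr_sumr -big_split; apply: eq_bigr => h _ /=.
  by rewrite !mxE mulrDr [_ * ('X * _)]mulrCA.
have coefv i (c : 'M_n) j : (v i *m c) 0 j = (\sum_h w 0 h * (c h j)%:P)`_i.
  by rewrite mxE coef_sum; apply: eq_bigr => h _; rewrite coefMC mxE.
have v0 := pencil_no_kernel (N := \max_j size (w 0%R j)) (v := v) n0 ind.
case/eqP: nw; apply/rowP => j; apply/polyP => i.
have := v0 _ _ _ i; rewrite mxE coef0 => /(_ _ _ _)/rowP/(_ j); rewrite !mxE; apply.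
- move=> i' le; apply/rowP => h; rewrite !mxE nth_default //.
  by apply: leq_trans le; apply: (leq_bigmax h).
- apply/rowP => h; rewrite coefv mxE.
  by have := congr1 (fun p : {poly k} => p`_0) (wMj h); rewrite coefD coefXM coef0 addr0.
- move=> i'; apply/rowP => h; rewrite mxE !coefv mxE.
  by have := congr1 (fun p : {poly k} => p`_i'.+1) (wMj h); rewrite coefD coefXM coef0.
Qed.

(** If one of the maps is invertible, the pencil amounts to a single indecomposable matrix. To find
    an invertible one, start from a' = a + l b: then a'^-1 b is similar to a Jordan block. If its
    eigenvalue is not 0, b is invertible; if it is 0, a'^-1 a is similar to 1 - l J with J
    nilpotent, and a is invertible. *)
Lemma pencil_jordan n (a b : 'M[k]_n) : (0 < n)%N -> pencil_indec a b ->
  exists mu, pencil_equiv a b 1%:M (jordan_mx n mu) \/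
             pencil_equiv a b (jordan_mx n mu) 1%:M.
Proof.
move=> n0 ind.
have gen (a' b' : 'M[k]_n) : pencil_indec a' b' -> a' \in unitmx ->
  exists mu, exists P : 'M_n, [/\ P \in unitmx, P *m (invmx a' *m b') = jordan_mx n mu *m P
    & pencil_equiv a' b' 1%:M (jordan_mx n mu)].
  move=> ind' ua'; pose c := invmx a' *m b'.
  have [E EE Ec|mu [P uP Pc]] := @jordan_exists n c n0.
    have [||||[_ ->]|[_ ->]] := ind' (a' *m E *m invmx a') E; [..|by left|by right].
    - by rewrite !mulmxA mulmxKV // -[a' *m E *m E]mulmxA EE.
    - exact: EE.
    - by rewrite mulmxKV.
    - rewrite -[_ *m b']mulmxA -/c -[_ *m c]mulmxA Ec /c !mulmxA mulmxV //.
      by rewrite mul1mx.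
  exists mu, P; split=> //; exists (P *m invmx a'), P.
  rewrite unitmx_mul uP unitmx_inv ua' mul1mx mulmxKV //; split=> //.
  by rewrite -[LHS]mulmxA.
have [l ul] := pencil_regular n0 ind.
have ind' : pencil_indec (a + l *: b) b.
  move=> E F EE FF Ea Eb; apply: ind => //; move: Ea.
  by rewrite mulmxDr mulmxDl -scalemxAr Eb scalemxAl => /addIr.
have [mu [P [uP Pc _]]] := gen _ _ ind' ul; set a' := a + l *: b in ul Pc ind'.
have bE : b = a' *m (invmx P *m jordan_mx n mu *m P).
  by rewrite -[invmx P *m _ *m P]mulmxA -Pc !mulmxA mulmxKV // mulmxV // mul1mx.
have [ua|ub] : a \in unitmx \/ b \in unitmx.
  case: (eqVneq mu 0) => [mu0|nmu]; [left|right]; last first.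
    by rewrite bE !unitmx_mul ul unitmx_inv uP jordan_unit.
  have -> : a = a' *m (invmx P *m (1%:M - l *: jordan_mx n 0) *m P).
    rewrite mulmxBr mulmxBl mulmx1 mulVmx // mulmxBr mulmx1.
    by rewrite -scalemxAr -scalemxAl -scalemxAr -mu0 -bE /a' addrK.
  by rewrite !unitmx_mul ul unitmx_inv uP unit_1B_nilpotent_jordan.
  by have [nu [_ [_ _ eqv]]] := gen _ _ ind ua; exists nu; left.
have indb : pencil_indec b a.
  by move=> E F EE FF Eb Ea; apply: ind.
have [nu [_ [_ _ [R [Q [uR uQ Rb Ra]]]]]] := gen _ _ indb ub.
by exists nu; right; exists R, Q.
Qed.

End ClosedField.

(** * Modules over A_{s,t} *)

Section PathAction.
Variables (k : fieldType) (R : comNzRingType) (iota : {rmorphism k -> R}).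
Variables (s t : nat) (V : vectType R) (op : stpath s t -> 'End(V)).
Hypothesis op_comp : forall p q v,
  op p (op q v) = oapp (fun r => op r v) 0 (stcomp p q).
Hypothesis op_one : forall v, op (Triv vtx1) v + op (Triv vtx2) v = v.
Implicit Types c d : Ast k s t.

(** The base ring [R] is k for modules and k[T] for bimodules; [iota] is the inclusion of k. *)
Definition path_act c : 'End(V) := \sum_p iota (c p) *: op p.

Lemma path_actE c v : path_act c v = \sum_p iota (c p) *: op p v.
Proof. by rewrite sum_lfunE; apply: eq_bigr => p _; rewrite scale_lfunE. Qed.

Lemma path_act_linear (x : k) c d :
  path_act (x *: c + d) = iota x *: path_act c + path_act d.
Proof.
rewrite /path_act scaler_sumr -big_split; apply: eq_bigr => p _ /=.
by rewrite !ffunE scalerA -scalerDl rmorphD rmorphM.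
Qed.

Lemma path_act_path p v : path_act (Ast_path k p) v = op p v.
Proof.
rewrite path_actE (bigD1 p) //= ffunE eqxx rmorph1 scale1r big1 ?addr0 // => q nq.
by rewrite ffunE (negPf nq) rmorph0 scale0r.
Qed.

Lemma path_act_sum I (r : seq I) (x : I -> k) (c : I -> Ast k s t) v :
  path_act (\sum_(i <- r) x i *: c i) v = \sum_(i <- r) iota (x i) *: path_act (c i) v.
Proof.
have p0 : path_act 0 v = 0.
  by rewrite path_actE big1 // => p _; rewrite ffunE rmorph0 scale0r.
elim: r => [|i r IH]; first by rewrite !big_nil.
by rewrite !big_cons path_act_linear add_lfunE scale_lfunE IH.
Qed.

Lemma path_act1 v : path_act 1 v = v.
Proof.
rewrite [1]Ast_oneE path_act_sum sum_ord2 !path_act_path rmorph1 !scale1r.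
exact: op_one.
Qed.

Lemma path_actM c d v : path_act (c * d) v = path_act c (path_act d v).
Proof.
rewrite [c * d]/(Ast_mul c d) /Ast_mul pair_big.
rewrite path_act_sum path_actE -(pair_big xpredT xpredT (fun p q =>
  iota (c p * d q) *: path_act (Ast_opath k (stcomp p q)) v)) /=.
apply: eq_bigr => p _; rewrite path_actE lfun_sum scaler_sumr; apply: eq_bigr => q _.
rewrite lfunZ scalerA rmorphM op_comp; congr (_ *: _).
case: (stcomp p q) => [r|] /=; first exact: path_act_path.
by rewrite path_actE big1 // => r _; rewrite ffunE rmorph0 scale0r.
Qed.

End PathAction.

Section PathModule.
Variables (k : fieldType) (s t : nat) (V : vectType k).
Variable op : stpath s t -> 'End(V).
Hypothesis op_comp : forall p q v,
  op p (op q v) = oapp (fun r => op r v) 0 (stcomp p q).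
Hypothesis op_one : forall v, op (Triv vtx1) v + op (Triv vtx2) v = v.

Fact path_act_lin : linear (path_act idfun op).
Proof. by move=> x c d; rewrite path_act_linear. Qed.

HB.instance Definition _ := GRing.isSemilinear.Build k (Ast k s t) 'End(V) _
  (path_act idfun op) (GRing.semilinear_linear path_act_lin).

Definition path_fdmod : fdmod (Ast k s t) :=
  @FdMod k (Ast k s t) V (path_act idfun op : {linear Ast k s t -> 'End(V)})
    (path_act1 idfun op_one) (path_actM idfun op_comp).

Lemma path_fdmodE p v : fdm_act path_fdmod (Ast_path k p) v = op p v.
Proof. exact: path_act_path. Qed.

End PathModule.

(** * The modules determined by s matrices *)

Section KModules.
Variables (s t : nat) (R : comNzRingType) (m n : nat) (a : 'I_s -> 'M[R]_(m, n)).

(** k^m and k^n consist of row vectors, on which the alpha_i act by right multiplication; row j of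
    the last component is the copy of k^n that beta_j maps onto. *)
Definition kspace : vectType R := ('rV[R]_m * 'rV[R]_n * 'M[R]_(t, n))%type.

Definition kfun (p : stpath s t) (v : kspace) : kspace :=
  match p with
  | Triv w => if w == vtx1 then (v.1.1, 0, v.2) else (0, v.1.2, 0)
  | Alpha i => (0, v.1.1 *m a i, 0)
  | Beta j => (0, 0, delta_mx j 0 *m v.1.2)
  | BetaAlpha j i => (0, 0, delta_mx j 0 *m (v.1.1 *m a i))
  end.

Lemma kspace_eq (u v : kspace) : u.1.1 = v.1.1 -> u.1.2 = v.1.2 -> u.2 = v.2 -> u = v.
Proof. by case: u => [[? ?] ?]; case: v => [[? ?] ?] /= -> -> ->. Qed.

Fact kfun_linear p : linear (kfun p).
Proof.
move=> c u v; apply: kspace_eq; case: p => [w|i|j|j i] /=;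
  try case: ifP => _; rewrite /= ?scaler0 ?addr0 //
    ?mulmxDl ?mulmxDr -?scalemxAl -?scalemxAr //.
Qed.

Definition kop p : 'End(kspace) := lfun_of (kfun_linear p).

Lemma kopE p v : kop p v = kfun p v. Proof. exact: lfun_ofE. Qed.

Lemma kop_comp p q v : kop p (kop q v) = oapp (fun r => kop r v) 0 (stcomp p q).
Proof.
rewrite !kopE; case: p => [w|i|j|j i]; case: q => [w'|i'|j'|j' i'] /=;
  try case: (ord2P w) => ->; try case: (ord2P w') => ->;
  by rewrite /= ?kopE /= ?mul0mx ?mulmx0 //; apply: kspace_eq; rewrite /= ?mulmx0.
Qed.

Lemma kop_one v : kop (Triv vtx1) v + kop (Triv vtx2) v = v.
Proof. by rewrite !kopE; apply: kspace_eq; rewrite /= ?addr0 ?add0r. Qed.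

End KModules.

Definition Kmod (k : fieldType) s t m n (a : 'I_s -> 'M[k]_(m, n)) :
  fdmod (Ast k s t) := path_fdmod (kop_comp (t := t) a) (@kop_one s t k m n a).

Section AstModules.
Variables (k : fieldType) (s t : nat).
Local Notation A := (Ast k s t).
Local Notation path := (stpath s t).
Implicit Types M N : fdmod A.

Lemma Ast_pathM (p q : path) :
  (Ast_path k p : A) * Ast_path k q = Ast_opath k (stcomp p q).
Proof. exact: Ast_mul_path. Qed.

Lemma act_pathM M (p q : path) v :
  fdm_act M (Ast_path k p) (fdm_act M (Ast_path k q) v) =
  oapp (fun r => fdm_act M (Ast_path k r) v) 0 (stcomp p q).
Proof.
by rewrite -fdm_actM Ast_pathM; case: (stcomp p q) => [r|] //=; rewrite act0.
Qed.

Lemma act_path_one M v : fdm_act M (Ast_path k (Triv vtx1)) v +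
  fdm_act M (Ast_path k (Triv vtx2)) v = v.
Proof.
rewrite -[RHS]fdm_act1 [1](_ : _ = \sum_v (Ast_path k (Triv v) : A)) //.
by rewrite act_sum sum_ord2.
Qed.

Lemma Ast_ind (P : A -> Prop) : P 0 -> (forall c x y, P x -> P y -> P (c *: x + y)) ->
  (forall v, P (Ast_path k (Triv v))) -> (forall i, P (Ast_path k (Alpha i))) ->
  (forall j, P (Ast_path k (Beta j))) ->
  (forall x y, P x -> P y -> P (x * y)) -> forall x, P x.
Proof.
move=> P0 PZ Pv Pa Pb PM x; rewrite (Ast_coord x).
elim/big_rec: _ => // p y _ Py; apply: PZ => //.
case: p => // j i; rewrite (_ : Ast_path k _ = Ast_path k (Beta j) * Ast_path k (Alpha i)).
  exact: PM.
by rewrite Ast_pathM.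
Qed.

Lemma Ast_hom_onP M N (U : {vspace M}) (f : 'Hom(M, N)) : is_submod U ->
  (forall v x, x \in U ->
    f (fdm_act M (Ast_path k (Triv v)) x) = fdm_act N (Ast_path k (Triv v)) (f x)) ->
  (forall i x, x \in U ->
    f (fdm_act M (Ast_path k (Alpha i)) x) = fdm_act N (Ast_path k (Alpha i)) (f x)) ->
  (forall j x, x \in U ->
    f (fdm_act M (Ast_path k (Beta j)) x) = fdm_act N (Ast_path k (Beta j)) (f x)) ->
  hom_on U f.
Proof.
move=> /is_submodP sU fv fa fb; apply: Ast_ind => //.
- by move=> x _; rewrite !act0 lfun0.
- by move=> c x y fx fy v Uv; rewrite !actD !actZ lfunD lfunZ fx ?fy.
- by move=> x y fx fy v Uv; rewrite !fdm_actM fx ?fy // sU.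
Qed.

Lemma Ast_homP M N (f : 'Hom(M, N)) :
  (forall v x, f (fdm_act M (Ast_path k (Triv v)) x) = fdm_act N (Ast_path k (Triv v)) (f x)) ->
  (forall i x, f (fdm_act M (Ast_path k (Alpha i)) x) = fdm_act N (Ast_path k (Alpha i)) (f x)) ->
  (forall j x, f (fdm_act M (Ast_path k (Beta j)) x) = fdm_act N (Ast_path k (Beta j)) (f x)) ->
  is_hom f.
Proof.
by move=> fv fa fb; apply: (Ast_hom_onP (submod_full M)) => *.
Qed.

Lemma Ast_submodP M (U : {vspace M}) :
  (forall v x, x \in U -> fdm_act M (Ast_path k (Triv v)) x \in U) ->
  (forall i x, x \in U -> fdm_act M (Ast_path k (Alpha i)) x \in U) ->
  (forall j x, x \in U -> fdm_act M (Ast_path k (Beta j)) x \in U) ->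
  is_submod U.
Proof.
move=> Uv Ua Ub; apply/is_submodP; apply: Ast_ind => //.
- by move=> x _; rewrite act0 mem0v.
- by move=> c x y Ux Uy v Uv'; rewrite actD actZ memvD ?memvZ ?Ux ?Uy.
- by move=> x y Ux Uy v Uv'; rewrite fdm_actM Ux ?Uy.
Qed.

Lemma KmodE m n (a : 'I_s -> 'M[k]_(m, n)) p v :
  fdm_act (Kmod t a) (Ast_path k p) v = kfun a p v.
Proof. by rewrite path_fdmodE kopE. Qed.

Section KMaps.
Variables (m n m' n' : nat) (a : 'I_s -> 'M[k]_(m, n)) (a' : 'I_s -> 'M[k]_(m', n')).
Variables (P : 'M[k]_(m, m')) (Q : 'M[k]_(n, n')).

Definition kmap_fun (v : Kmod t a) : Kmod t a' :=
  (v.1.1 *m P, v.1.2 *m Q, v.2 *m Q).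

Fact kmap_linear : linear kmap_fun.
Proof. by move=> c u v; apply: kspace_eq; rewrite /= mulmxDl -scalemxAl. Qed.

Definition kmap : 'Hom(Kmod t a, Kmod t a') := lfun_of kmap_linear.

Lemma kmapE v : kmap v = kmap_fun v. Proof. exact: lfun_ofE. Qed.

Lemma kmap_hom : (forall i, P *m a' i = a i *m Q) -> is_hom kmap.
Proof.
move=> PQ; apply: Ast_homP => [v|i|j] x; rewrite !KmodE !kmapE;
  apply: kspace_eq; rewrite /= ?mul0mx //; try case: ifP => _;
  by rewrite /= ?mul0mx // -!mulmxA ?PQ.
Qed.

End KMaps.

Lemma indecomposable_idempotent M (T : 'End(M)) : indecomposable M -> is_hom T ->
  (forall x, T (T x) = T x) -> T = 0 \/ T = \1%VF.
Proof.
move=> [_ ind] hT TT.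
have sK : is_submod (lker T).
  by rewrite -[lker T]capfv; apply: submod_ker_on => //; apply: submod_full.
have [||T0|T1] := ind (limg T) (lker T) (submod_img hT (submod_full M)) sK.
- apply/eqP; rewrite eqEsubv subvf; apply/subvP => x _.
  rewrite -[x](subrK (T x)) addrC memv_add ?memv_img ?memvf //.
  by rewrite memv_ker lfunB TT subrr.
- apply/vspaceP => x; rewrite memv_cap memv_ker memv0; apply/andP/eqP.
    by case=> /memv_imgP[y _ ->] /eqP; rewrite TT.
  by move->; rewrite mem0v lfun0.
- left; apply/lfunP => x; apply/eqP; rewrite zero_lfunE -memv0 -T0.
  by rewrite memv_img ?memvf.
- right; apply/lfunP => x; apply/eqP; rewrite lfunE -subr_eq0 -memv0 -T1.
  by rewrite memv_ker lfunB TT subrr.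
Qed.

Lemma Kmod_indec m n (a : 'I_s -> 'M[k]_(m, n)) (E : 'M_m) (F : 'M_n) :
  indecomposable (Kmod t a) -> E *m E = E -> F *m F = F ->
  (forall i, E *m a i = a i *m F) -> (E = 0 /\ F = 0) \/ (E = 1%:M /\ F = 1%:M).
Proof.
move=> ind EE FF EF.
have mat0 p q (X Y : 'M[k]_(p, q)) : (forall x : 'rV_p, x *m X = x *m Y) -> X = Y.
  by move=> XY; apply/row_matrixP => i; rewrite !rowE.
have [||T0|T1] := @indecomposable_idempotent _ (kmap a a E F) ind.
- exact: kmap_hom.
- by move=> x; rewrite !kmapE /kmap_fun /= -!mulmxA EE FF.
- left; split; apply: mat0 => x.
    have /lfunP/(_ ((x, 0, 0) : Kmod t a)) := T0.
    by rewrite kmapE zero_lfunE => /(congr1 (fun u => u.1.1)) /= ->; rewrite mulmx0.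
  have /lfunP/(_ ((0, x, 0) : Kmod t a)) := T0.
  by rewrite kmapE zero_lfunE => /(congr1 (fun u => u.1.2)) /= ->; rewrite mulmx0.
- right; split; apply: mat0 => x.
    have /lfunP/(_ ((x, 0, 0) : Kmod t a)) := T1.
    by rewrite kmapE lfunE => /(congr1 (fun u => u.1.1)) /= ->; rewrite mulmx1.
  have /lfunP/(_ ((0, x, 0) : Kmod t a)) := T1.
  by rewrite kmapE lfunE => /(congr1 (fun u => u.1.2)) /= ->; rewrite mulmx1.
Qed.

Lemma Kmod_iso m n (a a' : 'I_s -> 'M[k]_(m, n)) (P : 'M_m) (Q : 'M_n) :
  P \in unitmx -> Q \in unitmx -> (forall i, P *m a i = a' i *m Q) ->
  isomorphic (Kmod t a) (Kmod t a').
Proof.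
move=> uP uQ PQ; apply: isomorphic_sym; exists (kmap a' a P Q).
apply: (@is_iso_cancel _ _ _ _ _ (kmap a a' (invmx P) (invmx Q))).
- exact: kmap_hom.
- by move=> x; rewrite !kmapE; apply: kspace_eq; rewrite /= mulmxK.
- by move=> x; rewrite !kmapE; apply: kspace_eq; rewrite /= mulmxKV.
Qed.

End AstModules.

Section Simples.
Variables (k : fieldType) (s t : nat).
Local Notation A := (Ast k s t).
Local Notation path := (stpath s t).

Definition simple_op (v : 'I_2) (p : path) : 'End(k^o) :=
  (p == Triv v)%:R *: \1%VF.

Fact simple_op_comp v p q x :
  simple_op v p (simple_op v q x) =
  oapp (fun r => simple_op v r x) 0 (stcomp p q).
Proof.
have E p' y : simple_op v p' y = (p' == Triv v)%:R *: y.
  by rewrite scale_lfunE lfunE.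
transitivity ((stcomp p q == Some (Triv v))%:R *: x); last first.
  by case: (stcomp p q) => [r|]; rewrite /= ?E // scale0r.
rewrite !E scalerA -natrM mulnb; congr (_%:R *: _).
case: p q => [w|i|j|j i] [w'|i'|j'|j' i'] //=; case: (ord2P v) => ->;
  try case: (ord2P w) => ->; try case: (ord2P w') => ->; rewrite ?andbF //.
Qed.

Fact simple_op_one v x : simple_op v (Triv vtx1) x + simple_op v (Triv vtx2) x = x.
Proof.
rewrite !scale_lfunE !lfunE /=.
by case: (ord2P v) => ->; rewrite eqxx /= scale1r scale0r ?addr0 ?add0r.
Qed.

Definition Ast_simple v : fdmod A :=
  path_fdmod (simple_op_comp v) (simple_op_one v).

Lemma Ast_simpleE v (a : A) (x : k^o) : fdm_act (Ast_simple v) a x = a (Triv v) * x.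
Proof.
rewrite /= path_actE (bigD1 (Triv v)) //= big1 => [|p np].
  by rewrite scale_lfunE lfunE eqxx /= scale1r addr0.
by rewrite scale_lfunE (negPf np) scale0r scaler0.
Qed.

Lemma Ast_char v (a b : A) : (a * b) (Triv v) = a (Triv v) * b (Triv v).
Proof.
by have := fdm_actM (f := Ast_simple v) a b 1; rewrite !Ast_simpleE !mulr1.
Qed.
End Simples.

(** * Standard modules of A_{s,t} *)

Section StandardModules.
Variables (k : fieldType) (s t : nat).
Local Notation A := (Ast k s t).
Local Notation reg := (regular_fdmod A).
Local Notation e := (fun v => Ast_path k (Triv v) : A).
Local Notation e1 := (Ast_path k (Triv vtx1) : A).
Local Notation e2 := (Ast_path k (Triv vtx2) : A).
Local Notation al i := (Ast_path k (Alpha i) : A).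
Local Notation be j := (Ast_path k (Beta j) : A).
Implicit Types (a : A) (M N D : fdmod A).

Lemma Ast_trivl v a p : (e v * a) p = (sttgt p == v)%:R * a p.
Proof.
rewrite {1}(Ast_coord a) mulr_sumr sum_ffunE (bigD1 p) //= big1 => [|q nq].
  rewrite -scalerAr [X in _ *: X]Ast_triv_mul !ffunE eqxx addr0.
  by rewrite [LHS]mulrA [LHS]mulr1 mulrC.
rewrite -scalerAr [X in _ *: X]Ast_triv_mul !ffunE [p == q]eq_sym (negPf nq).
by rewrite !scaler0.
Qed.

Lemma Ast_trivr v a p : (a * e v) p = (stsrc p == v)%:R * a p.
Proof.
rewrite {1}(Ast_coord a) mulr_suml sum_ffunE (bigD1 p) //= big1 => [|q nq].
  rewrite -scalerAl [X in _ *: X]Ast_mul_triv !ffunE eqxx addr0.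
  by rewrite [LHS]mulrA [LHS]mulr1 mulrC.
rewrite -scalerAl [X in _ *: X]Ast_mul_triv !ffunE [p == q]eq_sym (negPf nq).
by rewrite !scaler0.
Qed.

Lemma Ast_corner2 a : e2 * a * e2 = a (Triv vtx2) *: e2.
Proof.
apply/ffunP => p; rewrite Ast_trivr Ast_trivl [RHS]ffunE [X in _ *: X]ffunE.
case: p => [v|i|j|j i] /=; rewrite ?mul0r ?mul1r ?[_ *: _]mulr0 //.
by case: (ord2P v) => -> /=; rewrite ?mul0r ?mul1r ?[_ *: _]mulr0 ?[_ *: _]mulr1.
Qed.

Lemma Ast_idem v : e v * e v = e v.
Proof. by rewrite Ast_pathM /= eqxx. Qed.

Lemma proj_ofP v (x : A) : reflect (x * e v = x) (x \in proj_of (Ast_e k s t v)).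
Proof.
apply: (iffP memv_imgP) => [[y _ ->]|xe]; first by rewrite lfunE /= -mulrA Ast_idem.
by exists x; rewrite ?memvf // lfunE.
Qed.

(** The simple module at vertex 1 and, in the next definition, the projective module A e2 with [g]
    in the role of e2. Both are described up to isomorphism, because the standard modules are an
    arbitrary choice of such modules. *)
Definition is_delta1 D := exists d : D, [/\ d != 0, forall x, exists c : k, x = c *: d
  & forall a, fdm_act D a d = a (Triv vtx1) *: d].

Definition is_delta2 D := exists g : D, [/\ fdm_act D e2 g = g,
  forall x, exists a, x = fdm_act D a g & forall a, fdm_act D a g = 0 -> a * e2 = 0].

Fact char1_linear : linear (fun x : A => x (Triv vtx1) : k^o).
Proof. by move=> c x y; rewrite !ffunE. Qed.

Definition trace1 : {vspace reg} :=
  (proj_of (Ast_e k s t vtx1) :&: lker (lfun_of char1_linear))%VS.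

Lemma trace1P (x : A) : (x \in trace1) = (x \in proj_of (Ast_e k s t vtx1)) && (x (Triv vtx1) == 0).
Proof. by rewrite memv_cap memv_ker lfun_ofE. Qed.

Lemma submod_proj v : is_submod (proj_of (Ast_e k s t v)).
Proof.
by apply/is_submodP => a x /proj_ofP xe; apply/proj_ofP; rewrite act_regular -mulrA xe.
Qed.

Lemma submod_trace1 : is_submod trace1.
Proof.
apply/is_submodP => a x; rewrite !trace1P => /andP[xe /eqP x0].
move/is_submodP: (submod_proj vtx1) => ->; rewrite //.
by rewrite act_regular Ast_char x0 mulr0 eqxx.
Qed.

Lemma hom_on_amulr (U : {vspace reg}) (x : A) : hom_on (N := reg) U (amulr x).
Proof. by move=> a y _; rewrite !act_regular !lfunE /= mulrA. Qed.

(** A nontrivial path starting at vertex 1 begins with some alpha_i, so it lies in the image of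
    right multiplication by alpha_i, a homomorphism A e2 -> A e1. *)
Lemma trace1_sub T : contains_images (Ast_e k s t) vtx1 T -> (trace1 <= T)%VS.
Proof.
move=> cT; have Ta i (x : A) : x * e2 = x -> x * al i \in T.
  move=> xe.
  have sub : (amulr (al i) @: proj_of (Ast_e k s t vtx2) <= proj_of (Ast_e k s t vtx1))%VS.
    apply/subvP => _ /memv_imgP[y _ ->]; apply/proj_ofP.
    by rewrite lfunE /= -mulrA Ast_pathM.
  have /subvP := cT vtx2 _ isT (@hom_on_amulr _ _) sub.
  apply; apply/memv_imgP; exists x; last by rewrite lfunE.
  exact/proj_ofP.
apply/subvP => x; rewrite trace1P => /andP[/proj_ofP xe /eqP x0].
rewrite (Ast_coord x) sum_stpath x0 scale0r add0r.
have xz p : stsrc p = vtx2 -> x p = 0.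
  by move=> sp; rewrite -xe Ast_trivr sp mul0r.
rewrite xz // scale0r add0r [X in _ + X + _]big1 => [|j _]; last by rewrite xz ?scale0r.
rewrite addr0 memvD ?memv_suml // => i _; last first.
  rewrite memv_suml // => i' _; apply: memvZ.
  have -> : Ast_path k (BetaAlpha i i') = be i * al i' by rewrite Ast_pathM.
  by apply: Ta; rewrite Ast_pathM.
apply: memvZ; have -> : Ast_path k (Alpha i) = e2 * al i by rewrite Ast_pathM.
by apply: Ta; rewrite Ast_idem.
Qed.

Lemma trace1_contains : contains_images (Ast_e k s t) vtx1 trace1.
Proof.
move=> j f; case: (ord2P j) => -> // _ hf sub; apply/subvP => _ /memv_imgP[x xe ->].
rewrite trace1P (subvP sub) ?memv_img //=.
have e2P : e2 \in proj_of (Ast_e k s t vtx2) by apply/proj_ofP; rewrite Ast_idem.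
move/proj_ofP: xe => <-; rewrite -act_regular -[X in fdm_act _ x X]Ast_idem.
rewrite -act_regular !hf ?act_regular ?Ast_idem // !Ast_char !ffunE /=.
by rewrite mul0r mulr0.
Qed.

Lemma trace1_is : is_trace (Ast_e k s t) vtx1 trace1.
Proof. by split; [exact: trace1_contains | exact: trace1_sub]. Qed.

Lemma trace2_is : is_trace (Ast_e k s t) vtx2 0%VS.
Proof. by split=> [j f|W _]; [case: (ord2P j) => -> | exact: sub0v]. Qed.

Lemma is_trace_uniq i T T' : is_trace (Ast_e k s t) i T -> is_trace (Ast_e k s t) i T' -> T = T'.
Proof.
by move=> [cT lT] [cT' lT']; apply/eqP; rewrite eqEsubv lT // lT'.
Qed.

Lemma standard_modules_exist : exists Delta, standard_modules (Ast_e k s t) Delta.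
Proof.
have [D1 D1P] := subquot_exists (submod_proj vtx1) submod_trace1 (capvSl _ _).
have [D2 D2P] := subquot_exists (submod_proj vtx2) (submod0 _) (sub0v _).
exists (fun i => if i == vtx1 then D1 else D2) => i; case: (ord2P i) => -> /=.
  by exists trace1 => //; exact: trace1_is.
by exists 0%VS => //; exact: trace2_is.
Qed.

Lemma standard_delta1 Delta : standard_modules (Ast_e k s t) Delta -> is_delta1 (Delta vtx1).
Proof.
move=> /(_ vtx1)[T tT [f [hf imf kf]]]; rewrite (is_trace_uniq tT trace1_is) in kf.
have e1P : e1 \in proj_of (Ast_e k s t vtx1) by apply/proj_ofP; rewrite Ast_idem.
have actE a : fdm_act (Delta vtx1) a (f e1) = a (Triv vtx1) *: f e1.
  rewrite -hf // act_regular; apply/eqP; rewrite -subr_eq0 -lfunZ -lfunB.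
  suff: a * e1 - a (Triv vtx1) *: e1 \in trace1.
    by rewrite -kf memv_cap memv_ker => /andP[].
  rewrite trace1P; apply/andP; split.
    by apply/proj_ofP; rewrite mulrBl -scalerAl -mulrA Ast_idem.
  rewrite !ffunE Ast_char ffunE eqxx mulr1 [X in _ - X]mulr1 ?subrr //.
exists (f e1); split=> // [|x].
  rewrite -memv_ker; apply/negP => k1; have: e1 \in trace1 by rewrite -kf memv_cap e1P.
  by rewrite trace1P ffunE eqxx oner_eq0 andbF.
have /memv_imgP[y /proj_ofP ye ->] : x \in (f @: proj_of (Ast_e k s t vtx1))%VS.
  by rewrite imf memvf.
by exists (y (Triv vtx1)); rewrite -actE -hf // act_regular ye.
Qed.

Lemma standard_delta2 Delta : standard_modules (Ast_e k s t) Delta -> is_delta2 (Delta vtx2).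
Proof.
move=> /(_ vtx2)[T tT [f [hf imf kf]]]; rewrite (is_trace_uniq tT trace2_is) in kf.
have e2P : e2 \in proj_of (Ast_e k s t vtx2) by apply/proj_ofP; rewrite Ast_idem.
have actE a : fdm_act (Delta vtx2) a (f e2) = f (a * e2) by rewrite -hf // act_regular.
exists (f e2); split=> [|x|a]; first by rewrite actE Ast_idem.
  have /memv_imgP[y /proj_ofP ye ->] : x \in (f @: proj_of (Ast_e k s t vtx2))%VS.
    by rewrite imf memvf.
  by exists y; rewrite actE ye.
rewrite actE => fa; apply/eqP; rewrite -memv0 -kf memv_cap memv_ker fa eqxx andbT.
by apply/proj_ofP; rewrite -mulrA Ast_idem.
Qed.

Lemma e2_neq0 : e2 != 0.
Proof.
by apply/eqP => /ffunP/(_ (Triv vtx2))/eqP; rewrite !ffunE eqxx oner_eq0.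
Qed.

Section Deltas.
Variables (D1 D2 : fdmod A).
Hypotheses (delta1 : is_delta1 D1) (delta2 : is_delta2 D2).

Lemma delta2_gen_neq0 (g : D2) : (forall a, fdm_act D2 a g = 0 -> a * e2 = 0) -> g != 0.
Proof.
move=> g0; apply: contra_neq e2_neq0 => gz; rewrite -Ast_idem.
by apply: g0; rewrite gz lfun0.
Qed.

Lemma delta2_corner (g x : D2) : (forall x, exists a, x = fdm_act D2 a g) ->
  fdm_act D2 e2 g = g -> fdm_act D2 e2 x = x -> exists c : k, x = c *: g.
Proof.
move=> gP eg ex; have [a xE] := gP x; exists (a (Triv vtx2)).
by rewrite -ex xE -{1}eg -!fdm_actM -mulrA mulrA Ast_corner2 actZ eg.
Qed.

Lemma delta1_e2 (x : D1) : fdm_act D1 e2 x = 0.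
Proof.
have [d [_ dP aE]] := delta1; have [c ->] := dP x.
by rewrite lfunZ aE ffunE /= scale0r scaler0.
Qed.

Lemma delta1_indecomposable : indecomposable D1.
Proof.
have [d [d0 dP aE]] := delta1; split=> [f0|U V sU sV UV UV0].
  by case/eqP: d0; apply/eqP; rewrite -memv0 -f0 memvf.
case: (eqVneq U 0%VS) => [->|]; [by left | rewrite -vpick0 => nu; right].
have Uf : U = fullv.
  apply/eqP; rewrite eqEsubv subvf; apply/subvP => x _; have [c ->] := dP x.
  have [b ub] := dP (vpick U); have b0 : b != 0.
    by apply: contraNneq nu => b0; rewrite ub b0 scale0r.
  by rewrite -[d]scale1r -(mulVf b0) -scalerA -ub !memvZ // memv_pick.
by rewrite -UV0 Uf capfv.
Qed.

(** e2 [D2] is the line of the generator [g], so the components of [g] in a decomposition, once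
    multiplied by e2, are multiples of [g], and one of the two summands contains [g]. *)
Lemma delta2_indecomposable : indecomposable D2.
Proof.
have [g [eg gP g0]] := delta2; have gn := delta2_gen_neq0 g0.
split=> [f0|U V sU sV UV UV0].
  by case/eqP: gn; apply/eqP; rewrite -memv0 -f0 memvf.
have full (W : {vspace D2}) : is_submod W -> g \in W -> W = fullv.
  move=> /is_submodP sW gW; apply/eqP; rewrite eqEsubv subvf.
  by apply/subvP => x _; have [a ->] := gP x; apply: sW.
have /memv_addP[u Uu [v Vv gE]] : g \in (U + V)%VS by rewrite UV memvf.
have sub (W : {vspace D2}) w : is_submod W -> w \in W ->
    exists2 c : k, fdm_act D2 e2 w = c *: g & c *: g \in W.
  move=> /is_submodP sW Ww; have [|c cE] := @delta2_corner g (fdm_act D2 e2 w) gP eg.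
    by rewrite -fdm_actM Ast_idem.
  by exists c => //; rewrite -cE sW.
have [c cE cU] := sub U u sU Uu; have [b bE bV] := sub V v sV Vv.
have gE' : g = c *: g + b *: g by rewrite -cE -bE -lfunD -gE.
case: (eqVneq c 0) => [c0|cn]; [left|right].
  rewrite c0 scale0r add0r in gE'; rewrite -gE' in bV.
  by rewrite -UV0 (full V) // capvf.
have gU : g \in U by rewrite -[g]scale1r -(mulVf cn) -scalerA memvZ.
by rewrite -UV0 (full U) // capfv.
Qed.

Lemma delta1_End : End_is_k D1.
Proof.
have [d [d0 dP _]] := delta1 => f _; have [c fd] := dP (f d).
exists c; split=> [|b fE].
  apply/lfunP => x; have [b ->] := dP x.
  by rewrite lfunZ fd scale_lfunE lfunE /= !scalerA mulrC.
apply/eqP; rewrite -subr_eq0; apply: contraR d0 => cb.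
move: fd; rewrite fE scale_lfunE lfunE /= => /eqP; rewrite -subr_eq0 -scalerBl.
by rewrite scaler_eq0 -opprB oppr_eq0 (negPf cb).
Qed.

Lemma delta2_End : End_is_k D2.
Proof.
have [g [eg gP g0]] := delta2; have gn := delta2_gen_neq0 g0.
move=> f /is_homP hf; have [|c fg] := @delta2_corner g (f g) gP eg.
  by rewrite -hf eg.
exists c; split=> [|b fE].
  apply/lfunP => x; have [a ->] := gP x.
  by rewrite hf fg lfunZ scale_lfunE lfunE.
apply/eqP; rewrite -subr_eq0; apply: contraR gn => cb.
move: fg; rewrite fE scale_lfunE lfunE /= => /eqP; rewrite -subr_eq0 -scalerBl.
by rewrite scaler_eq0 -opprB oppr_eq0 (negPf cb).
Qed.

Lemma delta21_Hom : ~ Hom_nonzero D2 D1.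
Proof.
have [g [eg gP _]] := delta2 => -[f /is_homP hf []]; apply/lfunP => x.
have [a ->] := gP x; rewrite hf -eg hf delta1_e2 lfun0 zero_lfunE //.
Qed.

(** [D2] is projective: a lift x = e2 x of [g] is killed by every element that kills [g], so a g |->
    a x is a section. *)
Lemma delta2_Ext N : ~ Ext1_nonzero D2 N.
Proof.
have [g [eg gP g0]] := delta2 => -[E [i [p [[_ /is_homP hp _ _ imp] []]]]].
have lin : linear (fun a => fdm_act D2 a g) by move=> c a b; rewrite actD actZ.
have [rho rhoP] : exists rho : 'Hom(D2, A), forall z, fdm_act D2 (rho z) g = z.
  have [|rho rP] := @lfun_section _ A D2 fullv (lfun_of lin).
    apply/eqP; rewrite eqEsubv subvf; apply/subvP => z _; apply/memv_imgP.
    by have [a zE] := gP z; exists a; rewrite ?memvf // lfun_ofE.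
  by exists rho => z; rewrite -{2}(rP z).2 lfun_ofE.
have /memv_imgP[x0 _ gx0] : g \in limg p by rewrite imp memvf.
pose x := fdm_act E e2 x0; have ex : fdm_act E e2 x = x by rewrite -fdm_actM Ast_idem.
have px : p x = g by rewrite hp -gx0.
have lin' : linear (fun z => fdm_act E (rho z) x).
  by move=> c z w; rewrite lfunD lfunZ actD actZ.
exists (lfun_of lin').
  apply/is_homP => a z; rewrite !lfun_ofE -fdm_actM; apply/eqP.
  rewrite -subr_eq0 -actB -ex -fdm_actM g0 ?act0 //.
  by rewrite actB fdm_actM !rhoP subrr.
by apply/lfunP => z; rewrite comp_lfunE lfun_ofE lfunE /= hp px rhoP.
Qed.

(** The quiver has no loop at vertex 1. Lift the generator to x = e1 x; the beta_j kill it, and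
    alpha_i x = e2 alpha_i x lies in the copy of [D1], which e2 kills. *)
Lemma delta1_Ext : ~ Ext1_nonzero D1 D1.
Proof.
have [d [d0 dP aE]] := delta1 => -[E [i [p [[/is_homP hi /is_homP hp _ imi imp] []]]]].
have /memv_imgP[x0 _ dx0] : d \in limg p by rewrite imp memvf.
pose x := fdm_act E e1 x0; have px : p x = d by rewrite hp -dx0 aE ffunE eqxx scale1r.
have [phi phi1] := dual_vector d0.
have lin : linear (fun z => phi z *: x).
  by move=> c z w; rewrite linearP scalerDl scalerA.
exists (lfun_of lin); last first.
  apply/lfunP => z; have [c ->] := dP z.
  by rewrite comp_lfunE lfun_ofE lfunE lfunZ px linearZ_LR /= phi1 mulr1.
apply: Ast_homP => [v z|l z|j z]; have [c ->] := dP z;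
  rewrite !lfun_ofE !lfunZ aE !ffunE /= !linearZ_LR /= phi1 mulr1.
- rewrite -fdm_actM Ast_pathM; case: (ord2P v) => -> /=.
    by rewrite mulr1.
  by rewrite mulr0 scale0r act0 scaler0.
- rewrite mulr0 scale0r.
  have : fdm_act E (al l) x \in lker p.
    by rewrite memv_ker hp px aE ffunE scale0r.
  rewrite -imi => /memv_imgP[y _ xE].
  rewrite (_ : fdm_act E _ _ = fdm_act E e2 (fdm_act E (al l) x)); last first.
    by rewrite act_pathM.
  by rewrite xE -hi delta1_e2 lfun0 scaler0.
- by rewrite mulr0 scale0r -fdm_actM Ast_pathM act0 scaler0.
Qed.

End Deltas.
End StandardModules.

(** * Modules filtered by standard modules *)

Section Filtered.
Variables (k : fieldType) (s t : nat).
Local Notation A := (Ast k s t).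
Local Notation e2 := (Ast_path k (Triv vtx2) : A).
Local Notation al i := (Ast_path k (Alpha i) : A).
Local Notation be j := (Ast_path k (Beta j) : A).
Implicit Types (a : A) (M N D : fdmod A).

(* the map (e_2 M)^t -> e_1 M given by the beta_j is injective on U *)
Definition beta_injective M (U : {vspace M}) := forall y : 'I_t -> M,
  (forall j, y j \in U /\ fdm_act M e2 (y j) = y j) ->
  \sum_j fdm_act M (be j) (y j) = 0 -> forall j, y j = 0.

Lemma sum_beta_coord (c : 'I_t -> k) j : (\sum_j c j *: be j) (Beta j) = c j.
Proof.
rewrite sum_ffunE (bigD1 j) //= big1 => [|i ni]; rewrite !ffunE.
  by rewrite eqxx addr0 [LHS]mulr1.
by rewrite (_ : _ == _ = false) ?[LHS]mulr0 //; apply: contraNF ni => /eqP[->].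
Qed.

Lemma sum_beta_e2 (c : 'I_t -> k) : (\sum_j c j *: be j) * e2 = \sum_j c j *: be j.
Proof.
by rewrite mulr_suml; apply: eq_bigr => j _; rewrite -scalerAl Ast_pathM.
Qed.

Section Deltas.
Variables (Delta : 'I_2 -> fdmod A).
Hypotheses (delta1 : is_delta1 (Delta vtx1)) (delta2 : is_delta2 (Delta vtx2)).

Lemma delta_beta_injective v : beta_injective {:Delta v}.
Proof.
case: (ord2P v) => -> y yP sum0 j.
  by rewrite -(yP j).2 (delta1_e2 delta1).
have [g [eg gP g0]] := delta2.
have /fin_all_exists[c cE] i : exists c : k, y i = c *: g.
  exact: delta2_corner gP eg (yP i).2.
have /g0 : fdm_act (Delta vtx2) (\sum_i c i *: be i) g = 0.
  rewrite act_sum -[RHS]sum0; apply: eq_bigr => i _.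
  by rewrite actZ cE lfunZ.
by rewrite sum_beta_e2 => /ffunP/(_ (Beta j)); rewrite sum_beta_coord ffunE cE => ->;
  rewrite scale0r.
Qed.

(** The property is stable under extensions: the images of the y_j in the top factor vanish because
    the factor has it, so the y_j already lie in the smaller submodule. *)
Lemma filtered_beta_injective M : filtered Delta M -> beta_injective {:M}.
Proof.
case=> r [N [N0 Nr sN stepN]].
suff: forall i, (i <= r)%N -> beta_injective (N i).
  by move=> /(_ r (leqnn r)); rewrite Nr.
elim=> [_|i IH ir].
  by move=> y yP _ j; apply/eqP; rewrite -memv0 -N0; case: (yP j).
have [NN [v [f [hf _ kf]]]] := stepN i ir.
move=> y yP sum0; have /is_submodP sNi := sN _ ir.
apply: (IH (ltnW ir)) => // j; split; last by case: (yP j).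
rewrite -kf memv_cap memv_ker (yP j).1 /=; apply/eqP.
apply: (@delta_beta_injective v (fun j => f (y j))) => [i'|].
  have [Ny ey] := yP i'; split; first exact: memvf.
  by rewrite -hf // ey.
rewrite -[RHS](lfun0 f) -sum0 lfun_sum; apply: eq_bigr => i' _.
by rewrite hf //; case: (yP i').
Qed.

Section KmodFiltered.
Variables (m n : nat) (a : 'I_s -> 'M[k]_(m, n)).

(** Number column c of k^n and of (k^n)^t by c, and coordinate c of k^m by n + c. The kernel
    [kfilt l] consists of the vectors supported on numbers below l: the first n steps add copies of
    [Delta vtx2], the last m copies of [Delta vtx1]. *)
Definition ktrunc_fun l (v : Kmod t a) : Kmod t a :=
  (\row_c (v.1.1 0 c *+ (l <= n + c)%N), \row_c (v.1.2 0 c *+ (l <= c)%N),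
   \matrix_(j, c) (v.2 j c *+ (l <= c)%N)).

Fact ktrunc_linear l : linear (ktrunc_fun l).
Proof.
by move=> x u v; apply: kspace_eq; apply/matrixP => i j; rewrite /= !mxE mulrnDl mulrnAr.
Qed.

Definition kfilt l : {vspace Kmod t a} := lker (lfun_of (ktrunc_linear l)).

Lemma kfiltP l v : v \in kfilt l <->
  [/\ forall c : 'I_m, (l <= n + c)%N -> v.1.1 0 c = 0, forall c : 'I_n, (l <= c)%N -> v.1.2 0 c = 0
    & forall j (c : 'I_n), (l <= c)%N -> v.2 j c = 0].
Proof.
rewrite memv_ker lfun_ofE; split=> [/eqP v0|[v1 v2 v3]].
  split=> [c lc|c lc|j c lc].
  - by have /rowP/(_ c) := congr1 (fun u => u.1.1) v0; rewrite !mxE lc.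
  - by have /rowP/(_ c) := congr1 (fun u => u.1.2) v0; rewrite !mxE lc.
  - by have /matrixP/(_ j c) := congr1 (fun u => u.2) v0; rewrite !mxE lc.
apply/eqP/kspace_eq; apply/matrixP => i j; rewrite /= !mxE ?ord1;
  case: (boolP (l <= _)%N) => lc; rewrite ?mulr0n ?mulr1n //.
- exact: v1.
- exact: v2.
- exact: v3.
Qed.

Lemma kfilt_submod l : is_submod (kfilt l).
Proof.
have z2 (v : Kmod t a) : v \in kfilt l -> forall i (c : 'I_n), (l <= c)%N -> (v.1.1 *m a i) 0 c = 0.
  case/kfiltP => v1 _ _ i c lc; rewrite mxE big1 // => b _.
  by rewrite v1 ?mul0r //; have := ltn_ord c; lia.
apply: Ast_submodP => [w|i|j] v vl; have := vl; rewrite KmodE => /kfiltP[v1 v2 v3].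
- by apply/kfiltP; rewrite /=; case: ifP => _; split=> *; rewrite /= ?mxE ?v1 ?v2 ?v3.
- by apply/kfiltP; split=> [c|c|j c] lc; rewrite /= 1?z2 // mxE.
- apply/kfiltP; split=> [c|c|i c] lc; rewrite /= ?mxE //.
  by rewrite big_ord1 v2 ?mulr0.
Qed.

Lemma kfilt_sub l : (kfilt l <= kfilt l.+1)%VS.
Proof.
apply/subvP => v /kfiltP[v1 v2 v3]; apply/kfiltP.
by split=> *; rewrite ?v1 ?v2 ?v3 //; apply: ltnW.
Qed.

Lemma kfilt_step2 (c : 'I_n) : subquot_iso (kfilt c.+1) (kfilt c) (Delta vtx2).
Proof.
have [g [eg gP g0]] := delta2.
have be_e2 (b : 'I_t -> k) (x : k) :
    fdm_act (Delta vtx2) (x *: e2 + \sum_j b j *: be j) g =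
    x *: g + \sum_j b j *: fdm_act (Delta vtx2) (be j) g.
  by rewrite actD actZ eg act_sum; congr (_ + _); apply: eq_bigr => j _; rewrite actZ.
pose f (v : Kmod t a) : Delta vtx2 :=
  v.1.2 0 c *: g + \sum_j v.2 j c *: fdm_act (Delta vtx2) (be j) g.
have flin : linear f.
  move=> x u v; rewrite /f /= !mxE scalerDl scalerDr scaler_sumr addrACA -big_split.
  by rewrite scalerA; congr (_ + _); apply: eq_bigr => j _; rewrite !mxE scalerDl scalerA.
have Tg w : fdm_act (Delta vtx2) (Ast_path k (Triv w)) g = (w == vtx2)%:R *: g.
  by rewrite -eg act_pathM; case: (ord2P w) => -> /=; rewrite ?scale0r ?scale1r.
have ag i : fdm_act (Delta vtx2) (al i) g = 0 by rewrite -eg act_pathM.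
pose bg j := fdm_act (Delta vtx2) (be j) g.
have Tbg w j : fdm_act (Delta vtx2) (Ast_path k (Triv w)) (bg j) = (w == vtx1)%:R *: bg j.
  by rewrite /bg act_pathM; case: (ord2P w) => -> /=; rewrite ?scale0r ?scale1r.
have abg i j : fdm_act (Delta vtx2) (al i) (bg j) = 0 by rewrite /bg act_pathM.
have bbg i j : fdm_act (Delta vtx2) (be i) (bg j) = 0 by rewrite /bg act_pathM.
have actf b v : fdm_act (Delta vtx2) b (f v) = v.1.2 0 c *: fdm_act (Delta vtx2) b g +
    \sum_j v.2 j c *: fdm_act (Delta vtx2) b (bg j).
  by rewrite lfunD lfunZ lfun_sum; congr (_ + _); apply: eq_bigr => j _; rewrite lfunZ.
exists (lfun_of flin); split.
- apply: Ast_hom_onP; first exact: kfilt_submod.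
  + move=> w v _; rewrite !(lfun_ofE flin) KmodE actf Tg.
    rewrite (eq_bigr (fun j => (w == vtx1)%:R *: (v.2 j c *: bg j))) => [|j _].
      case: (ord2P w) => -> /=; rewrite /f /= ?mxE ?scale0r ?scaler0 ?scale1r.
        by congr (_ + _); apply: eq_bigr => j _; rewrite scale1r.
      by congr (_ + _); rewrite !big1 // => j _; rewrite ?mxE scale0r.
    by rewrite Tbg !scalerA mulrC.
  + move=> i v /kfiltP[v1 _ _]; rewrite !(lfun_ofE flin) KmodE actf ag scaler0 add0r.
    rewrite [RHS]big1 => [|j _]; last by rewrite abg scaler0.
    rewrite /f /= mxE big1 => [|b _].
      by rewrite scale0r add0r big1 // => j _; rewrite mxE scale0r.
    by rewrite v1 ?mul0r //; have := ltn_ord c; lia.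
  + move=> j v _; rewrite !(lfun_ofE flin) KmodE actf.
    rewrite [X in _ + X]big1 => [|i _]; last by rewrite bbg scaler0.
    rewrite /f /= mxE scale0r add0r addr0 (bigD1 j) //= big1 => [|i ni].
      by rewrite mxE big_ord1 mxE !eqxx mul1r addr0.
    by rewrite mxE big_ord1 mxE (negPf ni) mul0r scale0r.
- apply/eqP; rewrite eqEsubv subvf; apply/subvP => x _.
  have [b xE] := gP x; rewrite xE.
  pose v : Kmod t a := (0, b (Triv vtx2) *: delta_mx 0 c,
    \matrix_(j, c') (b (Beta j) *+ (c' == c))).
  (* As g = e2 g, only the paths of [b] starting at vertex 2 matter: e2 and the beta_j. *)
  have -> : fdm_act (Delta vtx2) b g = lfun_of flin v.
    rewrite lfun_ofE /f /= !mxE !eqxx mulr1.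
    rewrite (eq_bigr (fun j => b (Beta j) *: fdm_act (Delta vtx2) (be j) g)) => [|j _].
      rewrite -be_e2 -{1}eg -fdm_actM; congr (fdm_act _ _ g); apply/ffunP => p.
      rewrite Ast_trivr ffunE ffunE [X in _ *: X]ffunE.
      case: p => [w|i|j|j i] /=; rewrite ?mul0r ?mul1r.
      - rewrite sum_ffunE big1 ?addr0 => [|j _]; last by rewrite !ffunE [LHS]mulr0.
        case: (ord2P w) => -> /=; first by rewrite mul0r [RHS]mulr0.
        by rewrite mul1r [RHS]mulr1.
      - by rewrite sum_ffunE big1 ?addr0 => [|j _]; rewrite ?ffunE [_ *: _]mulr0.
      - by rewrite sum_beta_coord [_ *: _]mulr0 add0r.
      - by rewrite sum_ffunE big1 ?addr0 => [|j' _]; rewrite ?ffunE [_ *: _]mulr0.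
    by rewrite mxE eqxx.
  apply: memv_img; apply/kfiltP; split=> [c' _|c' lc|j c' lc]; rewrite /= !mxE //.
    by rewrite [c' == c](_ : _ = false) ?andbF ?mulr0 //; apply/eqP => e; rewrite e ltnn in lc.
  by rewrite [c' == c](_ : _ = false) //; apply/eqP => e; rewrite e ltnn in lc.
- apply/vspaceP => v; rewrite memv_cap memv_ker lfun_ofE; apply/andP/idP.
    case=> /kfiltP[v1 v2 v3]; rewrite /f -be_e2 => /eqP/g0.
    rewrite mulrDl -scalerAl Ast_idem sum_beta_e2 => /ffunP v0.
    have y0 : v.1.2 0 c = 0.
      have := v0 (Triv vtx2); rewrite !ffunE sum_ffunE big1 => [|j _].
        by rewrite addr0 [_ *: _]mulr1.
      by rewrite !ffunE [LHS]mulr0.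
    have Z0 j : v.2 j c = 0.
      by have := v0 (Beta j); rewrite ffunE sum_beta_coord y0 scale0r !ffunE add0r.
    apply/kfiltP; split=> [c' lc|c' lc|j c' lc].
    + by apply: v1; have := ltn_ord c; lia.
    + case: (ltngtP c c') lc => // [cc _|/val_inj <- _ //]; exact: v2.
    + case: (ltngtP c c') lc => // [cc _|/val_inj <- _ //]; exact: v3.
  move=> vc; rewrite (subvP (kfilt_sub c)) //; move/kfiltP: vc => [v1 v2 v3]; split=> //.
  by rewrite /f v2 // scale0r add0r big1 // => j _; rewrite v3 ?scale0r.
Qed.

Lemma kfilt_step1 (c : 'I_m) : subquot_iso (kfilt (n + c).+1) (kfilt (n + c)) (Delta vtx1).
Proof.
have [d [d0 dP aE]] := delta1.
pose f (v : Kmod t a) : Delta vtx1 := v.1.1 0 c *: d.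
have flin : linear f.
  by move=> x u v; rewrite /f /= !mxE scalerDl scalerA.
exists (lfun_of flin); split.
- apply: Ast_hom_onP; first exact: kfilt_submod.
  + move=> w v _; rewrite !lfun_ofE KmodE /f lfunZ aE ffunE.
    by case: (ord2P w) => -> /=; rewrite ?scale1r // mxE !scale0r scaler0.
  + by move=> i v _; rewrite !lfun_ofE KmodE /f lfunZ aE ffunE /= mxE !scale0r scaler0.
  + by move=> j v _; rewrite !lfun_ofE KmodE /f lfunZ aE ffunE /= mxE !scale0r scaler0.
- apply/eqP; rewrite eqEsubv subvf; apply/subvP => x _; have [b ->] := dP x.
  have -> : b *: d = lfun_of flin ((b *: delta_mx 0 c, 0, 0) : Kmod t a).
    by rewrite lfun_ofE /f /= !mxE !eqxx mulr1.
  apply: memv_img; apply/kfiltP; split=> [c' lc|c' _|j c' _]; rewrite /= !mxE //.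
  rewrite [c' == c](_ : _ = false) ?andbF ?mulr0 //; apply/eqP => e.
  by move: lc; rewrite e ltnn.
- apply/vspaceP => v; rewrite memv_cap memv_ker lfun_ofE; apply/andP/idP.
    rewrite /f scaler_eq0 (negPf d0) orbF => -[/kfiltP[v1 v2 v3] /eqP y0].
    have ge (c' : 'I_n) : ~ (n + c <= c')%N by have := ltn_ord c'; lia.
    apply/kfiltP; split=> [c'|c'|j c'] lc; [|by case: (ge c')|by case: (ge c')].
    rewrite leq_add2l in lc; case: (ltngtP c c') lc => // [cc _|/val_inj <- _ //].
    by apply: v1; rewrite ltn_add2l.
  move=> vc; rewrite (subvP (kfilt_sub _)) //; move/kfiltP: vc => [v1 v2 v3]; split=> //.
  by rewrite /f v1 // scale0r.
Qed.

Lemma Kmod_filtered : filtered Delta (Kmod t a).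
Proof.
exists (n + m)%N, kfilt; split=> [||l _|l lnm].
- apply/vspaceP => v; rewrite memv0; apply/idP/eqP => [/kfiltP[v1 v2 v3]|->].
    by apply: kspace_eq; apply/matrixP => i j; rewrite /= ?ord1 ?v1 ?v2 ?v3 ?mxE.
  exact: mem0v.
- apply/vspaceP => v; rewrite memvf; apply/kfiltP.
  by split=> [c|c|j c]; have := ltn_ord c; lia.
- exact: kfilt_submod.
split; first exact: kfilt_sub.
case: (ltnP l n) => [ln|nl]; first by exists vtx2; exact: (kfilt_step2 (Ordinal ln)).
have lm : (l - n < m)%N by lia.
by exists vtx1; have := kfilt_step1 (Ordinal lm); rewrite /= subnKC.
Qed.

End KmodFiltered.
End Deltas.
End Filtered.

Section BasisCombination.
Variables (k : fieldType) (V : vectType k) (U : {vspace V}).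

Definition vcomb (x : 'rV[k]_(\dim U)) : V := \sum_i x 0 i *: (vbasis U)`_i.

Fact vcomb_linear : linear vcomb.
Proof.
move=> c x y; rewrite /vcomb scaler_sumr -big_split; apply: eq_bigr => i _ /=.
by rewrite !mxE scalerDl scalerA.
Qed.

HB.instance Definition _ := GRing.isSemilinear.Build k 'rV[k]_(\dim U) V _ vcomb
  (GRing.semilinear_linear vcomb_linear).

End BasisCombination.

Section Structure.
Variables (k : fieldType) (s t : nat).
Local Notation A := (Ast k s t).
Local Notation e1 := (Ast_path k (Triv vtx1) : A).
Local Notation e2 := (Ast_path k (Triv vtx2) : A).
Local Notation al i := (Ast_path k (Alpha i) : A).
Local Notation be j := (Ast_path k (Beta j) : A).
Implicit Types (a : A) (M N D : fdmod A).

Lemma vcomb_inj (V : vectType k) (U : {vspace V}) : injective (@vcomb k V U).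
Proof.
move=> x y /eqP; rewrite -subr_eq0 -linearB /= => /eqP xy.
apply/eqP; rewrite -subr_eq0; apply/eqP/rowP => i; rewrite [RHS]mxE.
by move/freeP: (basis_free (vbasisP U)) => /(_ (fun i => (x - y) 0 i) xy i).
Qed.

Lemma vcomb_mem (V : vectType k) (U : {vspace V}) (x : 'rV_(\dim U)) : vcomb x \in U.
Proof.
by apply: memv_suml => i _; rewrite memvZ // vbasis_mem // mem_nth // size_tuple.
Qed.

Lemma vcomb_coord (V : vectType k) (U : {vspace V}) u : u \in U ->
  vcomb (\row_i coord (vbasis U) i u) = u.
Proof.
by move=> Uu; rewrite [RHS](coord_vbasis Uu); apply: eq_bigr => i _; rewrite mxE.
Qed.

Section BetaInjective.
Variables (M : fdmod A).
Hypothesis inj : beta_injective {:M}.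

Let V1 : {vspace M} := limg (fdm_act M e1).
Let V2 : {vspace M} := limg (fdm_act M e2).
Let B : {vspace M} := (\sum_j (fdm_act M (be j) @: V2))%VS.
Let W := (V1 :\: B)%VS.

Let V1P x : x \in V1 -> fdm_act M e1 x = x.
Proof. by case/memv_imgP => y _ ->; rewrite act_pathM. Qed.

Let V2P x : x \in V2 -> fdm_act M e2 x = x.
Proof. by case/memv_imgP => y _ ->; rewrite act_pathM. Qed.

Let WV1 : (W <= V1)%VS. Proof. exact: diffvSl. Qed.

Let BV1 : (B <= V1)%VS.
Proof.
apply/subv_sumP => j _; apply/subvP => _ /memv_imgP[x _ ->].
by rewrite -[fdm_act M _ x](act_pathM (Triv vtx1) (Beta j)) memv_img ?memvf.
Qed.

Let WB : (W + B)%VS = V1. Proof. by rewrite addv_diff; apply/addv_idPl. Qed.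
Let WB0 : (W :&: B = 0)%VS. Proof. exact: capv_diff. Qed.

Let m := \dim W.
Let n := \dim V2.
Let a i : 'M[k]_(m, n) := \matrix_(l, l')
  coord (vbasis V2) l' (fdm_act M (al i) (vbasis W)`_l).

Let wf (x : 'rV_m) : M := vcomb x.
Let vf (y : 'rV_n) : M := vcomb y.
Let bf (Z : 'M_(t, n)) : M := \sum_j fdm_act M (be j) (vf (row j Z)).

Let vf_mem y : vf y \in V2. Proof. exact: vcomb_mem. Qed.
Let wf_mem x : wf x \in W. Proof. exact: vcomb_mem. Qed.
Let vfE y : fdm_act M e2 (vf y) = vf y. Proof. exact: V2P. Qed.
Let wfE x : fdm_act M e1 (wf x) = wf x. Proof. by apply/V1P/(subvP WV1). Qed.
Let bfB Z : bf Z \in B.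
Proof. by apply: memv_suml => j _; rewrite (subvP (sumv_sup j _ (subvv _))) ?memv_img. Qed.

Let alpha_wf i x : fdm_act M (al i) (wf x) = vf (x *m a i).
Proof.
rewrite /wf /vf {1}/vcomb lfun_sum mulmx_sum_row linear_sum; apply: eq_bigr => l _.
rewrite lfunZ linearZ /=; congr (_ *: _); rewrite (_ : row l (a i) = \row_l'
  coord (vbasis V2) l' (fdm_act M (al i) (vbasis W)`_l)).
  rewrite vcomb_coord // -[fdm_act M _ _](act_pathM (Triv vtx2) (Alpha i)).
  by rewrite memv_img ?memvf.
by apply/rowP => l'; rewrite !mxE.
Qed.

Definition structure_fun (v : Kmod t a) : M := wf v.1.1 + vf v.1.2 + bf v.2.

Fact structure_linear : linear structure_fun.
Proof.
move=> c u v; have bfP : bf (c *: u.2 + v.2) = c *: bf u.2 + bf v.2.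
  rewrite /bf scaler_sumr -big_split; apply: eq_bigr => j _ /=.
  by rewrite /vf !linearP.
rewrite /structure_fun /= bfP /wf /vf !linearP /= !scalerDr.
rewrite [X in X + _]addrACA; exact: addrACA.
Qed.

(** M is the sum of W, e2 M and B, where B = sum_j beta_j e2 M and W is a complement of B in e1 M.
    The relations make the alpha_i kill B, and injectivity makes B the sum of t copies of e2 M. *)
Lemma beta_injective_iso : exists m n (a : 'I_s -> 'M[k]_(m, n)), isomorphic (Kmod t a) M.
Proof.
exists m, n, a; pose f : 'Hom(Kmod t a, M) := lfun_of structure_linear.
have fE v : f v = wf v.1.1 + vf v.1.2 + bf v.2 by apply: lfun_ofE.
have wf0 : wf 0 = 0 by apply: linear0.
have vf0 : vf 0 = 0 by apply: linear0.
have bf0 : bf 0 = 0 by rewrite /bf big1 // => j _; rewrite row0 vf0 lfun0.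
have vb p y : fdm_act M (Ast_path k p) (vf y) =
    oapp (fun r => fdm_act M (Ast_path k r) (vf y)) 0 (stcomp p (Triv vtx2)).
  by rewrite -{1}vfE act_pathM.
have wb p x : fdm_act M (Ast_path k p) (wf x) =
    oapp (fun r => fdm_act M (Ast_path k r) (wf x)) 0 (stcomp p (Triv vtx1)).
  by rewrite -{1}wfE act_pathM.
have hf : is_hom f.
  apply: Ast_homP => [w|i|j] v; rewrite !fE KmodE !lfunD [X in _ = _ + X]lfun_sum.
  - case: (ord2P w) => ->; rewrite /= ?wf0 ?vf0 ?bf0 ?addr0 ?add0r.
      rewrite wfE vb /= addr0; congr (_ + _); apply: eq_bigr => j _.
      by rewrite act_pathM.
    rewrite wb vfE /= add0r big1 ?addr0 // => j _; by rewrite act_pathM.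
  - rewrite /= wf0 bf0 addr0 add0r alpha_wf vb /= addr0 big1 ?addr0 // => j _.
    by rewrite act_pathM.
  - rewrite /= wf0 vf0 !add0r wb /= add0r [X in _ = _ + X]big1 => [|j' _]; last first.
      by rewrite act_pathM.
    rewrite addr0 /bf (bigD1 j) //= big1 ?addr0 => [|j' nj]; rewrite row_mul.
      rewrite (_ : row j _ = 1%:M) ?mul1mx //.
      by apply/matrixP => x y; rewrite !ord1 !mxE !eqxx.
    rewrite (_ : row j' _ = 0) ?mul0mx ?vf0 ?lfun0 //.
    by apply/matrixP => x y; rewrite !mxE (negPf nj).
exists f; split=> //.
  apply/eqP; rewrite -subv0; apply/subvP => v; rewrite memv_ker memv0 fE => /eqP v0.
  have Bp x : x \in V1 -> fdm_act M e2 x = 0 by move/V1P <-; rewrite act_pathM.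
  have y0 : vf v.1.2 = 0.
    have := congr1 (fdm_act M e2) v0; rewrite lfun0 !lfunD vfE.
    rewrite (Bp _ (subvP WV1 _ (wf_mem _))) (Bp _ (subvP BV1 _ (bfB _))).
    by rewrite add0r addr0.
  rewrite y0 addr0 in v0; have wB : wf v.1.1 \in B.
    by rewrite -(addrK (bf v.2) (wf _)) v0 sub0r memvN.
  have x0 : wf v.1.1 = 0 by apply/eqP; rewrite -memv0 -WB0 memv_cap wf_mem.
  rewrite x0 add0r in v0.
  have Z0 := inj (fun j => conj (memvf _) (vfE (row j v.2))) v0.
  apply/eqP/kspace_eq; rewrite /=.
  - by apply: (@vcomb_inj _ W); rewrite linear0.
  - by apply: (@vcomb_inj _ V2); rewrite linear0.
  - apply/row_matrixP => j; rewrite row0; apply: (@vcomb_inj _ V2).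
    by rewrite linear0; exact: Z0.
have V2f : (V2 <= limg f)%VS.
  apply/subvP => x /vcomb_coord <-; apply/memv_imgP.
  by exists ((0, \row_i coord (vbasis V2) i x, 0) : Kmod t a); rewrite ?memvf // fE
    wf0 bf0 add0r addr0.
have /is_submodP sf := submod_img hf (submod_full _).
apply/eqP; rewrite eqEsubv subvf; apply/subvP => x _.
rewrite -(act_path_one x) memvD //; last by apply: (subvP V2f); rewrite memv_img ?memvf.
have : fdm_act M e1 x \in V1 by rewrite memv_img ?memvf.
rewrite -WB => /memv_addP[w /vcomb_coord <- [b Bb ->]]; apply: memvD.
  apply/memv_imgP; exists ((\row_i coord (vbasis W) i w, 0, 0) : Kmod t a).
    exact: memvf.
  by rewrite fE vf0 bf0 !addr0.
apply: subvP Bb; apply/subv_sumP => j _; apply/subvP => _ /memv_imgP[y /(subvP V2f) yf ->].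
exact: sf.
Qed.

End BetaInjective.

(** e2 A is spanned by e2 and the alpha_i, and the beta_j and beta_j alpha_i are pairwise distinct
    basis paths. This is what puts A itself into F(Delta). *)
Lemma regular_beta_injective : beta_injective {:regular_fdmod A}.
Proof.
move=> y yP; rewrite (eq_bigr (fun j => be j * y j)) => [|j _]; last by rewrite act_regular.
have yE j : y j = y j (Triv vtx2) *: e2 + \sum_i y j (Alpha i) *: al i.
  have [_] := yP j; rewrite act_regular => ey; rewrite {1}(Ast_coord (y j)) sum_stpath.
  have z p : sttgt p = vtx1 -> y j p = 0 by move=> tp; rewrite -ey Ast_trivl tp mul0r.
  have S1 : \sum_i y j (Beta i) *: Ast_path k (Beta i) = 0 :> A.
    by apply: big1 => i _; rewrite z ?scale0r.
  have S2 : \sum_i \sum_i' y j (BetaAlpha i i') *: Ast_path k (BetaAlpha i i') = 0 :> A.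
    by apply: big1 => i _; apply: big1 => i' _; rewrite z ?scale0r.
  by rewrite S1 S2 !addr0 z // scale0r add0r.
have byE j : be j * y j = y j (Triv vtx2) *: be j +
    \sum_i y j (Alpha i) *: Ast_path k (BetaAlpha j i).
  rewrite {1}yE mulrDr -scalerAr Ast_pathM /=; congr (_ + _).
  by rewrite mulr_sumr; apply: eq_bigr => i _; rewrite -scalerAr Ast_pathM.
rewrite (eq_bigr _ (fun j _ => byE j)) big_split /= => sum0 j.
rewrite yE; have := congr1 (fun a : A => a (Beta j)) sum0.
rewrite ffunE sum_beta_coord sum_ffunE big1 => [|j' _]; last first.
  by rewrite sum_ffunE big1 // => i _; rewrite !ffunE [LHS]mulr0.
rewrite addr0 [RHS]ffunE => ->; rewrite scale0r add0r big1 // => i _.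
have := congr1 (fun a : A => a (BetaAlpha j i)) sum0.
rewrite ffunE sum_ffunE big1 ?add0r => [|j' _]; last by rewrite !ffunE [LHS]mulr0.
rewrite sum_ffunE (bigD1 j) //= [X in _ + X]big1 => [|j' nj].
  rewrite addr0 sum_ffunE (bigD1 i) //= big1 => [|i' ni]; rewrite !ffunE.
    by rewrite eqxx addr0 [_ *: _]mulr1 => ->; rewrite scale0r.
  by rewrite (_ : _ == _ = false) ?[LHS]mulr0 //; apply: contraNF ni => /eqP[->].
rewrite sum_ffunE big1 // => i' _; rewrite !ffunE (_ : _ == _ = false) ?[LHS]mulr0 //.
by apply: contraNF nj => /eqP[->].
Qed.

Lemma filtered_iso n (Delta : 'I_n -> fdmod A) M N :
  isomorphic M N -> filtered Delta M -> filtered Delta N.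
Proof.
move=> [f fi] [r [F [F0 Fr sF stepF]]]; have [hf /eqP kf imf] := fi.
have [g [/is_homP hg fK gK]] := is_iso_inv fi.
exists r, (fun i => (f @: F i)%VS); split=> [||i ir|i ir].
- by rewrite F0 limg0.
- by rewrite Fr.
- exact: submod_img hf (sF i ir).
have [FF [j [q [hq qF kq]]]] := stepF i ir; split; first exact: limgS.
exists j, (q \o g)%VF; split.
- by move=> a _ /memv_imgP[x Fx ->]; rewrite !comp_lfunE hg fK hq.
- rewrite limg_comp -qF; congr (_ @: _)%VS; apply/vspaceP => x.
  apply/memv_imgP/idP => [[_ /memv_imgP[y Fy ->] ->]|Fx]; first by rewrite fK.
  by exists (f x); rewrite ?memv_img ?fK.
- apply/vspaceP => x; rewrite memv_cap memv_ker comp_lfunE -kq.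
  apply/andP/memv_imgP => [[/memv_imgP[y Fy ->]]|[y]].
    by rewrite fK => qy; exists y; rewrite // memv_cap Fy memv_ker.
  by rewrite memv_cap memv_ker => /andP[Fy qy] ->; rewrite fK memv_img.
Qed.

Lemma standard_systemP Delta : standard_modules (Ast_e k s t) Delta -> standard_system Delta.
Proof.
move=> std; have [d1 d2] := (standard_delta1 std, standard_delta2 std).
split=> [i|i|i j|i j|].
- case: (ord2P i) => ->; [exact: delta1_indecomposable | exact: delta2_indecomposable].
- case: (ord2P i) => ->; [exact: delta1_End | exact: delta2_End].
- case: (ord2P i) => ->; case: (ord2P j) => -> //.
  by move/(delta21_Hom d1 d2).
- case: (ord2P i) => ->; case: (ord2P j) => -> //.
  + by move/(delta1_Ext d1).
  + by move/(delta2_Ext d2).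
  + by move/(delta2_Ext d2).
have [m [n [a iso]]] := beta_injective_iso regular_beta_injective.
exact: filtered_iso iso (Kmod_filtered d1 d2 a).
Qed.

Lemma filtered_Kmod Delta M : standard_modules (Ast_e k s t) Delta -> filtered Delta M ->
  exists m n (a : 'I_s -> 'M[k]_(m, n)), isomorphic (Kmod t a) M.
Proof.
move=> std filt; apply: beta_injective_iso.
exact: filtered_beta_injective (standard_delta1 std) (standard_delta2 std) _ filt.
Qed.

End Structure.

(** * The exact Borel subalgebra *)

Section OneDimensionalSimples.
Variables (k : fieldType) (C : falgType k) (s t : nat).
Variables (e : 'I_2 -> C) (a : 'I_s -> C) (b : 'I_t -> C).
Hypothesis rel : st_relations e a b.
Hypothesis gen : forall P : C -> Prop, P 0 ->
  (forall c x y, P x -> P y -> P (c *: x + y)) ->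
  (forall v, P (e v)) -> (forall i, P (a i)) -> (forall j, P (b j)) ->
  (forall x y, P x -> P y -> P (x * y)) -> forall x, P x.
Variables (L : 'I_2 -> fdmod C) (d : forall v, L v).
Hypotheses (d0 : forall v, d v != 0) (dP : forall v x, exists c : k, x = c *: d v).
Hypotheses (ed : forall v w, fdm_act (L v) (e w) (d v) = (v == w)%:R *: d v).
Hypotheses (ad : forall v i, fdm_act (L v) (a i) (d v) = 0).
Hypotheses (bd : forall v j, fdm_act (L v) (b j) (d v) = 0).

Lemma one_dim_simple v : simple_mod (L v).
Proof.
split=> [f0|U _]; first by case/eqP: (d0 v); apply/eqP; rewrite -memv0 -f0 memvf.
case: (eqVneq U 0%VS) => [->|]; [by left | rewrite -vpick0 => nu; right].
apply/eqP; rewrite eqEsubv subvf; apply/subvP => x _; have [c ->] := dP x.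
have [c' uE] := dP (vpick U); have c0 : c' != 0.
  by apply: contraNneq nu => c0; rewrite uE c0 scale0r.
by rewrite -[d v]scale1r -(mulVf c0) -scalerA -uE !memvZ // memv_pick.
Qed.

Lemma simple_iso_of_vector (S : fdmod C) v (x : S) : simple_mod S -> x != 0 ->
  fdm_act S (e v) x = x -> (forall i, fdm_act S (a i) x = 0) ->
  (forall j, fdm_act S (b j) x = 0) -> isomorphic S (L v).
Proof.
move=> [_ simS] x0 ex ax bx; have [_ ee _ _ _] := rel.
have [phi phi1] := dual_vector (d0 v).
have lin : linear (fun z => phi z *: x).
  by move=> c z w; rewrite linearP scalerDl scalerA.
pose f : 'Hom(L v, S) := lfun_of lin.
have fE c : f (c *: d v) = c *: x by rewrite lfun_ofE linearZ_LR /= phi1 mulr1.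
have hf : is_hom f.
  apply/is_homP; apply: gen => [|c y z Py Pz|w|i|j|y z Py Pz] u.
  - by rewrite !act0 lfun0.
  - by rewrite !actD !actZ lfunD lfunZ Py Pz.
  - have exw : fdm_act S (e w) x = (v == w)%:R *: x.
      rewrite -{1}ex -fdm_actM ee eq_sym; case: eqP => [<-|_].
        by rewrite ex scale1r.
      by rewrite act0 scale0r.
    by have [c ->] := dP u; rewrite [fdm_act (L v) _ _]lfunZ ed scalerA !fE lfunZ exw scalerA.
  - have [c ->] := dP u; by rewrite lfunZ ad scaler0 lfun0 fE lfunZ ax scaler0.
  - have [c ->] := dP u; by rewrite lfunZ bd scaler0 lfun0 fE lfunZ bx scaler0.
  - by rewrite !fdm_actM Py Pz.
apply: isomorphic_sym; exists f; split=> //.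
  apply/eqP; rewrite -subv0; apply/subvP => u; rewrite memv_ker memv0.
  have [c ->] := dP u; rewrite fE scaler_eq0 (negPf x0) orbF => /eqP->.
  by rewrite scale0r.
case: (simS _ (submod_img hf (submod_full _))) => // f0.
case/eqP: x0; apply/eqP; rewrite -memv0 -f0 -[x]scale1r -fE.
by rewrite memv_img ?memvf.
Qed.

(** A simple module contains a vector spanning a one-dimensional submodule: if y = e2 y is nonzero,
    either some b_j y, which all arrows kill because a b = b b = 0, or y itself; if e2 acts as zero,
    any nonzero vector. *)
Lemma one_dim_complete_simples : complete_simples L.
Proof.
have [e1 ee ea eb ab] := rel.
split=> [|i j [f [/is_homP hf /eqP kf _]]|S simS]; first exact: one_dim_simple.
  apply/eqP; move/lker0P: kf => injf; apply: contraR (d0 i) => ij; apply/eqP/injf.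
  have {1}-> : d i = fdm_act (L i) (e i) (d i) by rewrite ed eqxx scale1r.
  rewrite hf lfun0; have [c ->] := dP (f (d i)).
  by rewrite lfunZ ed eq_sym (negPf ij) scale0r scaler0.
have ez v w : v != w -> e v * e w = 0 by rewrite ee => /negPf->.
case: (classic (exists2 y : S, y != 0 & fdm_act S (e vtx2) y = y)) => [[y y0 ey]|ney].
  have ay i (z : S) : fdm_act S (e vtx2) z = z -> fdm_act S (a i) z = 0.
    by move=> <-; rewrite -(ea i).2 -fdm_actM -mulrA ez // mulr0 act0.
  case: (classic (exists j, fdm_act S (b j) y <> 0)) => [[j /eqP bj]|nb].
    exists vtx1; apply: (simple_iso_of_vector simS bj) => [|i|j'].
    - by rewrite -fdm_actM (eb j).1.
    - by rewrite -fdm_actM ab act0.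
    - by rewrite -(eb j).1 -(eb j').2 -fdm_actM mulrA -[_ * e vtx2 * _]mulrA ez //
        mulr0 mul0r act0.
  exists vtx2; apply: (simple_iso_of_vector simS y0 ey) => [i|j]; first exact: ay.
  by apply: NNPP => bj; apply: nb; exists j.
have e20 (y : S) : fdm_act S (e vtx2) y = 0.
  apply: NNPP => /eqP ey; apply: ney; exists (fdm_act S (e vtx2) y) => //.
  by rewrite -fdm_actM ee.
have [x x0] : exists x : S, x != 0.
  by exists (vpick fullv); rewrite vpick0; apply/eqP; case: simS.
exists vtx1; apply: (simple_iso_of_vector simS x0) => [|i|j].
- by rewrite -{2}[x]fdm_act1 -e1 actD e20 addr0.
- by rewrite -(ea i).1 fdm_actM e20.
- by rewrite -(eb j).2 fdm_actM e20 lfun0.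
Qed.

End OneDimensionalSimples.

Section Restriction.
Variables (k : fieldType) (A : falgType k) (B : {aspace A}).
Hypothesis B1 : 1 \in B.

Lemma vsval1 : vsval (1 : subvs_of B) = 1.
Proof. by apply/eqP; rewrite /= algid_eq1. Qed.

Variable M : fdmod A.

Definition restrict_op (b : subvs_of B) : 'End(M) := fdm_act M (vsval b).

Fact restrict_op_linear : linear restrict_op.
Proof. by move=> c x y; rewrite /restrict_op -linearP. Qed.

HB.instance Definition _ := GRing.isSemilinear.Build k (subvs_of B) 'End(M) _
  restrict_op (GRing.semilinear_linear restrict_op_linear).

Fact restrict_act1 v : restrict_op 1 v = v.
Proof. by rewrite /restrict_op vsval1 fdm_act1. Qed.

Fact restrict_actM x y v : restrict_op (x * y) v = restrict_op x (restrict_op y v).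
Proof. exact: fdm_actM. Qed.

Definition restrict_fdmod : fdmod (subvs_of B) :=
  @FdMod k (subvs_of B) M (restrict_op : {linear subvs_of B -> 'End(M)})
    restrict_act1 restrict_actM.

End Restriction.

Section Borel.
Variables (k : fieldType) (s t : nat).
Local Notation A := (Ast k s t).
Local Notation path := (stpath s t).
Local Notation pa p := (Ast_path k p : A).
Local Notation e1 := (Ast_path k (Triv vtx1) : A).
Local Notation e2 := (Ast_path k (Triv vtx2) : A).

Definition in_borel (p : path) := if p is (Triv _ | Alpha _) then true else false.

Lemma Ast_borel_path p : in_borel p -> pa p \in Ast_borel k s t.
Proof.
case: p => [v|i|//|//] _; apply: memv_span; rewrite !inE.
  by case: (ord2P v) => ->; rewrite eqxx ?orbT.
by apply/or3P/Or33/mapP; exists i; rewrite ?mem_enum.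
Qed.

Lemma Ast_borelP (x : A) : reflect (forall p, ~~ in_borel p -> x p = 0) (x \in Ast_borel k s t).
Proof.
apply: (iffP idP) => [xU p np|xp]; last first.
  rewrite (Ast_coord x); apply: memv_suml => p _.
  case: (boolP (in_borel p)) => [bp|/xp->]; last by rewrite scale0r mem0v.
  by rewrite memvZ // Ast_borel_path.
have lin : linear (fun x : A => x p : k^o) by move=> c y z; rewrite !ffunE.
suff: (Ast_borel k s t <= lker (lfun_of lin))%VS.
  by move/subvP/(_ _ xU); rewrite memv_ker lfun_ofE => /eqP.
have g0 q : in_borel q -> pa q \in lker (lfun_of lin).
  move=> bq; rewrite memv_ker lfun_ofE ffunE (_ : p == q = false) //.
  by apply: contraNF np => /eqP->.
apply/span_subvP => y; rewrite !inE => /or3P[/eqP->|/eqP->|/mapP[i _ ->]];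
  exact: g0.
Qed.

Lemma Ast_borel1 : 1 \in Ast_borel k s t.
Proof.
rewrite [1](_ : _ = \sum_v pa (Triv v)) // memv_suml // => v _.
exact: Ast_borel_path.
Qed.

Fact Ast_borel_aspace : is_aspace (Ast_borel k s t).
Proof.
rewrite /is_aspace has_algid1 ?Ast_borel1 //=; apply/prodvP => x y xU yU.
rewrite [x * y]/(Ast_mul x y) memv_suml // => p _; rewrite memv_suml // => q _.
case: (boolP (in_borel p)) => [bp|/(Ast_borelP _ xU)->]; last by rewrite mul0r scale0r mem0v.
case: (boolP (in_borel q)) => [bq|/(Ast_borelP _ yU)->]; last by rewrite mulr0 scale0r mem0v.
apply: memvZ; case: p q bp bq => [v|i|//|//] [w|i'|//|//] _ _ /=;
  try case: ifP => _; rewrite ?mem0v //; exact: Ast_borel_path.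
Qed.

Definition borel : {aspace A} := ASpace Ast_borel_aspace.
Local Notation B := (subvs_of borel).
Local Notation pr x := (vsproj borel x : B).

Lemma prK (x : A) : x \in Ast_borel k s t -> vsval (pr x) = x.
Proof. exact: (@vsprojK _ _ borel). Qed.

Lemma pr_path p : in_borel p -> vsval (pr (pa p)) = pa p.
Proof. by move=> bp; rewrite prK // Ast_borel_path. Qed.

Lemma borel_relations : st_relations (fun v => pr (pa (Triv v)))
  (fun i => pr (pa (Alpha i))) (fun j : 'I_0 => 0).
Proof.
have [r1 r2 r3 _ _] := Ast_relations k s t.
split=> [|v w|i|[//]|i [//]].
- apply: val_inj; rewrite /= !pr_path //; apply: etrans r1 _.
  exact: esym (vsval1 (B := borel) Ast_borel1).
- by apply: val_inj; rewrite /= !pr_path //; case: eqP (r2 v w) => [->|_] ->;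
    rewrite ?pr_path ?linear0.
- by split; apply: val_inj; rewrite /= !pr_path //; [exact: (r3 i).1 | exact: (r3 i).2].
Qed.

Lemma borel_gen (P : B -> Prop) : P 0 ->
  (forall c x y, P x -> P y -> P (c *: x + y)) ->
  (forall v, P (pr (pa (Triv v)))) -> (forall i, P (pr (pa (Alpha i)))) ->
  forall x, P x.
Proof.
move=> P0 PZ Pv Pa x; rewrite -[x]vsvalK (Ast_coord (vsval x)) linear_sum.
elim/big_rec: _ => // p y _ Py; rewrite linearZ /=.
case: (boolP (in_borel p)) => [|np]; first by case: p => [v|i|//|//] _; apply: PZ.
by have := Ast_borelP _ (subvsP x) p np => ->; rewrite scale0r add0r.
Qed.

Definition borel_simple v : fdmod B := restrict_fdmod (B := borel) Ast_borel1 (Ast_simple k s t v).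

Lemma borel_simpleE v (b : B) (x : k^o) :
  fdm_act (borel_simple v) b x = vsval b (Triv v) * x.
Proof. exact: Ast_simpleE. Qed.

Lemma borel_complete_simples : complete_simples borel_simple.
Proof.
have one_span v (x : borel_simple v) : exists c : k, x = c *: (1 : k^o).
  by exists x; rewrite [RHS]mulr1.
apply: (@one_dim_complete_simples _ _ _ _ _ _ _ borel_relations _
  borel_simple (fun v => (1 : k^o))) => //.
- by move=> P P0 PZ Pv Pa _ _; apply: borel_gen.
- by move=> v; apply: oner_neq0.
- move=> v w; rewrite borel_simpleE pr_path // ffunE.
  by congr (_%:R * _).
- by move=> v i; rewrite borel_simpleE pr_path // ffunE mul0r.
- by move=> v [].
Qed.

Lemma Ast_complete_simples : complete_simples (Ast_simple k s t).
Proof.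
have one_span v (x : Ast_simple k s t v) : exists c : k, x = c *: (1 : k^o).
  by exists x; rewrite [RHS]mulr1.
apply: (@one_dim_complete_simples _ _ _ _ _ _ _ (Ast_relations k s t) _
  (Ast_simple k s t) (fun v => (1 : k^o))) => //.
- exact: Ast_ind.
- by move=> v; apply: oner_neq0.
- by move=> v w; rewrite Ast_simpleE ffunE.
- by move=> v i; rewrite Ast_simpleE ffunE mul0r.
- by move=> v i; rewrite Ast_simpleE ffunE mul0r.
Qed.

(** Only the extensions of L(2) by L(1) have to be split: each alpha_i kills a lift x = e2 x of the
    generator, so x spans a copy of L(2). *)
Lemma borel_directed : directed borel_simple.
Proof.
move=> i j; case: (ord2P i) => ->; case: (ord2P j) => -> //.
case=> E [f [p [[_ /is_homP hp _ _ imp] []]]].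
have /memv_imgP[x0 _ px0] : (1 : k^o) \in limg p by rewrite imp memvf.
have [_ ee ea _ _] := borel_relations.
pose x := fdm_act E (pr e2) x0.
have px : p x = (1 : k^o).
  by rewrite hp -px0 borel_simpleE pr_path // ffunE eqxx mulr1.
have lin : linear (fun z : k^o => z *: x) by move=> c z w; rewrite scalerDl scalerA.
exists (lfun_of lin : 'Hom(borel_simple vtx2, E)); last first.
  apply/lfunP => z; rewrite comp_lfunE lfun_ofE lfunE lfunZ px.
  by rewrite [LHS]mulr1.
apply/is_homP; apply: borel_gen => [|c y z Py Pz|v|l] u.
- by rewrite !act0 lfun0.
- by rewrite !actD !actZ lfunD lfunZ Py Pz.
- rewrite borel_simpleE pr_path // !lfun_ofE ffunE lfunZ -fdm_actM ee.
  case: (ord2P v) => -> /=; first by rewrite mul0r scale0r act0 scaler0.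
  by rewrite mul1r.
- rewrite borel_simpleE pr_path // !lfun_ofE ffunE /= mul0r scale0r lfunZ.
  by rewrite -(ea l).2 -fdm_actM -mulrA ee /= mulr0 act0 scaler0.
Qed.

(* As a right B-module, A is the direct sum of B and of t copies of e_2 B, the
   j-th one being beta_j B; proj0 and projb j are the coordinates. *)
Definition path_ext (h : path -> option path) (a : A) : A :=
  \sum_p a p *: Ast_opath k (h p).

Definition proj0_path (p : path) := if in_borel p then Some p else None.

Definition projb_path (j : 'I_t) (p : path) : option path :=
  match p with
  | Beta j' => if j' == j then Some (Triv vtx2) else None
  | BetaAlpha j' i => if j' == j then Some (Alpha i) else None
  | _ => None
  end.

Fact path_ext_linear h : linear (path_ext h).
Proof.
move=> c x y; rewrite /path_ext scaler_sumr -big_split; apply: eq_bigr => p _ /=.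
by rewrite !ffunE scalerDl scalerA.
Qed.

HB.instance Definition _ h := GRing.isSemilinear.Build k A A _ (path_ext h)
  (GRing.semilinear_linear (path_ext_linear h)).

Lemma path_ext_path h p : path_ext h (pa p) = Ast_opath k (h p).
Proof.
rewrite /path_ext (bigD1 p) //= ffunE eqxx scale1r big1 ?addr0 // => q nq.
by rewrite ffunE (negPf nq) scale0r.
Qed.

Lemma path_ext_mul h (a x : A) : x \in Ast_borel k s t ->
  (forall p q, in_borel q ->
    obind h (stcomp p q) = obind (fun r => stcomp r q) (h p)) ->
  path_ext h (a * x) = path_ext h a * x.
Proof.
move=> xB hP; rewrite (Ast_coord a) mulr_suml !linear_sum mulr_suml.
apply: eq_bigr => p _; rewrite -scalerAl !linearZ -scalerAl; congr (_ *: _).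
rewrite (Ast_coord x) !mulr_sumr linear_sum; apply: eq_bigr => q _.
rewrite -!scalerAr linearZ /=.
case: (boolP (in_borel q)) => [bq|/(Ast_borelP _ xB)->]; last by rewrite !scale0r.
congr (_ *: _); rewrite Ast_pathM path_ext_path.
have -> : path_ext h (Ast_opath k (stcomp p q)) = Ast_opath k (obind h (stcomp p q)).
  by case: (stcomp p q) => [r|]; rewrite /= ?path_ext_path ?linear0.
rewrite hP //; case: (h p) => [r|] /=; last by rewrite mul0r.
by rewrite Ast_pathM.
Qed.

Lemma path_ext_mem h a : (forall p q, h p = Some q -> in_borel q) ->
  path_ext h a \in Ast_borel k s t.
Proof.
move=> hB; apply: memv_suml => p _; apply: memvZ.
by case E: (h p) => [q|]; rewrite ?mem0v //= Ast_borel_path // (hB p).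
Qed.

Definition proj0 (a : A) : B := pr (path_ext proj0_path a).
Definition projb j (a : A) : B := pr (path_ext (projb_path j) a).

Lemma proj0_mem a : path_ext proj0_path a \in Ast_borel k s t.
Proof. by apply: path_ext_mem => p q; rewrite /proj0_path; case: ifP => // bp [<-]. Qed.

Lemma projb_mem j a : path_ext (projb_path j) a \in Ast_borel k s t.
Proof.
by apply: path_ext_mem => -[v|i|j'|j' i] q //=; case: ifP => // _ [<-].
Qed.

Lemma proj0M a (b : B) : proj0 (a * vsval b) = proj0 a * b.
Proof.
apply: val_inj; rewrite /= !prK ?proj0_mem // path_ext_mul ?subvsP //.
by move=> [v|i|j|j i] [w|i'|//|//] _ /=; try case: ifP => _; rewrite //= ?eqxx.
Qed.

Lemma projbM j a (b : B) : projb j (a * vsval b) = projb j a * b.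
Proof.
apply: val_inj; rewrite /= !prK ?projb_mem // path_ext_mul ?subvsP //.
by move=> [v|i|j'|j' i] [w|i'|//|//] _ /=; try case: (ord2P v) => ->;
  try case: (ord2P w) => ->; rewrite /=; try case: ifP.
Qed.

Lemma proj_sum a :
  a = vsval (proj0 a) + \sum_j pa (Beta j) * vsval (projb j a).
Proof.
rewrite prK ?proj0_mem //; under eq_bigr do rewrite prK ?projb_mem //.
transitivity (\sum_p a p *: (Ast_opath k (proj0_path p) +
    \sum_j pa (Beta j) * Ast_opath k (projb_path j p))).
  rewrite {1}(Ast_coord a); apply: eq_bigr => p _; congr (_ *: _).
  (* An option treats the paths beta_j ([None]) and beta_j alpha_i ([Some i]) together. *)
  have beE j j' p' : projb_path j' (if p' is Some i then BetaAlpha j i else Beta j) =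
      if j == j' then Some (if p' is Some i then Alpha i else Triv vtx2) else None.
    by case: p'.
  have sumE (j : 'I_t) p' : \sum_j' pa (Beta j') * Ast_opath k
      (projb_path j' (if p' is Some i then BetaAlpha j i else Beta j)) =
      pa (if p' is Some i then BetaAlpha j i else Beta j).
    rewrite (bigD1 j) //= big1 => [|j' nj]; rewrite beE.
      by rewrite eqxx addr0 Ast_pathM; case: p'.
    by rewrite eq_sym (negPf nj) mulr0.
  case: p => [v|i|j|j i] /=.
  - by rewrite big1 ?addr0 // => j _; rewrite mulr0.
  - by rewrite big1 ?addr0 // => j _; rewrite mulr0.
  - by rewrite add0r (sumE j None).
  - by rewrite add0r (sumE j (Some i)).
rewrite (eq_bigr (fun p => a p *: Ast_opath k (proj0_path p) + \sum_j a p *: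
  (pa (Beta j) * Ast_opath k (projb_path j p)))); last first.
  by move=> p _; rewrite scalerDr scaler_sumr.
rewrite big_split exchange_big /=; congr (_ + _); apply: eq_bigr => j _.
by rewrite [RHS]mulr_sumr; apply: eq_bigr => p _; exact: scalerAr.
Qed.

Lemma proj0_linear : linear proj0.
Proof. by move=> c x y; rewrite /proj0 !linearP. Qed.

Lemma projb_linear j : linear (projb j).
Proof. by move=> c x y; rewrite /projb !linearP. Qed.

Lemma proj0_1 : proj0 1 = 1.
Proof.
apply: val_inj; rewrite /= prK ?proj0_mem //.
rewrite [1](_ : _ = \sum_v pa (Triv v)) // linear_sum.
transitivity (1 : A); last exact: esym (vsval1 (B := borel) Ast_borel1).
by rewrite [RHS](_ : _ = \sum_v pa (Triv v)) //; apply: eq_bigr => v _; exact: path_ext_path.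
Qed.

Lemma projb_1 j : projb j 1 = 0.
Proof.
apply: val_inj; rewrite /= prK ?projb_mem //.
rewrite [1](_ : _ = \sum_v pa (Triv v)) // linear_sum big1 // => v _.
exact: path_ext_path.
Qed.

Lemma proj0_beta j : proj0 (pa (Beta j)) = 0.
Proof. by apply: val_inj; rewrite /= prK ?proj0_mem // path_ext_path. Qed.

Lemma projb_beta j j' : projb j' (pa (Beta j)) = if j == j' then pr e2 else 0.
Proof.
apply: val_inj; rewrite /= prK ?projb_mem // path_ext_path /=.
by case: eqP => _; rewrite ?linear0 // pr_path.
Qed.

Section Tensor.
Variable X : fdmod B.
Local Notation model := (X * {ffun 'I_t -> X})%type.

(** The decomposition of A as a right B-module gives A (x)_B X = X + (e_2 X)^t; this is the element
    a (x) x in it, with (e_2 X)^t embedded in X^t. *)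
Definition tensor_model (a : A) (x : X) : model :=
  (fdm_act X (proj0 a) x, [ffun j => fdm_act X (projb j a) x]).

Lemma tensor_model_balanced : balanced (@sub_ract k A borel) (@sub_lact k A borel X) tensor_model.
Proof.
split=> [a b x|a x y|a b x].
- congr (_, _); first by rewrite -actD -[proj0 a]scale1r -proj0_linear scale1r.
  by apply/ffunP => j; rewrite !ffunE -actD -[projb j a]scale1r -projb_linear scale1r.
- by congr (_, _); [rewrite lfunD | apply/ffunP => j; rewrite !ffunE lfunD].
- congr (_, _); first by rewrite /sub_ract proj0M fdm_actM.
  by apply/ffunP => j; rewrite !ffunE /sub_ract projbM fdm_actM.
Qed.

Variables (T : zmodType) (t0 : A -> X -> T).
Hypothesis ind : is_induced t0.

Lemma induced_B (x : X) (a : A) (b : B) : t0 (a * vsval b) x = t0 a (fdm_act X b x).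
Proof. by have [[_ _ tB] _] := ind; apply: tB. Qed.

Lemma induced0l x : t0 0 x = 0.
Proof.
by have [[tD _ _] _] := ind; apply: (addIr (t0 0 x)); rewrite -tD !add0r.
Qed.

Lemma induced0r a : t0 a 0 = 0.
Proof.
by have [[_ tD _] _] := ind; apply: (addIr (t0 a 0)); rewrite -tD !add0r.
Qed.

Lemma induced_suml I (r : seq I) (F : I -> A) x :
  t0 (\sum_(i <- r) F i) x = \sum_(i <- r) t0 (F i) x.
Proof.
have [[tD _ _] _] := ind.
exact: (big_morph (fun a => t0 a x) (fun a b => tD a b x) (induced0l x)).
Qed.

Lemma induced_beta j x : t0 (pa (Beta j)) x = t0 (pa (Beta j)) (fdm_act X (pr e2) x).
Proof. by rewrite -induced_B pr_path // Ast_pathM. Qed.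

(** Both sides of the normal form are additive in z and agree on the elements [t0 a x], so
    uniqueness in the universal property identifies them. *)
Lemma induced_normal : exists g : {additive T -> model},
  (forall a x, g (t0 a x) = tensor_model a x) /\
  forall z, z = t0 1 (g z).1 + \sum_j t0 (pa (Beta j)) ((g z).2 j).
Proof.
have [[tDl tDr _] uni] := ind.
have [g gE _] := uni _ _ tensor_model_balanced; exists g; split=> // z.
pose G z := t0 1 (g z).1 + \sum_j t0 (pa (Beta j)) ((g z).2 j).
have GD : {morph G : x y / x + y}.
  move=> x y; rewrite /G raddfD /= tDr addrACA -big_split; congr (_ + _).
  by apply: eq_bigr => j _; rewrite ffunE tDr.
have GB : zmod_morphism G.
  by move=> x y; apply: (addIr (G y)); rewrite -GD !subrK.
pose Ga : {additive T -> T} := HB.pack G (GRing.isZmodMorphism.Build T T G GB).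
have [g0 _ g0u] := uni _ _ (proj1 ind).
have idE : (idfun : {additive T -> T}) =1 g0 by apply: g0u.
rewrite -[LHS]/(idfun z) idE -[RHS]/(Ga z); apply/esym/g0u => a x.
rewrite /= /G gE /tensor_model /=; rewrite [in RHS](proj_sum a) tDl.
rewrite -[vsval (proj0 a)]mul1r induced_B; congr (_ + _).
by rewrite [RHS]induced_suml; apply: eq_bigr => j _; rewrite ffunE induced_B.
Qed.

End Tensor.

(** On normal forms the induced maps act coordinatewise by [f] and [g], so exactness reduces to that
    of the sequences of the spaces X and e_2 X. *)
Lemma borel_induction_exact : induction_exact borel.
Proof.
move=> X Y Z f g [/is_homP hf /is_homP hg kf imf img] TX TY TZ tX tY tZ iX iY iZ F G FE GE.
have [nX [nXE nXz]] := induced_normal iX.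
have [nY [nYE nYz]] := induced_normal iY.
have [nZ [nZE nZz]] := induced_normal iZ.
have inj_f : injective f by apply/lker0P/eqP.
have gf x : g (f x) = 0.
  by apply/eqP; rewrite -memv_ker -imf memv_img ?memvf.
(* The coordinates of a normal form are recovered only after applying e2 to the y_j, because beta_j
   (x) y = beta_j (x) e2 y. *)
have nform (W : fdmod B) (TW : zmodType) (tW : A -> W -> TW)
    (nW : {additive TW -> W * {ffun 'I_t -> W}})
    (nWE : forall a x, nW (tW a x) = tensor_model a x) x (y : 'I_t -> W) :
    nW (tW 1 x + \sum_j tW (pa (Beta j)) (y j)) = (x, [ffun j => fdm_act W (pr e2) (y j)]).
  rewrite raddfD raddf_sum /= nWE; under eq_bigr do rewrite nWE.
  rewrite /tensor_model; apply/eqP; rewrite xpair_eqE; apply/andP; split; apply/eqP.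
    rewrite /= proj0_1 fdm_act1 (raddf_sum fst) /= big1 ?addr0 // => j _.
    by rewrite proj0_beta act0.
  apply/ffunP => j; rewrite !ffunE projb_1 act0 add0r (raddf_sum snd) sum_ffunE /=.
  rewrite (bigD1 j) //= big1 => [|j' nj]; rewrite ffunE projb_beta.
    by rewrite eqxx addr0.
  by rewrite (negPf nj) act0.
have FN x (y : 'I_t -> X) : F (tX 1 x + \sum_j tX (pa (Beta j)) (y j)) =
    tY 1 (f x) + \sum_j tY (pa (Beta j)) (f (y j)).
  by rewrite raddfD raddf_sum FE; congr (_ + _); apply: eq_bigr => j _; rewrite FE.
have GN x (y : 'I_t -> Y) : G (tY 1 x + \sum_j tY (pa (Beta j)) (y j)) =
    tZ 1 (g x) + \sum_j tZ (pa (Beta j)) (g (y j)).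
  by rewrite raddfD raddf_sum GE; congr (_ + _); apply: eq_bigr => j _; rewrite GE.
split.
- suff F0 z : F z = 0 -> z = 0.
    by move=> x y Fxy; apply/eqP; rewrite -subr_eq0; apply/eqP/F0; rewrite raddfB /= Fxy subrr.
  rewrite [z]nXz FN => /(congr1 nY); rewrite nform // raddf0 => -[/eqP fx /ffunP fy].
  have -> : (nX z).1 = 0 by apply: inj_f; rewrite lfun0; apply/eqP.
  rewrite (induced0r iX) add0r big1 // => j _; rewrite (induced_beta iX).
  suff -> : fdm_act X (pr e2) ((nX z).2 j) = 0 by rewrite (induced0r iX).
  by apply: inj_f; rewrite hf lfun0; have := fy j; rewrite !ffunE.
- move=> y; split=> [|[x <-]]; last first.
    rewrite [x]nXz FN GN gf (induced0r iZ) add0r big1 // => j _.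
    by rewrite gf (induced0r iZ).
  rewrite [y]nYz GN => /(congr1 nZ); rewrite nform // raddf0 => -[gu /ffunP gv].
  have lift w : g w = 0 -> exists x, f x = w.
    move/eqP; rewrite -memv_ker -imf => /memv_imgP[x _ ->]; by exists x.
  have [u fu] := lift _ gu.
  have /fin_all_exists[v fv] j : exists x, f x = fdm_act Y (pr e2) ((nY y).2 j).
    by apply: lift; rewrite hg; have := gv j; rewrite !ffunE.
  exists (tX 1 u + \sum_j tX (pa (Beta j)) (v j)).
  rewrite FN fu; congr (_ + _); apply: eq_bigr => j _.
  by rewrite fv -(induced_beta iY).
- move=> z.
  have lift w : exists x, g x = w.
    have : w \in limg g by rewrite img memvf.
    by case/memv_imgP=> x _ ->; exists x.
  have [u gu] := lift (nZ z).1.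
  have /fin_all_exists[v gv] j := lift ((nZ z).2 j).
  exists (tY 1 u + \sum_j tY (pa (Beta j)) (v j)).
  by rewrite GN gu [RHS]nZz; congr (_ + _); apply: eq_bigr => j _; rewrite gv.
Qed.

(** A balanced map h is determined by the values h(a, 1), and [D] represents such maps through a |->
    a g as soon as h(a, 1) depends on a g only. *)
Lemma induced_of_generator v (D : fdmod A) (g : D) :
  (forall z, exists a, z = fdm_act D a g) ->
  (forall b : B, fdm_act D (vsval b) g = vsval b (Triv v) *: g) ->
  (forall (V : zmodType) (h : A -> borel_simple v -> V),
    balanced (@sub_ract k A borel) (@sub_lact k A borel (borel_simple v)) h ->
    forall x, fdm_act D x g = 0 -> h x (1 : k^o) = 0) ->
  induced_iso (borel_simple v) D.
Proof.
move=> gP gB hker; pose t0 (a : A) (c : borel_simple v) : D := (c : k) *: fdm_act D a g.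
exists t0; split; last by move=> a a' x; rewrite /t0 fdm_actM lfunZ.
have lin : linear (fun a => fdm_act D a g) by move=> c a b; rewrite actD actZ.
have [rho rhoP] : exists rho : 'Hom(D, A), forall z, fdm_act D (rho z) g = z.
  have [|rho rP] := @lfun_section _ A D fullv (lfun_of lin).
    apply/eqP; rewrite eqEsubv subvf; apply/subvP => z _; apply/memv_imgP.
    by have [a zE] := gP z; exists a; rewrite ?memvf // lfun_ofE.
  by exists rho => z; rewrite -{2}(rP z).2 lfun_ofE.
split=> [|V h hb].
  split=> [a b c|a c d|a b c]; rewrite /t0; first by rewrite actD scalerDr.
    by rewrite scalerDl.
  by rewrite /sub_ract /sub_lact fdm_actM gB lfunZ scalerA borel_simpleE mulrC.
have [hDl hDr hB] := hb.
have h0 c : h 0 c = 0 by apply: (addIr (h 0 c)); rewrite -hDl !add0r.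
pose G z := h (rho z) (1 : k^o).
have GD : {morph G : x y / x + y} by move=> x y; rewrite /G lfunD hDl.
have GB : zmod_morphism G.
  by move=> x y; apply: (addIr (G y)); rewrite -GD !subrK.
have hker' x y : fdm_act D x g = fdm_act D y g -> h x (1 : k^o) = h y (1 : k^o).
  move=> xy; have := hker V h hb (x - y); rewrite actB xy subrr => /(_ erefl) hxy.
  by rewrite -[x](subrK y) hDl hxy add0r.
exists (HB.pack G (GRing.isZmodMorphism.Build D V G GB) : {additive D -> V}) => [a c|G' G'E z].
  rewrite /= /G (hker' _ ((c : k) *: a)); last by rewrite rhoP actZ.
  have -> : (c : k) *: a = a * vsval ((c : k) *: 1 : B).
    by rewrite vsvalZ (vsval1 (B := borel) Ast_borel1) -scalerAr mulr1.
  rewrite -[_ * _]/(sub_ract a ((c : k) *: 1)) hB; congr (h a _).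
  by rewrite /sub_lact actZ fdm_act1 [LHS]mulr1.
by rewrite /= /G -G'E /t0 rhoP scale1r.
Qed.

(** For v = 1, the annihilator of the generator consists of the x with x e1 = sum_i y_i alpha_i, and
    each alpha_i passes through h to act as zero on L(1). For v = 2 it consists of the x with x e2 =
    0, and h(x, 1) = h(x e2, 1). *)
Lemma borel_induced Delta v : standard_modules (Ast_e k s t) Delta ->
  induced_iso (borel_simple v) (Delta v).
Proof.
move=> std; case: (ord2P v) => ->.
  have [d [d0 dP aE]] := standard_delta1 std.
  apply: (@induced_of_generator _ _ d) => [z|b|V h hb x].
  - have [c ->] := dP z; exists (c *: 1); by rewrite actZ fdm_act1.
  - exact: aE.
  rewrite aE => /eqP; rewrite scaler_eq0 (negPf d0) orbF => /eqP x0.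
  have [hDl hDr hB] := hb.
  have h0l c : h 0 c = 0 by apply: (addIr (h 0 c)); rewrite -hDl !add0r.
  have h0r a : h a 0 = 0 by apply: (addIr (h a 0)); rewrite -hDr !add0r.
  have h1 : h x (1 : k^o) = h (x * e1) (1 : k^o).
    have := hB x (pr e1) (1 : k^o); rewrite /sub_ract pr_path // => ->; congr (h x _).
    by rewrite /sub_lact borel_simpleE pr_path // ffunE eqxx mul1r.
  have ha (y : A) i : h (y * pa (Alpha i)) (1 : k^o) = 0.
    have := hB y (pr (pa (Alpha i))) (1 : k^o); rewrite /sub_ract pr_path // => ->.
    by rewrite /sub_lact borel_simpleE pr_path // ffunE mul0r h0r.
  pose y i : A := (x (Alpha i) : k) *: e2 + \sum_j (x (BetaAlpha j i) : k) *: pa (Beta j).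
  have pathZM c p q : c *: (pa p : A) * pa q = c *: (Ast_opath k (stcomp p q) : A).
    by rewrite -scalerAl Ast_pathM.
  have xE : x * e1 = \sum_i y i * pa (Alpha i).
    rewrite {1}(Ast_coord x) mulr_suml sum_stpath x0 scale0r mul0r.
    rewrite add0r pathZM /= scaler0 add0r.
    rewrite [X in _ + X + _]big1 => [|j _]; last by rewrite pathZM scaler0.
    rewrite addr0 [X in _ + X]exchange_big -big_split; apply: eq_bigr => i _ /=.
    rewrite /y mulrDl mulr_suml [in LHS]pathZM [in RHS]pathZM; congr (_ + _).
    by apply: eq_bigr => j _; rewrite [LHS]pathZM [RHS]pathZM.
  rewrite h1 xE.
  rewrite (big_morph (fun a => h a (1 : k^o)) (fun a b => hDl a b _) (h0l _)).
  by apply: big1 => i _; apply: ha.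
have [g [eg gP g0]] := standard_delta2 std.
apply: (@induced_of_generator _ _ g) => [z|b|V h hb x /g0 x0]; first exact: gP.
  rewrite -{1}eg -fdm_actM (_ : vsval b * e2 = vsval b (Triv vtx2) *: e2) ?actZ ?eg //.
  apply/ffunP => p; rewrite Ast_trivr !ffunE.
  have := Ast_borelP _ (subvsP b) p; case: p => [w|i|j|j i] /= bp.
  - by case: (ord2P w) => -> /=; rewrite ?mul0r ?mul1r ?[RHS]mulr0 ?[RHS]mulr1.
  - by rewrite mul0r [RHS]mulr0.
  - by rewrite bp // mulr0 [RHS]mulr0.
  - by rewrite bp // mulr0 [RHS]mulr0.
have [hDl hDr hB] := hb.
have h0l c : h 0 c = 0 by apply: (addIr (h 0 c)); rewrite -hDl !add0r.
have := hB x (pr e2) (1 : k^o); rewrite /sub_ract pr_path // x0 h0l => /esym <-.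
congr (h x _); by rewrite /sub_lact borel_simpleE pr_path // ffunE eqxx mul1r.
Qed.

Lemma Ast_exact_borel Delta : standard_modules (Ast_e k s t) Delta ->
  exact_borel Delta (Ast_borel k s t).
Proof.
move=> std; split.
- by exists (Ast_simple k s t); apply: Ast_complete_simples.
- exact: standard_systemP.
- exact: Ast_borel1.
exists borel => //; exists borel_simple; split.
- exact: borel_complete_simples.
- exact: borel_directed.
- exact: borel_induction_exact.
- by move=> v; apply: borel_induced.
Qed.

End Borel.

(** * Representation type *)

Section RepType.
Variables (k : fieldType) (s t : nat).
Local Notation A := (Ast k s t).
Local Notation al i := (Ast_path k (Alpha i) : A).

Lemma Kmod_indec_gt0 m n (a : 'I_s -> 'M[k]_(m, n)) :
  indecomposable (Kmod t a) -> (0 < m + n)%N.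
Proof.
case: m n a => [|m] [|n] a //= -[full0 _]; case: full0.
apply/vspaceP => x; rewrite memvf memv0; apply/esym/eqP/kspace_eq.
- by rewrite thinmx0.
- by rewrite thinmx0.
- by rewrite thinmx0.
Qed.

(** A nonzero entry of a_i gives x and g with x a_i g = 1. Then a_i g x and g x a_i are intertwined
    idempotents of rank one, so both must be identities. *)
Lemma Kmod_indec_rank1 m n (a : 'I_s -> 'M[k]_(m, n)) :
  indecomposable (Kmod t a) -> (exists i, a i != 0) -> (s <= 1)%N -> m = 1%N /\ n = 1%N.
Proof.
move=> ind [i ai0] s1.
have [r ri0] : exists r, row r (a i) != 0.
  apply/existsP; apply: contraNT ai0 => /existsPn r0; apply/eqP/row_matrixP => r.
  by rewrite row0; apply/eqP; have := r0 r; rewrite negbK.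
have [c rc] : exists c, a i r c != 0.
  apply/existsP; apply: contraNT ri0 => /existsPn c0; apply/eqP/rowP => c.
  by rewrite !mxE; apply/eqP; have := c0 c; rewrite negbK.
pose x : 'rV[k]_m := delta_mx 0 r; pose g : 'cV[k]_n := (a i r c)^-1 *: delta_mx c 0.
have xag : x *m a i *m g = 1%:M.
  rewrite -rowE /g -scalemxAr -colE; apply/matrixP => u v.
  by rewrite !mxE !ord1 mulVf.
have := @Kmod_indec _ _ _ _ _ _ (a i *m g *m x) (g *m (x *m a i)) ind.
case.
- transitivity (a i *m g *m (x *m a i *m g) *m x); first by rewrite !mulmxA.
  by rewrite xag mulmx1.
- transitivity (g *m (x *m a i *m g) *m (x *m a i)); first by rewrite !mulmxA.
  by rewrite xag mulmx1.
- move=> j; rewrite (_ : j = i) ?mulmxA //; apply: val_inj => /=.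
  by have := ltn_ord i; have := ltn_ord j; lia.
- move=> [_ F0]; have : x *m a i *m (g *m (x *m a i)) *m g = 0 by rewrite F0 mulmx0 mul0mx.
  by rewrite mulmxA xag mul1mx xag => /matrixP/(_ 0 0); rewrite !mxE => /eqP; rewrite oner_eq0.
- move=> [E1 F1]; have := mulmx1_min E1; have := mulmx1_min F1.
  have := mulmx1_min xag; move: (xag); rewrite -mulmxA => /mulmx1_min; lia.
Qed.

(** With zero matrices any two idempotents form a decomposition: (1, 0) forces m or n to be 0, and a
    diagonal matrix unit forces the other size to be 1. *)
Lemma Kmod_indec_zero m n (a : 'I_s -> 'M[k]_(m, n)) :
  indecomposable (Kmod t a) -> (forall i, a i = 0) ->
  (m = 1%N /\ n = 0%N) \/ (m = 0%N /\ n = 1%N).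
Proof.
move=> ind a0; have mn0 := Kmod_indec_gt0 ind.
have one0 p : (1%:M : 'M[k]_p) = 0 -> p = 0%N.
  move=> e; apply: (@eqP _ _ 0%N); rewrite -(mxrank1 k p) e; exact/eqP/mxrank0.
have idem p q (i : 'I_p) (j : 'I_q) : (delta_mx i j *m delta_mx j i : 'M[k]_p) = delta_mx i i.
  by rewrite mul_delta_mx.
have del p (i : 'I_p) : (delta_mx i i : 'M[k]_p) = 0 \/ (delta_mx i i : 'M[k]_p) = 1%:M -> p = 1%N.
  case=> [/matrixP/(_ i i)|e].
    by rewrite !mxE !eqxx => /eqP; rewrite oner_eq0.
  have /mulmx1_min : (delta_mx i 0 : 'cV_p) *m delta_mx 0 i = 1%:M :> 'M[k]_p.
    by rewrite mul_delta_mx.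
  by have := ltn_ord i; lia.
have [||i|[/one0 m0 _]|[_ /esym/one0 n0]] := @Kmod_indec _ _ _ _ _ _ 1%:M 0 ind.
- by rewrite mulmx1.
- by rewrite mulmx0.
- by rewrite a0 ?mulmx0 ?mul0mx.
- right; split=> //; have i : 'I_n by apply: (@Ordinal _ 0); lia.
  have [||j|[_ ?]|[_ ?]] := @Kmod_indec _ _ _ _ _ _ 0 (delta_mx i i) ind.
  + by rewrite mulmx0.
  + by rewrite mul_delta_mx.
  + by rewrite a0 ?mulmx0 ?mul0mx.
  + by apply: (del _ i); left.
  + by apply: (del _ i); right.
- left; split=> //; have i : 'I_m by apply: (@Ordinal _ 0); lia.
  have [||j|[? _]|[? _]] := @Kmod_indec _ _ _ _ _ _ (delta_mx i i) 0 ind.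
  + by rewrite mul_delta_mx.
  + by rewrite mulmx0.
  + by rewrite a0 ?mulmx0 ?mul0mx.
  + by apply: (del _ i); left.
  + by apply: (del _ i); right.
Qed.

Lemma filtered_finite_type Delta : standard_modules (Ast_e k s t) Delta -> (s <= 1)%N ->
  finite_type (filtered Delta).
Proof.
move=> std s1.
(* The indecomposable representations of the quiver of type A_2, of sizes (1,0), (0,1) and (1,1). *)
pose D (i : 'I_3) : fdmod A := match val i with
  | 0 => Kmod t (fun _ : 'I_s => 0 : 'M[k]_(1, 0))
  | 1 => Kmod t (fun _ : 'I_s => 0 : 'M[k]_(0, 1))
  | _ => Kmod t (fun _ : 'I_s => 1%:M : 'M[k]_1) end.
exists 3, D => X fX iX.
have [m [n [a Xa]]] := filtered_Kmod std fX.
have ia := indecomposable_iso (isomorphic_sym Xa) iX.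
suff [i ai] : exists i, isomorphic (Kmod t a) (D i).
  by exists i; apply: isomorphic_trans (isomorphic_sym Xa) ai.
case: (classic (exists i, a i != 0)) => [ne|all0].
  have [em en] := Kmod_indec_rank1 ia ne s1; subst m n; exists ord_max.
  have [i ai0] := ne; apply: (@Kmod_iso _ _ _ _ _ _ _ 1%:M (a i)); rewrite ?unitmx1 //.
    rewrite unitmxE det_mx11 unitfE; apply: contraNneq ai0 => e.
    by apply/eqP/matrixP => u v; rewrite !ord1 e mxE.
  move=> j; rewrite !mul1mx; congr (a _); apply: val_inj => /=.
  by have := ltn_ord i; have := ltn_ord j; lia.
have a0 i : a i = 0.
  by apply/eqP/negPn/negP => ai; apply: all0; exists i.
case: (Kmod_indec_zero ia a0) => -[em en]; subst m n.
  exists ord0; apply: (@Kmod_iso _ _ _ _ _ _ _ 1%:M 1%:M); rewrite ?unitmx1 // => i.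
  by rewrite a0 ?mulmx0 ?mul0mx.
exists (Ordinal (isT : 1 < 3)%N).
apply: (@Kmod_iso _ _ _ _ _ _ _ 1%:M 1%:M); rewrite ?unitmx1 // => i.
by rewrite a0 ?mulmx0 ?mul0mx.
Qed.

Definition Kline (x : 'I_s -> k) : fdmod A := Kmod t (fun i => (x i)%:M : 'M[k]_1).

(** The e2-part is the line of [f], so one summand contains [f], and with it everything outside the
    k^m component. The other summand V is then zero: alpha_i0 maps V into the first one, which
    leaves its vectors without k^m component. *)
Lemma Kline_indec x i0 : x i0 != 0 -> indecomposable (Kline x).
Proof.
move=> x0; pose f : Kline x := (0, 1%:M, 0); split.
  move/vspaceP/(_ f); rewrite memvf memv0 => /esym/eqP/(congr1 (fun u => u.1.2)) /matrixP/(_ 0 0).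
  by rewrite !mxE => /eqP; rewrite oner_eq0.
have main (U V : {vspace Kline x}) : is_submod U -> is_submod V -> (U :&: V)%VS = 0%VS ->
    f \in U -> V = 0%VS.
  move=> /is_submodP sU /is_submodP sV UV0 fU.
  have sub0 u : u.1.1 = 0 -> u \in U.
    move=> u0; rewrite [u](_ : _ = u.1.2 0 0 *: f + \sum_j u.2 j 0 *:
        fdm_act (Kline x) (Ast_path k (Beta j)) f).
      by rewrite memvD ?memvZ //; apply: memv_suml => j _; rewrite memvZ ?sU.
    have -> : \sum_j u.2 j 0 *: fdm_act (Kline x) (Ast_path k (Beta j)) f = (0, 0, u.2) :> Kline x.
      have uE : \sum_j u.2 j 0 *: delta_mx j 0 = u.2.
        apply/matrixP => i j; rewrite ord1 summxE (bigD1 i) //= !mxE !eqxx mulr1.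
        by rewrite big1 ?addr0 // => l li; rewrite !mxE eq_sym (negPf li) mulr0.
      rewrite -[in RHS]uE; elim/big_rec2: _ => // j y1 y2 _ ->; rewrite KmodE.
      by apply: kspace_eq; rewrite /= ?scaler0 ?addr0 ?mulmx1.
    apply: kspace_eq; rewrite /= ?scaler0 ?addr0 ?add0r //.
    by apply/matrixP => i j; rewrite !ord1 !mxE mulr1.
  apply/vspaceP => v; rewrite memv0; apply/idP/eqP => [vV|->]; last exact: mem0v.
  have : fdm_act (Kline x) (al i0) v \in (U :&: V)%VS.
    by rewrite memv_cap sV // andbT KmodE; apply: sub0.
  rewrite UV0 memv0 KmodE => /eqP/(congr1 (fun u => u.1.2)) /=.
  rewrite mul_mx_scalar => /eqP; rewrite scaler_eq0 (negPf x0) => /eqP v0.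
  by apply/eqP; rewrite -memv0 -UV0 memv_cap vV sub0.
move=> U V sU sV UV UV0.
have : f \in (U + V)%VS by rewrite UV memvf.
case/memv_addP => u uU [v vV fuv].
have e2f (W : {vspace Kline x}) (w : Kline x) : is_submod W -> w \in W -> w.1.2 != 0 -> f \in W.
  move=> /is_submodP sW wW w0; have w00 : w.1.2 0 0 != 0.
    by apply: contraNneq w0 => e; apply/eqP/matrixP => i j; rewrite !ord1 e mxE.
  rewrite (_ : f = (w.1.2 0 0)^-1 *: fdm_act (Kline x) (Ast_path k (Triv vtx2)) w).
    by rewrite memvZ // sW.
  rewrite KmodE; apply: kspace_eq; rewrite /= ?scaler0 //.
  by apply/matrixP => i j; rewrite !ord1 !mxE mulVf.
have [u0|/(e2f _ _ sU uU) fU] := eqVneq u.1.2 0; last by right; apply: main fU.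
have [v0|/(e2f _ _ sV vV) fV] := eqVneq v.1.2 0; last by left; apply: main fV => //; rewrite capvC.
have /matrixP/(_ 0 0) := congr1 (fun u => u.1.2) fuv; rewrite /= u0 v0 addr0 !mxE => /eqP.
by rewrite oner_eq0.
Qed.

(** An isomorphism invariant: the ratios of the alpha_i to alpha_i0 recover x from [Kline x] when x
    i0 = 1. *)
Definition alpha_ratio (M : fdmod A) i0 (x : 'I_s -> k) : Prop :=
  (exists z, fdm_act M (al i0) z <> 0) /\
  forall i z, fdm_act M (al i) z = x i *: fdm_act M (al i0) z.

Lemma Kline_ratio x i0 : x i0 = 1 -> alpha_ratio (Kline x) i0 x.
Proof.
move=> x1; split.
  exists (1%:M, 0, 0); rewrite KmodE /= => /(congr1 (fun u => u.1.2)) /matrixP/(_ 0 0).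
  by rewrite /= x1 mulmx1 !mxE => /eqP; rewrite oner_eq0.
move=> i z; rewrite !KmodE /=; apply: kspace_eq; rewrite /= ?scaler0 //.
by rewrite x1 mulmx1 mul_mx_scalar.
Qed.

Lemma alpha_ratio_iso M N i0 x y : isomorphic M N -> alpha_ratio M i0 x ->
  alpha_ratio N i0 y -> x =1 y.
Proof.
move=> [f [/is_homP hf /eqP/lker0P fi _]] [[z z0] Mx] [_ Ny] i.
have fz : fdm_act N (al i0) (f z) != 0.
  by apply/eqP; rewrite -hf => e; apply: z0; apply: fi; rewrite e lfun0.
have : x i *: fdm_act N (al i0) (f z) = y i *: fdm_act N (al i0) (f z).
  by rewrite -Ny -!hf (Mx i) lfunZ.
move/eqP; rewrite -subr_eq0 -scalerBl scaler_eq0 (negPf fz) orbF subr_eq0.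
by move/eqP.
Qed.

End RepType.

Lemma finite_avoid (k : closedFieldType) (l : seq k) : exists x, x \notin l.
Proof.
have [x] := closed_nonrootP (\prod_(y <- l) ('X - y%:P)) (monic_neq0 (monic_prod_XsubC _ _ _)).
by rewrite root_prod_XsubC => xl; exists x.
Qed.

Lemma finite_collect (T : eqType) (k : eqType) (l : seq T) (R : T -> k -> Prop) :
  (forall f, f \in l -> exists lf : seq k, forall y, R f y -> y \in lf) ->
  exists l' : seq k, forall f y, f \in l -> R f y -> y \in l'.
Proof.
elim: l => [|f l IH] H; first by exists [::].
have [lf fP] := H f (mem_head _ _); have [|l' lP] := IH.
  by move=> g gl; apply: H; rewrite inE gl orbT.
exists (lf ++ l') => g y; rewrite inE mem_cat => /orP[/eqP->|gl] Ry.
  by rewrite fP.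
by rewrite (lP g) ?orbT.
Qed.

Lemma finite_collect1 (T k : eqType) (l : seq T) (R : T -> k -> Prop) :
  (forall f y y', R f y -> R f y' -> y = y') ->
  exists l' : seq k, forall f y, f \in l -> R f y -> y \in l'.
Proof.
move=> R1; apply: finite_collect => f _.
case: (classic (exists y, R f y)) => [[y Ry]|nR].
  by exists [:: y] => y' /R1/(_ Ry) ->; rewrite inE.
by exists [::] => y Ry; case: nR; exists y.
Qed.

Section Infinite.
Variables (k : closedFieldType) (s t : nat).
Variable Delta : 'I_2 -> fdmod (Ast k s t).
Hypothesis std : standard_modules (Ast_e k s t) Delta.

Lemma Kline_filtered x : filtered Delta (Kline t x).
Proof. exact: (Kmod_filtered (standard_delta1 std) (standard_delta2 std)). Qed.

Lemma filtered_not_finite : (1 < s)%N -> ~ finite_type (filtered Delta).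
Proof.
move=> s1 [m [M MP]].
pose i0 : 'I_s := Ordinal (ltnW s1); pose i1 : 'I_s := Ordinal s1.
pose x (y : k) (i : 'I_s) : k := if i == i0 then 1 else y.
have [l lP] := @finite_collect1 _ k (enum 'I_m)
  (fun i y => isomorphic (Kline t (x y)) (M i))
  (fun i y y' yi y'i => let e := isomorphic_trans yi (isomorphic_sym y'i) in
    alpha_ratio_iso e (Kline_ratio t (erefl (x y i0))) (Kline_ratio t (erefl (x y' i0))) i1).
have [y yl] := finite_avoid l.
have [||i yi] := MP (Kline t (x y)); first exact: Kline_filtered.
  by apply: (@Kline_indec _ _ _ _ i0); rewrite oner_eq0.
by case/negP: yl; apply: (lP i); rewrite ?mem_enum.
Qed.

End Infinite.

(** * Families over k[T] and their specializations *)

Section Specialization.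
Variables (k : fieldType) (s t : nat).
Local Notation A := (Ast k s t).
Implicit Types X Y : fdmod A.

Lemma specialization_iso (N : bimod A) l X Y :
  isomorphic X Y -> specialization N l X -> specialization N l Y.
Proof.
move=> [f fi] [u [[[uDl uDr uB] univ] uA]]; have [/is_homP hf _ _] := fi.
have [g [/is_homP hg fK gK]] := is_iso_inv fi.
exists (fun x c => f (u x c)); split=> [|a x c]; last by rewrite uA hf.
split=> [|V h /univ[g0 g0E g0u]].
  by split=> [x y c|x c d|x p c]; rewrite ?uDl ?uDr ?uB ?lfunD.
pose G y := g0 (g y).
have GB : zmod_morphism G by move=> x y; rewrite /G lfunB raddfB.
exists (HB.pack G (GRing.isZmodMorphism.Build Y V G GB) : {additive Y -> V}) => [x c|G' G'E y].
  by rewrite /= /G fK g0E.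
pose H x := G' (f x).
have HZ : zmod_morphism H by move=> x z; rewrite /H lfunB raddfB.
rewrite /= /G -(g0u (HB.pack H (GRing.isZmodMorphism.Build X V H HZ) : {additive X -> V})) //=.
by rewrite /H gK.
Qed.

Variables (m n : nat) (a : 'I_s -> 'M[{poly k}]_(m, n)).

Definition Kbimod_act : A -> 'End(kspace t {poly k} m n) :=
  path_act (polyC : {rmorphism k -> {poly k}}) (kop a).

Fact Kbimod_linear c x y :
  Kbimod_act (c *: x + y) = c%:P *: Kbimod_act x + Kbimod_act y.
Proof. exact: path_act_linear. Qed.

Definition Kbimod : bimod A := @Bimod k A (kspace t {poly k} m n) Kbimod_act
  Kbimod_linear (path_act1 polyC (@kop_one s t {poly k} m n a))
  (path_actM polyC (kop_comp (t := t) a)).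

Variable l : k.
Local Notation ev := (horner_eval l).
Local Notation eval_mx := (map_mx ev).
Local Notation al := (fun i => eval_mx (a i)).

Definition keval (x : kspace t {poly k} m n) : kspace t k m n :=
  (eval_mx x.1.1, eval_mx x.1.2, eval_mx x.2).

Definition klift (x : kspace t k m n) : kspace t {poly k} m n :=
  (map_mx polyC x.1.1, map_mx polyC x.1.2, map_mx polyC x.2).

Lemma kevalD x y : keval (x + y) = keval x + keval y.
Proof. by apply: kspace_eq; rewrite /= map_mxD. Qed.

Lemma kevalZ p x : keval (p *: x) = p.[l] *: keval x.
Proof. by apply: kspace_eq; rewrite /= map_mxZ. Qed.

Lemma kliftD x y : klift (x + y) = klift x + klift y.
Proof. by apply: kspace_eq; rewrite /= map_mxD. Qed.

Lemma kliftZ c x : klift (c *: x) = c%:P *: klift x.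
Proof. by apply: kspace_eq; rewrite /= map_mxZ. Qed.

(** Entrywise division by X - l: it shows that a vector and its constant lift differ by an element
    that vanishes in the tensor product with k_l. *)
Lemma klift_eval x : exists y, x = ('X - l%:P) *: y + klift (keval x).
Proof.
pose q (p : {poly k}) := (p - p.[l]%:P) %/ ('X - l%:P).
have qE p : p = ('X - l%:P) * q p + p.[l]%:P.
  apply/eqP; rewrite -subr_eq mulrC /q divpK // dvdp_XsubCl.
  by rewrite /root !hornerE subrr.
exists (map_mx q x.1.1, map_mx q x.1.2, map_mx q x.2).
by apply: kspace_eq; apply/matrixP => i j; rewrite !mxE; apply: qE.
Qed.

Lemma keval_fun p x : keval (kfun a p x) = kfun al p (keval x).
Proof.
case: p => [v|i|j|j i] /=; try case: ifP => _;
  by apply: kspace_eq; rewrite /= ?map_mx0 ?map_mxM ?map_delta_mx.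
Qed.

Lemma keval_act c x : keval (Kbimod_act c x) = fdm_act (Kmod t al) c (keval x).
Proof.
have kevals I (r : seq I) (F : I -> kspace t {poly k} m n) :
    keval (\sum_(i <- r) F i) = \sum_(i <- r) keval (F i).
  apply: (big_morph keval kevalD).
  by apply: kspace_eq; rewrite /= map_mx0.
rewrite [Kbimod_act c x]path_actE kevals {2}(Ast_coord c) act_sum.
apply: eq_bigr => p _; rewrite kevalZ hornerC actZ; congr (_ *: _).
by rewrite KmodE kopE keval_fun.
Qed.

(** A balanced map kills the multiples of X - l, so its values on the lifts of constant vectors
    determine it. *)
Lemma Kbimod_specialization : specialization Kbimod l (Kmod t al).
Proof.
exists (fun x c => c *: keval x); split=> [|c x d]; last first.
  by rewrite keval_act lfunZ.
split=> [|V h [hDl hDr hB]].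
  split=> [x y c|x c d|x p c]; first by rewrite kevalD scalerDr.
    by rewrite scalerDl.
  by rewrite kevalZ scalerA mulrC.
have h0 x : h x 0 = 0 by apply: (addIr (h x 0)); rewrite -hDr !add0r.
pose G (z : Kmod t al) := h (klift z) 1.
have GD : {morph G : x y / x + y} by move=> x y; rewrite /G kliftD hDl.
have GB : zmod_morphism G.
  by move=> x y; apply: (addIr (G y)); rewrite -GD !subrK.
have GE x c : G (c *: keval x) = h x c.
  rewrite /G kliftZ hB hornerC mulr1; have [y {2}->] := klift_eval x.
  by rewrite hDl hB !hornerE subrr mul0r h0 add0r.
exists (HB.pack G (GRing.isZmodMorphism.Build (Kmod t al) V G GB) :
  {additive Kmod t al -> V}) => [x c|G' G'E z]; first exact: GE.
have zE : z = 1 *: keval (klift z).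
  by rewrite scale1r; apply: kspace_eq; apply/matrixP => i j; rewrite !mxE /horner_eval hornerC.
by rewrite /= {1}zE G'E {2}zE GE.
Qed.

End Specialization.

Section Tame.
Variables (k : closedFieldType) (t : nat).
Variable Delta : 'I_2 -> fdmod (Ast k 2 t).
Hypothesis std : standard_modules (Ast_e k 2 t) Delta.

Definition pencil_seq (R : Type) m n (a b : 'M[R]_(m, n)) (i : 'I_2) :=
  if i == vtx1 then a else b.

Lemma Kmod_pencil_indec m n (a : 'I_2 -> 'M[k]_(m, n)) :
  indecomposable (Kmod t a) -> pencil_indec (a vtx1) (a vtx2).
Proof.
move=> ind E F EE FF Ea Eb; apply: Kmod_indec ind EE FF _ => i.
by case: (ord2P i) => ->.
Qed.

Lemma Kmod_pencil_equiv m n (a a' : 'I_2 -> 'M[k]_(m, n)) :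
  pencil_equiv (a vtx1) (a vtx2) (a' vtx1) (a' vtx2) ->
  isomorphic (Kmod t a) (Kmod t a').
Proof.
move=> [P [Q [uP uQ e1 e2]]]; apply: (Kmod_iso _ uP uQ) => i.
by case: (ord2P i) => ->.
Qed.

Lemma dim_kspace m n : dim (kspace t k m n) = (m + n + t * n)%N.
Proof. by rewrite -[LHS]/(1 * m + 1 * n + t * n)%N !mul1n. Qed.

Lemma map_jordan_mx n (l : k) :
  map_mx (horner_eval l) (jordan_mx n 'X) = jordan_mx n l.
Proof.
apply/matrixP => i j; rewrite !mxE /horner_eval hornerD !hornerMn hornerX.
by rewrite hornerC.
Qed.

Definition jordan_bimod (nb : nat * bool) : bimod (Ast k 2 t) :=
  let: (n, b) := nb in
  Kbimod t (if b then pencil_seq 1%:M (jordan_mx n 'X)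
            else pencil_seq (jordan_mx n 'X) 1%:M).

Lemma filtered_tame : tame (filtered Delta).
Proof.
split=> [|d _]; first exact: filtered_not_finite.
(* One representative for each size with m <> n; a size without indecomposables gets the zero module
   as a placeholder. *)
have /choose_fun[D DP] : forall mn : nat * nat, exists D : fdmod (Ast k 2 t),
    mn.1 != mn.2 -> forall a : 'I_2 -> 'M[k]_(mn.1, mn.2),
    indecomposable (Kmod t a) -> isomorphic (Kmod t a) D.
  move=> [m n]; case: (classic (exists a : 'I_2 -> 'M[k]_(m, n), indecomposable (Kmod t a))).
    move=> [a0 i0]; exists (Kmod t a0) => mn a ia; apply: Kmod_pencil_equiv.
    by apply: pencil_unique => //; apply: Kmod_pencil_indec.
  by move=> none; exists (Kmod t (fun=> 0 : 'M_(0,0))) => _ a ia; case: none; exists a.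
(* The dimension m + n + t n = d bounds m and n by d. The boolean tells which of the two matrices is
   the identity, the other one being the Jordan block. *)
pose I1 := ('I_d.+1 * bool)%type; pose I2 := ('I_d.+1 * 'I_d.+1)%type.
exists #|{: I1}|, (fun i => jordan_bimod (val (enum_val i).1, (enum_val i).2)).
exists #|{: I2}|, (fun i => D (val (enum_val i).1, val (enum_val i).2)).
move=> X fX iX dX; have [m [n [a aX]]] := filtered_Kmod std fX.
have ia := indecomposable_iso (isomorphic_sym aX) iX.
have mnd : (m < d.+1)%N /\ (n < d.+1)%N.
  have [f [_ /eqP kf imf]] := aX.
  have := limg_dim_eq (f := f) (U := fullv); rewrite (eqP kf) capv0 => /(_ erefl).
  rewrite imf dX [in RHS]dimvf [in RHS]dim_kspace; lia.
have [em|en] := eqVneq m n; last first.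
  left; exists (enum_rank (Ordinal mnd.1 : 'I_d.+1, Ordinal mnd.2 : 'I_d.+1)).
  by rewrite enum_rankK; apply: isomorphic_trans (isomorphic_sym aX) (DP (m, n) en a ia).
right; subst m.
have n0 : (0 < n)%N by have := Kmod_indec_gt0 ia; lia.
have [l] := pencil_jordan n0 (Kmod_pencil_indec ia).
have spec (a' : 'I_2 -> 'M[{poly k}]_n) :
    pencil_equiv (a vtx1) (a vtx2)
      (map_mx (horner_eval l) (a' vtx1)) (map_mx (horner_eval l) (a' vtx2)) ->
    specialization (Kbimod t a') l X.
  move=> e; have := Kbimod_specialization t a' l; apply: specialization_iso.
  by apply: isomorphic_trans (isomorphic_sym _) aX; apply: Kmod_pencil_equiv.
case=> e; [exists (enum_rank (Ordinal mnd.1 : 'I_d.+1, true)) |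
           exists (enum_rank (Ordinal mnd.1 : 'I_d.+1, false))];
  by exists l; rewrite enum_rankK; apply: spec; rewrite /= map_jordan_mx map_mx1.
Qed.

End Tame.

(** * At least three arrows from 1 to 2 *)

Section Wild.
Variables (k : closedFieldType) (s t : nat).
Local Notation A := (Ast k s t).
Local Notation al i := (Ast_path k (Alpha i) : A).

Section Coefficients.
Import VectorInternalTheory.
Variable N : bimod A.

(** Each f consists of the entries of the alpha_i at one fixed position of their matrices over k[T].
    The ratios on the specialization at l are those of the values at l, for a position where
    alpha_i0 does not vanish. So [N] contributes finitely many rational curves of ratios. *)
Lemma specialization_ratio (i0 : 'I_s) :
  exists fs : seq {ffun 'I_s -> {poly k}}, forall l X x,
    specialization N l X -> alpha_ratio X i0 x ->
    exists f, [/\ f \in fs, (f i0).[l] != 0 & forall i, (f i).[l] = x i * (f i0).[l]].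
Proof.
pose r := dim N; pose b (j : 'I_r) : N := @r2v {poly k} N (delta_mx 0 j).
pose co (j : 'I_r) (v : N) : {poly k} := v2r v 0 j.
have coE v : v = \sum_j co j v *: b j.
  apply: (can_inj v2rK); rewrite linear_sum [LHS]row_sum_delta.
  by apply: eq_bigr => j _; rewrite linearZ /= r2vK.
have coD j u v : co j (u + v) = co j u + co j v by rewrite /co linearD mxE.
have coZ j p v : co j (p *: v) = p * co j v by rewrite /co linearZ mxE.
pose F (jh : 'I_r * 'I_r) : {ffun 'I_s -> {poly k}} :=
  [ffun i => co jh.2 (bm_act N (al i) (b jh.1))].
exists [seq F jh | jh <- enum {: 'I_r * 'I_r}] => l X x [u [[[uDl uDr uB] univ] uA]] [[z z0] ratio].
have act0l v : bm_act N 0 v = 0.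
  have := bm_act_linear N 1 0 0; rewrite scale1r addr0 => /lfunP/(_ v).
  rewrite add_lfunE scale_lfunE scale1r => /eqP.
  by rewrite -subr_eq0 opprD addrA subrr sub0r oppr_eq0 => /eqP.
have actc c v : bm_act N c%:A v = c%:P *: v.
  rewrite -[c%:A]addr0 bm_act_linear add_lfunE scale_lfunE act0l addr0.
  by rewrite bm_act1.
(* A scalar of k acts on [X] through A, and on [N] it acts as the constant polynomial; balancedness
   joins the two. *)
have uc v c : u v c = c *: u v 1.
  rewrite -[in LHS](mulr1 c) -{1}(hornerC c l) -uB -actc uA actZ.
  by rewrite fdm_act1.
have u0r v : u v 0 = 0 by apply: (addIr (u v 0)); rewrite -uDr !add0r.
have u0l c : u 0 c = 0 by apply: (addIr (u 0 c)); rewrite -uDl !add0r.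
have usum I (R : seq I) (G : I -> N) c : u (\sum_(i <- R) G i) c = \sum_(i <- R) u (G i) c.
  exact: (big_morph (fun v => u v c) (fun v w => uDl v w c) (u0l c)).
have coef j (h : 'I_r) i : (F (j, h) i).[l] = x i * (F (j, h) i0).[l].
  (* The h-th coordinate evaluated at l is balanced, hence factors through [X], where the ratio of
     alpha_i to alpha_i0 is known. *)
  pose H (v : N) (c : k) : k^o := (co h v).[l] * c.
  have [|g gE _] := univ _ H.
    split=> [v w c|v c d|v p c]; rewrite /H ?coD ?coZ ?hornerE ?mulrDl ?mulrDr //.
    by congr (_ * c); apply: mulrC.
  have := gE (bm_act N (al i) (b j)) 1; rewrite /H mulr1 /F !ffunE => <-.
  rewrite uA ratio -uA -uc gE /H mulrC; congr (_ * _).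
case: (classic (exists jh, (F jh i0).[l] != 0)) => [[[j h] nz]|none].
  exists (F (j, h)); split=> //; by apply: map_f; rewrite mem_enum.
(* If every entry of alpha_i0 vanished at l, alpha_i0 would be zero on the image of [u], and by
   uniqueness in the universal property on all of [X]. *)
have al0 v c : fdm_act X (al i0) (u v c) = 0.
  rewrite -uA uc [v]coE; suff -> : u (bm_act N (al i0) (\sum_j co j v *: b j)) 1 = 0.
    by rewrite scaler0.
  rewrite lfun_sum usum big1 // => j1 _; rewrite lfunZ uB mulr1 uc uA.
  rewrite -uA [bm_act _ _ _]coE usum big1 ?scaler0 // => h1 _.
  rewrite uB mulr1; suff -> : (co h1 (bm_act N (al i0) (b j1))).[l] = 0 by rewrite u0r.
  apply/eqP/negPn/negP => nz; apply: none; exists (j1, h1); by rewrite /F ffunE.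
have [|g _ gu] := univ X (fun _ _ => 0); first by split=> *; rewrite ?addr0.
have B1 : zmod_morphism (fun z : X => fdm_act X (al i0) z) by move=> v w; rewrite lfunB.
have B2 : zmod_morphism (fun z : X => 0 : X) by move=> v w; rewrite subrr.
case: z0.
have := gu (HB.pack (fun z : X => fdm_act X (al i0) z)
  (GRing.isZmodMorphism.Build X X _ B1) : {additive X -> X}) al0 z.
have := gu (HB.pack (fun z : X => 0 : X)
  (GRing.isZmodMorphism.Build X X _ B2) : {additive X -> X}) (fun _ _ => erefl) z.
by move=> /= <-.
Qed.

End Coefficients.

Variable Delta : 'I_2 -> fdmod (Ast k s t).
Hypothesis std : standard_modules (Ast_e k s t) Delta.

Lemma poly_roots (p : {poly k}) : p != 0 -> exists l : seq k, forall x, p.[x] = 0 -> x \in l.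
Proof.
move=> p0; have [r pE] := closed_field_poly_normal p; exists r => x px.
have : root p x by apply/eqP.
by rewrite pE rootZ ?lead_coef_eq0 // root_prod_XsubC.
Qed.

(** The modules [Kline] with ratios (1, x, y, ...) cannot lie on finitely many curves: x is chosen
    so that no curve has constant first ratio x, and then only finitely many y are reached. *)
Lemma filtered_not_tame : (2 < s)%N -> ~ tame (filtered Delta).
Proof.
move=> s2 [_ tm].
have [s1 s0] : (1 < s)%N /\ (0 < s)%N by lia.
pose i0 : 'I_s := Ordinal s0; pose i1 : 'I_s := Ordinal s1; pose i2 : 'I_s := Ordinal s2.
pose xy (x y : k) (i : 'I_s) : k := if i == i0 then 1 else if i == i1 then x else y.
pose d := \dim {: kspace t k 1 1}.
have [|m [N [r [E NE]]]] := tm d.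
  rewrite lt0n dimv_eq0; apply/eqP => /vspaceP/(_ (1%:M, 0, 0)).
  rewrite memvf memv0 => /esym/eqP/(congr1 (fun u => u.1.1)) /matrixP/(_ 0 0).
  by rewrite !mxE => /eqP; rewrite oner_eq0.
have /choose_fun[fs fsP] : forall i : 'I_m, _ := fun i => specialization_ratio (N i) i0.
pose l := flatten [seq fs i | i <- enum 'I_m].
have lfs i f : f \in fs i -> f \in l.
  by move=> fi; apply/flatten_mapP; exists i; rewrite ?mem_enum.
(* The values x for which some curve satisfies f_1 = x f_0 identically, at most one for each f with
   f_0 nonzero. *)
have [bx bxP] : exists bx : seq k, forall f x, f \in l ->
    f i0 != 0 /\ f i1 = x *: f i0 -> x \in bx.
  apply: finite_collect1 => f x x' [f0 ->] [_ /eqP].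
  by rewrite -subr_eq0 -scalerBl scaler_eq0 (negPf f0) orbF subr_eq0 => /eqP.
have [x xbx] := finite_avoid bx.
(* For x outside [bx], the polynomial f_1 - x f_0 is nonzero whenever f_0 is; each of its finitely
   many roots gives at most one y. *)
have [bz bzP] : exists bz : seq k, forall f y, f \in l ->
    (exists l, [/\ (f i0).[l] != 0, (f i1).[l] = x * (f i0).[l] & (f i2).[l] = y * (f i0).[l]]) ->
    y \in bz.
  apply: finite_collect => f fl; have [f0|f0] := eqVneq (f i0) 0.
    by exists [::] => y [z []]; rewrite f0 horner0 eqxx.
  have [|rs rsP] := @poly_roots (f i1 - x *: f i0).
    by apply: contraNneq xbx => /eqP; rewrite subr_eq0 => /eqP e; apply: (bxP f).
  exists [seq (f i2).[z] / (f i0).[z] | z <- rs] => y [z [z0 z1 z2]].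
  apply/mapP; exists z; last by rewrite z2 mulfK.
  by apply: rsP; rewrite !hornerE z1 subrr.
have [bE bEP] : exists bE : seq k, forall i y, i \in enum 'I_r ->
    isomorphic (Kline t (xy x y)) (E i) -> y \in bE.
  apply: finite_collect1 => i y y' yi y'i.
  have e := isomorphic_trans yi (isomorphic_sym y'i).
  exact: (alpha_ratio_iso e (Kline_ratio t (erefl (xy x y i0)))
    (Kline_ratio t (erefl (xy x y' i0))) i2).
have [y] := finite_avoid (bz ++ bE); rewrite mem_cat => /norP[ybz ybE].
have [||//|[i Xi]|[i [z spec]]] := NE (Kline t (xy x y)).
- exact: Kline_filtered.
- by apply: (@Kline_indec _ _ _ _ i0); rewrite oner_eq0.
- by case/negP: ybE; apply: (bEP i); rewrite ?mem_enum.
have [f [fi f0 fx]] := fsP i z _ _ spec (Kline_ratio t (erefl (xy x y i0))).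
case/negP: ybz; apply: (bzP f); first exact: lfs fi.
by exists z; split=> //; apply: fx.
Qed.

End Wild.

Local Close Scope ring_scope.

Theorem theorem4p58 (k : closedFieldType) :
  (forall A : falgType k, quasi_hereditary A 2 ->
     exists s t : nat, morita_equivalent A (Ast k s t)) /\
  (forall s t : nat,
     (exists Delta : 'I_2 -> fdmod (Ast k s t),
        standard_modules (Ast_e k s t) Delta) /\
     (forall Delta : 'I_2 -> fdmod (Ast k s t),
        standard_modules (Ast_e k s t) Delta ->
        [/\ exact_borel Delta (Ast_borel k s t),
            finite_type (filtered Delta) <-> (s <= 1)%N
          & tame (filtered Delta) <-> s = 2])).
Proof.
split=> [A|s t]; first exact: quasi_hereditary2_morita.
split; first exact: standard_modules_exist.
move=> Delta std; split; first exact: Ast_exact_borel.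
  split=> [fin|]; last exact: filtered_finite_type.
  by rewrite leqNgt; apply/negP => /(filtered_not_finite std); apply.
split=> [tm|es]; last by subst s; apply: filtered_tame.
case: (ltngtP s 2) => // [s1|s3]; last by case: (filtered_not_tame std s3).
by case: tm => nfin _; case: nfin; apply: filtered_finite_type.
Qed.
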